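(* Let $\mathbb G=(\mathbb V,\mathbb E)$ be an infinite connected non-amenable graph with bounded degrees, with random-walk transition matrix $P_{\mathbb G}$. For each $n\ge1$, choose an arbitrary $n$-element subset $V_n\subseteq\mathbb V$, let $K_n=P_{\mathbb G}[V_n]$ be the restriction of $P_{\mathbb G}$ to $V_n^2$, let $\nu_n$ be the uniform law on $V_n$, and let $\lambda_n\in(0,\infty)$. Then, as $n\to\infty$, the $\mathrm{ARW}(K_n,\lambda_n,\nu_n)$ chain satisfies $$t_{\mathrm{rel}}^{(n)}=\Theta(n),\qquad t_{\mathrm{sep}}^{(n)}=\Theta(n\log n),$$ and there is a separation cutoff with window $O(n\sqrt{\log n})$.
   Context: Graph notions: $P_{\mathbb G}(x,y)=1/\deg(x)$ if $\{x,y\}\in\mathbb E$ and $0$ otherwise. $\mathbb G$ is non-amenable if $\inf\{|\partial V|/|V|\colon V\subseteq\mathbb V,\ 0<|V|<\infty\}>0$, where $\partial V$ is the set of vertices in $\mathbb V\setminus V$ having a neighbor in $V$. Given a finite set $V$ and a sub-stochastic matrix $K\colon V^2\to[0,1]$ (i.e. $\sum_{y}K(x,y)\le1$) having no stochastic principal sub-matrix, a $K$-walk is the killed random walk which, when alive at $x$, jumps to $y\in V$ at rate $K(x,y)$ and is killed at rate $1-\sum_yK(x,y)$. ARW dynamics with sleeping rate $\lambda\in(0,\infty)$: a configuration is $\eta\in\{0,\mathrm s,1,2,\ldots\}^V$; the site $x$ is empty if $\eta(x)=0$, holds one sleeping particle if $\eta(x)=\mathrm s$, and holds $k\ge1$ active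 particles if $\eta(x)=k$. In continuous time, active particles perform independent $K$-walks (a killed particle is removed), but fall asleep at rate $\lambda$ when alone on a site; sleeping particles do not move, but become active upon contact with another particle. Configurations in $\{0,\mathrm s\}^V$ are stable, and from any configuration with finitely many particles the process is almost surely absorbed in a stable configuration. The $\mathrm{ARW}(K,\lambda,\nu)$ chain is the discrete-time Markov chain on $\mathcal X=\{0,\mathrm s\}^V$ which at each step adds one active particle to the current state at an independent $\nu$-distributed random site and then runs the ARW dynamics until a stable configuration is obtained; the latter is the new state. Its transition matrix $P$ is irreducible and aperiodic, with unique invariant distribution $\pi$. $t_{\mathrm{rel}}:=\frac1{1-\rho}$ with $\rho:=\max\{|z|\colon z\in\mathbb C\setminus\{1\}\text{ is an eigenvalue of }P\}$; $d_{\mathrm{sep}}(t):=\max_{\eta,\eta'\in\mathcal X}\big(1-\frac{P^t(\eta,\eta')}{\pi(\eta')}\big)$; $t_{\mathrm{sep}}(\varepsilon):=\inf\{t\in\mathbb N\colon d_{\mathrm{sep}}(t)\le\varepsilon\}$, $t_{\mathrm{sep}}:=t_{\mathrm{sep}}(1/2)$, with $\mathbb N=\{0,1,2,\dots\}$. Quantities of the $n$-th chain carry the superscript $(n)$. A sequence of chains exhibits separation cutoff if for any fixed $\alpha\ge0$, $d_{\mathrm{sep}}^{(n)}(\lfloor\alpha t_{\mathrm{sep}}^{(n)}\rfloor)$ tends to $1$ if $\alpha<1$ and to $0$ if $\alpha>1$. The cutoff has window $O(w_n)$ if moreover, for every fixed $\varepsilon\in(0,1/2)$, $t_{\mathrm{sep}}^{(n)}(\varepsilon)-t_{\mathrm{sep}}^{(n)}(1-\varepsilon)=O(w_n)$.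 *)

(* Defs.v *)
From mathcomp Require Import all_boot all_order all_algebra finmap.
From mathcomp Require Import all_classical all_reals all_analysis.
From mathcomp Require Import complex.

Set Implicit Arguments.
Unset Strict Implicit.
Unset Printing Implicit Defensive.

Import Order.TTheory GRing.Theory Num.Theory.
Import numFieldNormedType.Exports.

Local Open Scope classical_set_scope.
Local Open Scope ring_scope.

(* A simple graph on VV is given by a symmetric irreflexive adjacency relation. *)

Definition nbrs (VV : choiceType) (adj : rel VV) (x : VV) : set VV :=
  [set y | adj x y].

(* fset_set A is junk (empty) for infinite A; every use below concerns graphs
   of bounded degree, where nbrs x and boundary A are finite. *)
Definition degree (VV : choiceType) (adj : rel VV) (x : VV) : nat :=
  #|` fset_set (nbrs adj x)|%fset.

Definition bounded_degree (VV : choiceType) (adj : rel VV) : Prop :=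
  exists D : nat, forall x, finite_set (nbrs adj x) /\ (degree adj x <= D)%N.

Definition connected_graph (VV : choiceType) (adj : rel VV) : Prop :=
  forall x y, exists p : seq VV, path adj x p /\ last x p = y.

Definition boundary (VV : choiceType) (adj : rel VV) (A : {fset VV}) : set VV :=
  [set y | y \notin A /\ exists2 x, x \in A & adj x y].

Definition nonamenable (R : realType) (VV : choiceType) (adj : rel VV) : Prop :=
  0 < inf [set r : R | exists A : {fset VV}, A != fset0 /\
             r = #|` fset_set (boundary adj A)|%fset%:R / #|` A|%fset%:R].

Definition rw_kernel (R : realType) (VV : choiceType) (adj : rel VV)
    (x y : VV) : R :=
  if adj x y then (degree adj x)%:R^-1 else 0.

(* Activated random walks on a finite set V.
   State of a site: None is the sleeping particle "s", Some k is k active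
   particles (so Some 0 is the empty site). *)
Definition config (V : finType) := {ffun V -> option nat}.

Definition set_site (V : finType) (eta : config V) (x : V) (s : option nat) :
    config V :=
  [ffun z => if z == x then s else eta z].

Definition nactive (s : option nat) : nat := if s is Some k then k else 0.

(* A particle arriving on a sleeping one wakes it up: s + 1 = 2. *)
Definition add_active (V : finType) (x : V) (eta : config V) : config V :=
  set_site eta x (if eta x is Some k then Some k.+1 else Some 2).

(* Only used, through the rates below, when eta x = Some k with 0 < k. *)
Definition remove_active (V : finType) (x : V) (eta : config V) : config V :=
  set_site eta x (if eta x is Some k then Some k.-1 else None).

Definition jump (V : finType) (x y : V) (eta : config V) : config V :=
  add_active y (remove_active x eta).

Definition fall_asleep (V : finType) (x : V) (eta : config V) : config V :=
  set_site eta x None.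

(* Infinitesimal generator of the continuous-time dynamics: each active particle
   at x jumps to y at rate K x y and is killed at rate 1 - \sum_y K x y; a lone
   active particle falls asleep at rate lambda. *)
Definition arw_generator (R : realType) (V : finType) (K : V -> V -> R)
    (lambda : R) (f : config V -> R) (eta : config V) : R :=
  \sum_(x : V)
    ((nactive (eta x))%:R *
       (\sum_(y : V) K x y * (f (jump x y eta) - f eta)
        + (1 - \sum_(y : V) K x y) * (f (remove_active x eta) - f eta))
     + (if eta x == Some 1%N then lambda * (f (fall_asleep x eta) - f eta)
        else 0)).

(* The semigroup exp(t L), i.e. E_eta[f(eta_t)]. The series converges for every
   f, because the particle number does not increase: only finitely many
   configurations can be reached from eta. *)
Definition arw_semigroup (R : realType) (V : finType) (K : V -> V -> R)
    (lambda t : R) (f : config V -> R) (eta : config V) : R :=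
  limn (series (fun k : nat =>
    t ^+ k / (k`!)%:R * iter k (arw_generator K lambda) f eta)).

(* Probability that the dynamics started from eta is absorbed in the stable
   configuration xi: the limit of P_eta(eta_t = xi) as t -> +oo. *)
Definition arw_absorption (R : realType) (V : finType) (K : V -> V -> R)
    (lambda : R) (eta xi : config V) : R :=
  lim ((fun t : R => arw_semigroup K lambda t (fun zeta => (zeta == xi)%:R) eta)
         @ +oo).

(* {0, s}^V; true stands for s. *)
Definition stable_config (V : finType) := {ffun V -> bool}.

Definition of_stable (V : finType) (eta : stable_config V) : config V :=
  [ffun x => if eta x then None else Some 0%N].

Definition ARW (R : realType) (V : finType) (K : V -> V -> R) (lambda : R)
    (nu : V -> R) (eta xi : stable_config V) : R :=
  \sum_(x : V)
    nu x * arw_absorption K lambda (add_active x (of_stable eta)) (of_stable xi).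

Definition chain_mx (R : realType) (X : finType) (P : X -> X -> R) :
    'M[R]_#|X| :=
  \matrix_(i, j) P (enum_val i) (enum_val j).

Definition chain_pow (R : realType) (X : finType) (P : X -> X -> R) (t : nat)
    (x y : X) : R :=
  (chain_mx P ^+ t) (enum_rank x) (enum_rank y).

Definition is_invariant (R : realType) (X : finType) (P : X -> X -> R)
    (pi : {ffun X -> R}) : Prop :=
  [/\ forall x, 0 <= pi x, \sum_x pi x = 1
    & forall y, \sum_x pi x * P x y = pi y].

Definition invariant_law (R : realType) (X : finType) (P : X -> X -> R) :
    {ffun X -> R} :=
  xget [ffun=> 0] [set pi | is_invariant P pi].

(* The maximum of a finite set of reals is written as its supremum. *)
Definition spectral_rho (R : realType) (X : finType) (P : X -> X -> R) : R :=
  sup [set r : R | exists z : R[i],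
         [/\ z != 1, eigenvalue (map_mx (real_complex R) (chain_mx P)) z
           & r = complex.Re `|z|]].

Definition t_rel (R : realType) (X : finType) (P : X -> X -> R) : R :=
  (1 - spectral_rho P)^-1.

Definition d_sep (R : realType) (X : finType) (P : X -> X -> R) (t : nat) : R :=
  sup [set r : R | exists x y : X,
         r = 1 - chain_pow P t x y / invariant_law P y].

(* Least t with d_sep t <= eps (such t exist for irreducible aperiodic P). *)
Definition t_sep (R : realType) (X : finType) (P : X -> X -> R) (eps : R) : nat :=
  xget 0%N [set t : nat | d_sep P t <= eps /\
              forall s : nat, d_sep P s <= eps -> (t <= s)%N].

Definition separation_cutoff (R : realType) (X : nat -> finType)
    (P : forall n, X n -> X n -> R) : Prop :=
  forall alpha : R, 0 <= alpha ->
    let d n := d_sep (P n) (Num.truncn (alpha * (t_sep (P n) 2^-1)%:R)) in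
    (alpha < 1 -> d n @[n --> \oo] --> (1 : R)) /\
    (1 < alpha -> d n @[n --> \oo] --> (0 : R)).

Definition separation_cutoff_with_window (R : realType) (X : nat -> finType)
    (P : forall n, X n -> X n -> R) (w : nat -> R) : Prop :=
  separation_cutoff P /\
  forall eps : R, 0 < eps < 2^-1 ->
    (fun n => (t_sep (P n) eps)%:R - (t_sep (P n) (1 - eps))%:R : R) =O_\oo w.

(* Main.v *)
Require Import Defs.
From mathcomp Require Import all_boot all_order all_algebra finmap.
From mathcomp Require Import all_classical all_reals all_analysis.
From mathcomp Require Import complex lra ring zify.

Set Implicit Arguments.
Unset Strict Implicit.
Unset Printing Implicit Defensive.

Import Order.TTheory GRing.Theory Num.Theory.
Import numFieldNormedType.Exports.

Local Open Scope ring_scope.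

(* Sites are filled by internal DLA: an inserted particle performs a [K]-walk
   until it is killed or reaches a site that is not yet occupied, where it
   settles. By the abelian property, the ARW chain started from any state is
   exactly stationary once all sites have been filled by the inserted particles,
   whatever that state was; and from the empty state it cannot reach the state
   where all sites hold a sleeping particle before that time. So the separation
   distance at time [t] is the probability that internal DLA started from the
   empty set has not filled [V] after [t] insertions.

   Let [tau] be the filling time and [hit x] the probability that a walk started
   from a [nu]-random site visits [x]. Adding one occupied site lowers the mean
   remaining filling time by at most the maximum of [1 / hit x], which is at most
   [n]; as the mean decreases by 1 per step on average, the variance of [tau] is
   at most [n] times its mean, and Chebyshev's inequality gives the cutoff and its
   window. Comparison with coupon collecting yields [E tau <= n H_n], and
   [E tau >= c n log n] provided [hit x = O(1/n)] for at least half of the sites.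
   Non-amenability gives the latter: by Cheeger's inequality the exit time from
   [V_n], averaged over the starting point, is bounded, i.e. the sum of the
   [hit x] is.

   Finally, the laws of the stabilized configurations intertwine internal DLA with
   the ARW chain; since [1 - hit x] is an eigenvalue of the former, with left
   eigenvector supported on [V \ x] and [V], it is one of the latter, while all
   eigenvalues other than 1 are bounded in modulus by the decay rate [1 - 1/n] of
   the separation distance. *)

(** * Walks killed outside a finite set *)

(** No probability space is built. Stabilization is the kernel [stab], and expectations after
    stabilization are the bounded functions invariant under every legal toppling; two of them agree
    once they agree on stable configurations. Identities between laws thus reduce to checking
    invariance and stable values. Uniqueness needs a certificate that the walks die: a function
    [g >= 0] with [1 + K g <= g], in the role of the absence of stochastic principal sub-matrices.
    It yields the minimum principle for the walk and a weight that decreases on average at each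
    legal toppling. For the graph kernels [g] is the mean exit time, whose equation is solvable by
    Cheeger's inequality, so nothing is circular. Internal DLA does not see [lambda]: the inserted
    particle is moved only while it shares its site with an active particle, where sleep
    instructions have no effect. Hence the arbitrary sleeping rates. The generator is tied to [stab]
    by uniformization, restricted to a bounded number of particles because the jump rates are
    unbounded. *)

Section KilledSystem.
Variables (R : realType) (V : finType) (K : V -> V -> R).
Implicit Types (A : {set V}) (b : V -> R).

Definition killed_mx A : 'M[R]_#|V| :=
  \matrix_(i, j) ((enum_val i \in A)%:R * K (enum_val i) (enum_val j)).

(** When the matrix is invertible, the solution of [u = b + 1_A K u]: [b] is boundary data off [A]
    and a source on [A], so one system covers Dirichlet problems and Green functions. *)
Definition ksolve A b (x : V) : R :=
  (invmx (1%:M - killed_mx A) *m \col_i b (enum_val i)) (enum_rank x) 0.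

Lemma killed_mx_unit A :
  (forall u : V -> R, (forall x, u x = (x \in A)%:R * \sum_y K x y * u y) ->
     forall x, u x = 0) ->
  1%:M - killed_mx A \in unitmx.
Proof.
move=> uniq; rewrite -unitmx_tr -row_free_unit; apply/inj_row_free => v v0.
have E x : v 0 (enum_rank x) = (x \in A)%:R * \sum_y K x y * v 0 (enum_rank y).
  move/matrixP: v0 => /(_ 0 (enum_rank x)).
  rewrite !mxE.
  under eq_bigr do rewrite !mxE !enum_rankK mulrBr.
  rewrite sumrB (bigD1 (enum_rank x))//= eqxx mulr1 big1 ?addr0.
    move/eqP; rewrite subr_eq0 => /eqP ->.
    rewrite mulr_sumr (reindex _ (onW_bij _ (@enum_rank_bij V)))/=.
    by apply: eq_bigr => y _; rewrite enum_rankK mulrC mulrA.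
  by move=> i /negbTE; rewrite eq_sym => ->; rewrite mulr0.
by apply/rowP => i; have := uniq _ E (enum_val i); rewrite enum_valK mxE.
Qed.

Lemma ksolve_eq A b x : 1%:M - killed_mx A \in unitmx ->
  ksolve A b x = b x + (x \in A)%:R * \sum_y K x y * ksolve A b y.
Proof.
move=> Au; have /matrixP/(_ (enum_rank x) 0) := mulKVmx Au (\col_i b (enum_val i)).
rewrite mulmxBl mul1mx !mxE enum_rankK => <-.
rewrite [X in _ - X](_ : _ = (x \in A)%:R * \sum_y K x y * ksolve A b y).
  by rewrite [X in _ = X - _ + _](_ : _ = ksolve A b x) ?subrK// /ksolve mxE.
rewrite (reindex _ (onW_bij _ (@enum_rank_bij V)))/= mulr_sumr.
by apply: eq_bigr => y _; rewrite mxE !enum_rankK -mulrA.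
Qed.

End KilledSystem.

(** * Minimum principle and exit probabilities for a transient kernel *)

Section Kernel.
Variables (R : realType) (V : finType) (K : V -> V -> R) (g : V -> R).
Hypothesis K_ge0 : forall x y, 0 <= K x y.
Hypothesis K_le1 : forall x, \sum_y K x y <= 1.
Hypothesis g_ge0 : forall x, 0 <= g x.
Hypothesis g_super : forall x, 1 + \sum_y K x y * g y <= g x.

Lemma g_gt0 x : 0 < g x.
Proof.
apply: lt_le_trans (g_super x).
by rewrite ltr_pwDl// sumr_ge0// => y _; rewrite mulr_ge0.
Qed.

(** Minimum principle for [u / g] instead of [u], since [K] may be stochastic at a minimum of [u].
    At a minimum of [u / g] with value [m < 0], [m * K g <= K u <= u = m * g], whence [g <= K g],
    against [1 + K g <= g]. *)
Lemma kernel_comparison (A : {set V}) (u : V -> R) :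
  {in A, forall x, \sum_y K x y * u y <= u x} ->
  (forall x, x \notin A -> 0 <= u x) -> forall x, 0 <= u x.
Proof.
move=> uA uNA x.
have [x0 _ x0min] := @arg_minP _ _ _ x xpredT (fun y => u y / g y) isT.
rewrite leNgt; apply/negP => ux.
have m0 : u x0 / g x0 < 0.
  by apply: le_lt_trans (x0min x isT) _; rewrite pmulr_llt0// invr_gt0 g_gt0.
have x0A : x0 \in A.
  apply: contraTT m0 => /uNA ?; rewrite -leNgt divr_ge0//.
have ux0 : u x0 = (u x0 / g x0) * g x0 by rewrite divfK// gt_eqF ?g_gt0.
have : (u x0 / g x0) * \sum_y K x0 y * g y <= u x0.
  apply: le_trans (uA _ x0A); rewrite mulr_sumr ler_sum// => y _.
  rewrite mulrCA ler_wpM2l//.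
  by have := x0min y isT; rewrite ler_pdivlMr ?g_gt0.
have := g_super x0; move: m0 ux0; set m := u x0 / g x0; set s := \sum_y _.
by move=> m0 -> gs; nra.
Qed.

Lemma kernel_unique (A : {set V}) (u v : V -> R) :
  {in A, forall x, u x - \sum_y K x y * u y = v x - \sum_y K x y * v y} ->
  (forall x, x \notin A -> u x = v x) -> u =1 v.
Proof.
move=> uvA uvNA.
have H w w' : {in A, forall x, w x - \sum_y K x y * w y = w' x - \sum_y K x y * w' y} ->
  (forall x, x \notin A -> w x = w' x) -> forall x, w x <= w' x.
  move=> wA wNA x; rewrite -subr_ge0.
  apply: (@kernel_comparison A (fun x => w' x - w x)) => [z zA|z zA].
    under eq_bigr do rewrite mulrBr.
    rewrite sumrB; have := wA _ zA; lra.
  by rewrite wNA// subrr.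
move=> x; apply/eqP; rewrite eq_le !H// => z zA; first by rewrite uvA.
by rewrite uvNA.
Qed.

Notation ksolve := (ksolve K).

Lemma ksolveE (A : {set V}) b x :
  ksolve A b x = b x + (x \in A)%:R * \sum_y K x y * ksolve A b y.
Proof.
apply: ksolve_eq; apply: killed_mx_unit => u E.
apply: (@kernel_unique A) => [y yA|y /negbTE yA]; last by rewrite E yA mul0r.
rewrite {1}E yA mul1r subrr big1 ?subrr// => z _; exact: mulr0.
Qed.

Lemma ksolve_in (A : {set V}) b x : x \in A ->
  ksolve A b x = b x + \sum_y K x y * ksolve A b y.
Proof. by move=> xA; rewrite ksolveE xA mul1r. Qed.

Lemma ksolve_out (A : {set V}) b x : x \notin A -> ksolve A b x = b x.
Proof. by move=> /negbTE xA; rewrite ksolveE xA mul0r addr0. Qed.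

Lemma ksolve_ge0 (A : {set V}) b x : (forall y, 0 <= b y) -> 0 <= ksolve A b x.
Proof.
move=> b0; apply: (@kernel_comparison A) => y yA.
  by rewrite ksolve_in// lerDr.
by rewrite ksolve_out.
Qed.

(* For [z \notin A], the probability that the walk started from [x] leaves [A] at
   [z]; for [z \in A] this is a Green function instead. *)
Definition exit_prob (A : {set V}) (x z : V) : R :=
  ksolve A (fun y => (y == z)%:R) x.

Lemma exit_prob_ge0 A x z : 0 <= exit_prob A x z.
Proof. by apply: ksolve_ge0 => y. Qed.

Lemma exit_prob_in (A : {set V}) x z : x \in A -> z \notin A ->
  exit_prob A x z = \sum_y K x y * exit_prob A y z.
Proof.
move=> xA zA; rewrite /exit_prob ksolve_in// (negbTE (_ : x != z)) ?add0r//.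
by apply: contraNneq zA => <-.
Qed.

Lemma exit_prob_out (A : {set V}) x z : x \notin A ->
  exit_prob A x z = (x == z)%:R.
Proof. by move=> xA; rewrite /exit_prob ksolve_out. Qed.

(** Optional stopping, with [c] the value of [u] at the cemetery. Subtracting [c] makes that value
    0, and the minimum principle applies to [u] minus its harmonic extension from outside [A]. *)
Lemma exit_comparison (A : {set V}) (u : V -> R) (c : R) :
  {in A, forall x, \sum_y K x y * u y + (1 - \sum_y K x y) * c <= u x} ->
  forall x, \sum_(z | z \notin A) exit_prob A x z * u z
            + (1 - \sum_(z | z \notin A) exit_prob A x z) * c <= u x.
Proof.
move=> uA x; rewrite -subr_ge0.
pose w x := u x - c - \sum_(z | z \notin A) exit_prob A x z * (u z - c).
suff : 0 <= w x.
  congr (_ <= _); rewrite /w.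
  under eq_bigr do rewrite mulrBr.
  by rewrite sumrB -mulr_suml; ring.
apply: (@kernel_comparison A) => [y yA|y yA].
  rewrite /w.
  have -> : \sum_(z | z \notin A) exit_prob A y z * (u z - c) =
     \sum_t K y t * (\sum_(z | z \notin A) exit_prob A t z * (u z - c)).
    under eq_bigr => z zA do rewrite exit_prob_in// mulr_suml.
    rewrite exchange_big/=; apply: eq_bigr => t _.
    by rewrite mulr_sumr; apply: eq_bigr => z _; rewrite mulrA.
  under eq_bigr do rewrite mulrBr mulrBr.
  rewrite !sumrB lerD2r -mulr_suml.
  by have := uA _ yA; lra.
rewrite /w (bigD1 y)//= exit_prob_out// eqxx mul1r big1 ?addr0 ?subrr//.
by move=> z /andP[zA zy]; rewrite exit_prob_out// eq_sym (negbTE zy) mul0r.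
Qed.

Lemma exit_harmonic (A : {set V}) (u : V -> R) (c : R) :
  {in A, forall x, u x = \sum_y K x y * u y + (1 - \sum_y K x y) * c} ->
  forall x, u x = \sum_(z | z \notin A) exit_prob A x z * u z
            + (1 - \sum_(z | z \notin A) exit_prob A x z) * c.
Proof.
move=> uA x; apply/eqP; rewrite eq_le andbC exit_comparison => [|y yA]; last first.
  by rewrite -uA.
have := @exit_comparison A (fun x => - u x) (- c) _ x.
under eq_bigr do rewrite mulrN.
rewrite sumrN mulrN -opprD lerN2; apply=> y yA.
under eq_bigr do rewrite mulrN.
by rewrite sumrN mulrN -opprD lerN2 -uA.
Qed.

Lemma sum_exit_prob_le1 (A : {set V}) x :
  \sum_(z | z \notin A) exit_prob A x z <= 1.
Proof.
have := @exit_comparison A (fun=> 1) 0 _ x; rewrite mulr0 addr0.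
under eq_bigr do rewrite mulr1.
apply => y yA; rewrite mulr0 addr0.
by under eq_bigr do rewrite mulr1.
Qed.

(** Strong Markov property: a walk that leaves [y |: A] at [z] leaves [A] either at [z], or at [y],
    from where it starts afresh. *)
Lemma exit_prob_setU1 (A : {set V}) x y z : y \notin A -> z \notin y |: A ->
  exit_prob (y |: A) x z =
  exit_prob A x z + exit_prob A x y * exit_prob (y |: A) y z.
Proof.
move=> yA zyA; have zA : z \notin A by apply: contra zyA; rewrite in_setU1 orbC => ->.
have yz : y != z by apply: contraNneq zyA => ->; rewrite in_setU1 eqxx.
move: x; apply: (@kernel_unique A) => [x xA|x xA]; last first.
  rewrite (exit_prob_out _ xA) (exit_prob_out _ xA).
  have [->|xy] := eqVneq x y; first by rewrite (negbTE yz) add0r mul1r.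
  by rewrite mul0r addr0 exit_prob_out// in_setU1 negb_or xy.
under [X in _ = _ - X]eq_bigr do rewrite mulrDr mulrA.
rewrite big_split/= -mulr_suml -!exit_prob_in// ?subrr//.
by rewrite in_setU1 xA orbT.
Qed.

Lemma exit_prob_le_hit (A : {set V}) x z : z \notin A ->
  exit_prob A x z <= exit_prob [set~ z] x z.
Proof.
move=> zA; rewrite -subr_ge0.
apply: (@kernel_comparison A (fun x => exit_prob [set~ z] x z - exit_prob A x z)) => y yA.
  have yz : y != z by apply: contraTneq yA => ->.
  under eq_bigr do rewrite mulrBr.
  by rewrite sumrB -!exit_prob_in// !inE// negbK.
rewrite (exit_prob_out _ yA); have [->|yz] := eqVneq y z.
  by rewrite exit_prob_out ?eqxx ?subrr// !inE negbK.
by rewrite subr0 exit_prob_ge0.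
Qed.

(** The right-hand side is the mean lifetime, i.e. the Green function summed over [z]; it dominates
    the hitting probability term by term, being at least 1 on the diagonal. *)
Lemma sum_hit_le (x : V) :
  \sum_z exit_prob [set~ z] x z <= ksolve [set: V] (fun=> 1) x.
Proof.
have -> : ksolve [set: V] (fun=> 1) x = \sum_z ksolve [set: V] (fun y => (y == z)%:R) x.
  move: x; apply: (@kernel_unique [set: V]) => [x _|x]; last by rewrite inE.
  rewrite ksolve_in ?inE// addrK.
  under [X in _ = X - _]eq_bigr do rewrite ksolve_in ?inE//.
  rewrite big_split/= exchange_big/= [X in _ = _ + X - _](_ : _ =
      \sum_y K x y * (\sum_z ksolve [set: V] (fun y0 => (y0 == z)%:R) y)).
    by rewrite addrK (bigD1 x)//= eqxx big1 ?addr0// => i /negbTE; rewrite eq_sym => ->.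
  by apply: eq_bigr => y _; rewrite mulr_sumr.
apply: ler_sum => z _; rewrite -subr_ge0; move: x.
apply: (@kernel_comparison [set~ z]) => x xz; last first.
  have -> : x = z by apply/eqP; move: xz; rewrite !inE negbK.
  rewrite exit_prob_out ?inE ?eqxx// ksolve_in ?inE// eqxx addrAC subrr add0r.
  by rewrite sumr_ge0// => y _; rewrite mulr_ge0// ksolve_ge0.
have -> : exit_prob [set~ z] x z = \sum_y K x y * exit_prob [set~ z] y z.
  by rewrite exit_prob_in// !inE negbK.
have xz' : x != z by move: xz; rewrite !inE.
rewrite ksolve_in ?inE// (negbTE xz') add0r.
under eq_bigr do rewrite mulrBr.
by rewrite sumrB.
Qed.

End Kernel.

(** * Internal DLA and its filling time *)

Definition harmonic_sum (R : realType) (k : nat) : R := \sum_(i < k) i.+1%:R^-1.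

Lemma harmonic_sumS (R : realType) k :
  harmonic_sum R k.+1 = harmonic_sum R k + k.+1%:R^-1.
Proof. by rewrite /harmonic_sum big_ord_recr. Qed.

Lemma card_setC_setU1 (V : finType) (A : {set V}) z : z \notin A ->
  #|~: A| = #|~: (z |: A)|.+1.
Proof.
move=> zA; rewrite (cardsD1 z) inE zA add1n; congr _.+1; apply: eq_card => y.
by rewrite !inE negb_or.
Qed.

Lemma setC_ind (V : finType) (P : {set V} -> Prop) :
  (forall A : {set V}, (forall z, z \notin A -> P (z |: A)) -> P A) -> forall A, P A.
Proof.
move=> IH A; elim: {A}_.+1 {-2}A (ltnSn #|~: A|) => // n IHn A An.
apply: IH => z zA; apply: IHn.
by move: An; rewrite (card_setC_setU1 zA).
Qed.

Lemma card_setC_gt0 (V : finType) (A : {set V}) :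
  (0 < #|~: A|)%N = (A != [set: V]).
Proof.
apply/idP/idP => [/card_gt0P[x]|].
  by rewrite inE; apply: contraNneq => ->; rewrite inE.
by rewrite -finset.subTset => /subsetPn[x _ xA]; apply/card_gt0P; exists x; rewrite inE.
Qed.

Section Idla.
Variables (R : realType) (V : finType) (K : V -> V -> R) (g nu : V -> R) (M : R).
Hypothesis K_ge0 : forall x y, 0 <= K x y.
Hypothesis K_le1 : forall x, \sum_y K x y <= 1.
Hypothesis g_ge0 : forall x, 0 <= g x.
Hypothesis g_super : forall x, 1 + \sum_y K x y * g y <= g x.
Hypothesis nu_sum : \sum_x nu x = 1.
Hypothesis M_gt0 : 0 < M.
Hypothesis nu_ge : forall x, M^-1 <= nu x.

Implicit Types (A B : {set V}) (f h : {set V} -> R).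

Let nu_ge0 x : 0 <= nu x.
Proof. by apply: le_trans (nu_ge x); rewrite invr_ge0 ltW. Qed.

Definition settle (A : {set V}) (z : V) : R := \sum_x nu x * exit_prob K A x z.

(* Transition operator of internal DLA on the set [A] of occupied sites. *)
Definition idla (f : {set V} -> R) (A : {set V}) : R :=
  f A + \sum_(z | z \notin A) settle A z * (f (z |: A) - f A).

(* Probability that [t] insertions do not fill [V], as a function of the set of
   sites occupied at time 0. *)
Definition unfilled (t : nat) : {set V} -> R :=
  iter t idla (fun A => (A != [set: V])%:R).

Lemma settle_ge0 A z : 0 <= settle A z.
Proof.
by apply: sumr_ge0 => x _; rewrite mulr_ge0// (exit_prob_ge0 K_ge0 g_ge0 g_super).
Qed.

Lemma settle_sum_le1 A : \sum_(z | z \notin A) settle A z <= 1.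
Proof.
rewrite exchange_big/= -[leRHS]nu_sum; apply: ler_sum => x _.
rewrite -mulr_sumr ler_piMr//.
exact: (sum_exit_prob_le1 K_ge0 K_le1 g_ge0 g_super).
Qed.

Lemma settle_ge A z : z \notin A -> M^-1 <= settle A z.
Proof.
move=> zA; apply: le_trans (nu_ge z) _.
rewrite /settle (bigD1 z)//= (exit_prob_out K_ge0 g_ge0 g_super)// eqxx mulr1 lerDl.
by apply: sumr_ge0 => x _; rewrite mulr_ge0// (exit_prob_ge0 K_ge0 g_ge0 g_super).
Qed.

Lemma settle_gt0 A z : z \notin A -> 0 < settle A z.
Proof. by move=> /settle_ge; apply: lt_le_trans; rewrite invr_gt0. Qed.

Lemma settle_le_hit A z : z \notin A -> settle A z <= settle [set~ z] z.
Proof.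
move=> zA; apply: ler_sum => x _; rewrite ler_wpM2l//.
exact: (exit_prob_le_hit K_ge0 g_ge0 g_super).
Qed.

Lemma settle_setU1 A y z : y \notin A -> z \notin y |: A ->
  settle (y |: A) z = settle A z + settle A y * exit_prob K (y |: A) y z.
Proof.
move=> yA zA; rewrite /settle mulr_suml -big_split/=; apply: eq_bigr => x _.
by rewrite (exit_prob_setU1 K_ge0 g_ge0 g_super)// mulrDr mulrA.
Qed.

Lemma idlaE f A : idla f A = (1 - \sum_(z | z \notin A) settle A z) * f A
  + \sum_(z | z \notin A) settle A z * f (z |: A).
Proof.
rewrite /idla; under eq_bigr do rewrite mulrBr.
by rewrite sumrB -mulr_suml; ring.
Qed.

Lemma idla_le f h A : f A <= h A ->
  (forall z, z \notin A -> f (z |: A) <= h (z |: A)) -> idla f A <= idla h A.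
Proof.
move=> fh fhA; rewrite !idlaE lerD//.
  by rewrite ler_wpM2l// subr_ge0 settle_sum_le1.
by apply: ler_sum => z /fhA fhz; rewrite ler_wpM2l// settle_ge0.
Qed.

Lemma idlaZ f c A : idla (fun B => f B * c) A = idla f A * c.
Proof.
rewrite /idla mulrDl mulr_suml; congr (_ + _); apply: eq_bigr => z _.
by rewrite -mulrBl mulrA.
Qed.

Lemma idla1B f A : idla (fun B => 1 - f B) A = 1 - idla f A.
Proof.
rewrite /idla (_ : \sum_(z | _) _ = - \sum_(z | z \notin A) settle A z * (f (z |: A) - f A)).
  by ring.
by rewrite -sumrN; apply: eq_bigr => z _; ring.
Qed.

Lemma unfilledS t A : unfilled t.+1 A = idla (unfilled t) A.
Proof. by []. Qed.

Lemma unfilled_setT t : unfilled t [set: V] = 0.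
Proof.
elim: t => [|t IH]; first by rewrite /unfilled/= eqxx.
by rewrite unfilledS /idla IH big1 ?addr0// => z; rewrite inE.
Qed.

Lemma unfilled_ge0 t A : 0 <= unfilled t A.
Proof.
elim: t A => [|t IH] A; first by rewrite /unfilled/=.
rewrite unfilledS (le_trans _ (idla_le (f := fun=> 0) _ _))//.
by rewrite /idla big1 ?addr0// => z _; rewrite subrr mulr0.
Qed.

Lemma unfilled_le1 t A : unfilled t A <= 1.
Proof.
elim: t A => [|t IH] A; first by rewrite /unfilled/=; case: (_ != _).
rewrite unfilledS (le_trans (idla_le (h := fun=> 1) _ _))//.
by rewrite /idla big1 ?addr0// => z _; rewrite subrr mulr0.
Qed.

Lemma decay01 : 0 <= 1 - M^-1 < 1.
Proof.
rewrite ltrBlDr ltrDl invr_gt0 M_gt0 andbT subr_ge0 -nu_sum.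
have [x _|V0] := pickP V; last first.
  have /eqP := nu_sum; rewrite big1 => [|x _]; first by rewrite eq_sym oner_eq0.
  by have := V0 x.
by rewrite (bigD1 x)//= (le_trans (nu_ge x))// lerDl sumr_ge0.
Qed.

(** First-moment bound: the mean number of empty sites shrinks by the factor [1 - M^-1] at each
    insertion, every empty site being filled with probability at least [M^-1]. *)
Lemma unfilled_le t A : unfilled t A <= #|~: A|%:R * (1 - M^-1) ^+ t.
Proof.
have /andP[M1 _] := decay01.
elim: t A => [|t IH] A.
  rewrite expr0 mulr1 /unfilled/= ler_nat.
  by have [//|] := eqVneq A [set: V]; rewrite -card_setC_gt0.
rewrite unfilledS; apply: (@le_trans _ _ (idla (fun B => #|~: B|%:R * (1 - M^-1) ^+ t) A)).
  by apply: idla_le => [|z _]; exact: IH.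
rewrite (idlaZ (fun B => #|~: B|%:R)) exprS mulrA ler_wpM2r ?exprn_ge0//.
rewrite /idla (_ : \sum_(z | _) _ = - \sum_(z | z \notin A) settle A z).
  rewrite mulrBr mulr1 lerD2l lerN2.
  rewrite (eq_bigl [in ~: A]) => [|z]; last by rewrite inE.
  rewrite mulr_natl -sumr_const; apply: ler_sum => z; rewrite inE; exact: settle_ge.
rewrite -sumrN; apply: eq_bigr => z zA.
by rewrite (card_setC_setU1 zA) -natr1; ring.
Qed.

(** First-step analysis conditioned on a settlement, hence the division. The number of empty sites
    is exactly enough fuel, as each settlement fills one. *)
Fixpoint fill_time_rec (k : nat) (A : {set V}) : R :=
  if k is k'.+1 then
    if A == [set: V] then 0 else
      (1 + \sum_(z | z \notin A) settle A z * fill_time_rec k' (z |: A))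
        / \sum_(z | z \notin A) settle A z
  else 0.

Definition fill_time (A : {set V}) : R := fill_time_rec #|~: A| A.

Lemma fill_time_setT : fill_time [set: V] = 0.
Proof. by rewrite /fill_time finset.setCT cards0. Qed.

Lemma settle_sum_gt0 A : A != [set: V] -> 0 < \sum_(z | z \notin A) settle A z.
Proof.
rewrite -finset.subTset => /subsetPn[z _ zA].
rewrite (bigD1 z)//= ltr_pwDl ?settle_gt0// sumr_ge0// => x _.
exact: settle_ge0.
Qed.

Lemma fill_time_drift A : A != [set: V] ->
  \sum_(z | z \notin A) settle A z * (fill_time A - fill_time (z |: A)) = 1.
Proof.
move=> AT; under eq_bigr do rewrite mulrBr.
rewrite sumrB -mulr_suml {1}/fill_time.
case E : #|~: A| => [|k] /=.
  by move: AT; rewrite -card_setC_gt0 E.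
rewrite (negbTE AT) mulrC divfK ?gt_eqF ?settle_sum_gt0// -addrA.
rewrite -sumrB big1 ?addr0// => z zA.
by move: E; rewrite (card_setC_setU1 zA) /fill_time => -[->]; rewrite subrr.
Qed.

(** Minimum principle by induction on the number of empty sites; it turns one-step drift
    inequalities into comparisons with explicit functions of the set. *)
Lemma idla_min (w : {set V} -> R) : 0 <= w [set: V] ->
  (forall A, A != [set: V] ->
     0 <= \sum_(z | z \notin A) settle A z * (w A - w (z |: A))) ->
  forall A, 0 <= w A.
Proof.
move=> wT wA; apply: setC_ind => A IH.
have [->//|AT] := eqVneq A [set: V].
have := wA A AT; under eq_bigr do rewrite mulrBr.
rewrite sumrB -mulr_suml subr_ge0 => h.
rewrite -(pmulr_rge0 _ (settle_sum_gt0 AT)); apply: le_trans h.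
by apply: sumr_ge0 => z /IH wz; rewrite mulr_ge0 // settle_ge0.
Qed.

Lemma fill_time_ge0 A : 0 <= fill_time A.
Proof.
by apply: idla_min => [|B BT]; rewrite ?fill_time_setT// fill_time_drift.
Qed.

Lemma settle_sum_ge A :
  #|~: A|%:R / M <= \sum_(z | z \notin A) settle A z.
Proof.
rewrite (eq_bigl [in ~: A]) => [|z]; last by rewrite inE.
by rewrite mulr_natl -sumr_const; apply: ler_sum => z; rewrite inE; exact: settle_ge.
Qed.

(** With [k] empty sites, a settlement lowers [M * H_k] by [M / k] and has probability at least
    [k / M]: this function falls by at least 1 on average, [fill_time] by exactly 1. *)
Lemma fill_time_le A : fill_time A <= M * harmonic_sum R #|~: A|.
Proof.
rewrite -subr_ge0; move: A; apply: idla_min => [|A AT].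
  by rewrite finset.setCT cards0 /harmonic_sum big_ord0 mulr0 fill_time_setT subrr.
have k0 : (0 < #|~: A|)%N by rewrite card_setC_gt0.
rewrite (_ : \sum_(z | _) _ = \sum_(z | z \notin A) settle A z * (M / #|~: A|%:R) - 1).
  rewrite subr_ge0 -mulr_suml mulrA ler_pdivlMr ?ltr0n// mul1r.
  by rewrite -ler_pdivrMr// settle_sum_ge.
rewrite [X in _ = _ - X](esym (fill_time_drift AT)) -sumrB; apply: eq_bigr => z zA.
rewrite (card_setC_setU1 zA) harmonic_sumS; ring.
Qed.

(** Only the filling of [S] is counted: an insertion settles at a given site of [S] with probability
    at most [c], so the left-hand side falls by at most 1 on average. *)
Lemma fill_time_ge (S : {set V}) (c : R) A : 0 < c ->
  {in S, forall z, settle [set~ z] z <= c} ->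
  c^-1 * harmonic_sum R #|S :\: A| <= fill_time A.
Proof.
move=> c0 Sc; rewrite -subr_ge0; move: A; apply: idla_min => [|A AT].
  by rewrite finset.setDT cards0 /harmonic_sum big_ord0 mulr0 fill_time_setT subrr.
rewrite (_ : \sum_(z | _) _ =
  1 - \sum_(z | z \in S :\: A) settle A z * (c * #|S :\: A|%:R)^-1).
  rewrite subr_ge0 -mulr_suml.
  have [->|k0] := posnP #|S :\: A|; first by rewrite mulr0 invr0 mulr0.
  rewrite ler_pdivrMr ?mulr_gt0 ?ltr0n// mul1r mulr_natr -sumr_const.
  apply: ler_sum => z; rewrite inE => /andP[zA zS].
  by apply: le_trans (settle_le_hit zA) _; exact: Sc.
rewrite [X in _ = X - _](esym (fill_time_drift AT)) [X in _ = _ - X](_ : _ =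
  \sum_(z | z \notin A) settle A z * (if z \in S then (c * #|S :\: A|%:R)^-1 else 0)).
  rewrite -sumrB; apply: eq_bigr => z zA.
  case: ifP => zS.
    rewrite (cardsD1 z (S :\: A)) inE zA zS/= add1n harmonic_sumS.
    rewrite (_ : #|S :\: A :\ z| = #|S :\: (z |: A)|); last first.
      by apply: eq_card => y; rewrite !inE negb_or andbA.
    rewrite invfM; ring.
  rewrite mulr0 subr0 (_ : #|S :\: (z |: A)| = #|S :\: A|); first by congr (_ * _); ring.
  apply: eq_card => y; rewrite !inE negb_or.
  by have [->|] := eqVneq y z; rewrite ?zS ?andbF.
rewrite [RHS](bigID [in S])/= [X in _ = _ + X]big1 ?addr0 => [|z /andP[_ /negbTE->]]; last first.
  by rewrite mulr0.
apply: eq_big => [z|z]; first by rewrite inE.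
by rewrite inE => /andP[_ ->].
Qed.

(** Couple both systems by their inserted particles, so that they differ by at most one site: a
    particle that settles at [y] in the smaller system walks on from [y] in the larger one, and the
    discrepancy moves to where it settles, or disappears if it is killed. So the difference is a
    sub-average of differences for larger sets, down to a single empty site [y], where it is
    [1 / settle A y]. *)
Lemma fill_time_diff A y : y \notin A ->
  0 <= fill_time A - fill_time (y |: A) <= M.
Proof.
move: A y; apply: setC_ind => A IH y yA.
pose D B x := fill_time B - fill_time (x |: B); rewrite -/(D A y).
have AT : A != [set: V] by apply: contraNneq yA => ->; rewrite inE.
have dA : settle A y * D A y + \sum_(z | z \notin y |: A) settle A z * D A z = 1.
  rewrite -[RHS](fill_time_drift AT) [in RHS](bigD1 y)//=; congr (_ + _).
  by apply: eq_bigl => z; rewrite in_setU1 negb_or andbC.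
have [BT|BT] := eqVneq (y |: A) [set: V].
  rewrite [X in _ + X]big_pred0 in dA; last by move=> z; rewrite BT inE.
  have q0 := settle_gt0 yA; have qM := settle_ge yA.
  have DE : D A y = (settle A y)^-1.
    by apply: (mulfI (lt0r_neq0 q0)); rewrite divff ?lt0r_neq0// -[RHS]dA addr0.
  by rewrite DE invr_ge0 ltW//= -[leRHS]invrK lef_pV2// posrE invr_gt0.
have dB := fill_time_drift BT.
pose p z := exit_prob K (y |: A) y z.
have p0 z : 0 <= p z by exact: (exit_prob_ge0 K_ge0 g_ge0 g_super).
have psum : \sum_(z | z \notin y |: A) p z <= 1.
  exact: (sum_exit_prob_le1 K_ge0 K_le1 g_ge0 g_super).
(* The coupling as an identity: the drifts of [A] and of [y |: A] both equal 1, and [settle_setU1]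
   splits the second one according to whether the particle leaves [A] at [y]. *)
have key : D A y * \sum_(z | z \notin A) settle A z =
    \sum_(z | z \notin y |: A) settle A z * D (z |: A) y
    + settle A y * \sum_(z | z \notin y |: A) p z * D (y |: A) z.
  have -> : \sum_(z | z \notin A) settle A z =
    settle A y + \sum_(z | z \notin y |: A) settle A z.
    rewrite (bigD1 y)//=; congr (_ + _).
    by apply: eq_bigl => z; rewrite in_setU1 negb_or andbC.
  have E1 : \sum_(z | z \notin y |: A) settle A z * D A z =
     D A y * \sum_(z | z \notin y |: A) settle A z
     + \sum_(z | z \notin y |: A) settle A z * D (y |: A) z
     - \sum_(z | z \notin y |: A) settle A z * D (z |: A) y.
    rewrite mulr_sumr -big_split/= -sumrB; apply: eq_bigr => z zB.
    by rewrite /D finset.setUCA; ring.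
  have E2 : 1 = \sum_(z | z \notin y |: A) settle A z * D (y |: A) z
     + settle A y * \sum_(z | z \notin y |: A) p z * D (y |: A) z.
    rewrite -dB mulr_sumr -big_split/=; apply: eq_bigr => z zB.
    by rewrite (settle_setU1 yA zB) /D/p; ring.
  by rewrite E1 {1}E2 in dA; move: dA; lra.
have Q0 := settle_sum_gt0 AT.
have zA z : z \notin y |: A -> z \notin A by rewrite in_setU1 negb_or => /andP[].
have D1 z : z \notin y |: A -> 0 <= D (z |: A) y <= M.
  move=> zB; apply: IH; first exact: zA.
  rewrite in_setU1 negb_or yA andbT.
  by apply: contraNneq zB => <-; rewrite in_setU1 eqxx.
have D2 z : z \notin y |: A -> 0 <= D (y |: A) z <= M by exact: IH.
apply/andP; split.
  rewrite -(pmulr_lge0 _ Q0) key addr_ge0 ?mulr_ge0 ?settle_ge0 ?sumr_ge0// => z zB.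
    by rewrite mulr_ge0 ?settle_ge0//; case/andP: (D1 z zB).
  by rewrite mulr_ge0//; case/andP: (D2 z zB).
rewrite -(ler_pM2r Q0) key [in leRHS](bigD1 y)//= mulrDr addrC lerD//.
  rewrite [leRHS]mulrC ler_wpM2l ?settle_ge0// (@le_trans _ _ (\sum_(z | z \notin y |: A) p z * M))//.
    by apply: ler_sum => z zB; rewrite ler_wpM2l//; case/andP: (D2 z zB).
  by rewrite -mulr_suml ler_piMl// ltW.
rewrite mulr_sumr [leRHS](eq_bigl (fun z => z \notin y |: A)) => [|z]; last first.
  by rewrite in_setU1 negb_or andbC.
by apply: ler_sum => z zB; rewrite mulrC ler_wpM2r ?settle_ge0//; case/andP: (D1 z zB).
Qed.

(* Dominates the second moment of the fill time around [a]: its variance is at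
   most [M] times its mean, since each step lowers the mean remaining time by
   [1] on average and by at most [M]. *)
Definition fill_moment (A : {set V}) (a : R) : R :=
  M * fill_time A + (fill_time A - a) ^+ 2.

(** Expand the square. The linear term has drift 1, matching the shift of [a]; the quadratic term is
    at most [M], because [0 <= D <= M] and [D] has mean 1, and is paid for by the drift of
    [M * fill_time]. *)
Lemma fill_moment_step A a : A != [set: V] ->
  idla (fill_moment^~ (a - 1)) A <= fill_moment A a.
Proof.
move=> AT; pose D z := fill_time A - fill_time (z |: A).
have -> : idla (fill_moment^~ (a - 1)) A = fill_moment A (a - 1)
    - (M + 2 * (fill_time A - a + 1)) * \sum_(z | z \notin A) settle A z * D z
    + \sum_(z | z \notin A) settle A z * (D z) ^+ 2.
  rewrite mulr_sumr -addrA -sumrN -big_split/= /idla; congr (_ + _).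
  by apply: eq_bigr => z _; rewrite /fill_moment /D; ring.
rewrite fill_time_drift//.
have : \sum_(z | z \notin A) settle A z * (D z) ^+ 2 <= M.
  rewrite -[leRHS]mulr1 -(fill_time_drift AT) mulr_sumr; apply: ler_sum => z zA.
  rewrite [leRHS]mulrCA ler_wpM2l ?settle_ge0// expr2.
  by have /andP[D0 DM] := fill_time_diff zA; rewrite ler_wpM2r.
rewrite /fill_moment; set s := \sum_(_ | _) _; move: (fill_time A) => t sM.
nra.
Qed.

Lemma fill_moment_ge0 A a : 0 <= fill_moment A a.
Proof. by rewrite addr_ge0 ?sqr_ge0// mulr_ge0 ?fill_time_ge0// ltW. Qed.

(** Chebyshev's inequality by induction on time: an insertion shifts [t] and the target [a]
    together, so [t - a] is constant. At time 0, [a <= 0 <= fill_time] gives the bound [a ^+ 2]. *)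
Lemma unfilled_chebyshev_above t A (a : R) : a <= t%:R ->
  unfilled t A * (t%:R - a) ^+ 2 <= fill_moment A a.
Proof.
elim: t A a => [|t IH] A a at_.
  rewrite sub0r sqrrN /unfilled/=.
  have [_|_] := eqVneq; first by rewrite mul0r fill_moment_ge0.
  rewrite mul1r /fill_moment.
  have := fill_time_ge0 A; move: (fill_time A) => f f0.
  have := mulr_ge0 (ltW M_gt0) f0; have : f * a <= 0 by rewrite mulr_ge0_le0.
  by have := sqr_ge0 f; nra.
have [->|AT] := eqVneq A [set: V]; first by rewrite unfilled_setT mul0r fill_moment_ge0.
rewrite unfilledS -idlaZ; apply: le_trans (fill_moment_step a AT).
have at1 : a - 1 <= t%:R by move: at_; rewrite -natr1; lra.
have E : t.+1%:R - a = t%:R - (a - 1) by rewrite -natr1; ring.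
by rewrite E; apply: idla_le => [|z _]; exact: IH.
Qed.

Lemma unfilled_chebyshev_below t A (a : R) : t%:R <= a ->
  (1 - unfilled t A) * (a - t%:R) ^+ 2 <= fill_moment A a.
Proof.
elim: t A a => [|t IH] A a at_.
  rewrite subr0 /unfilled/=.
  have [->|_] := eqVneq; last by rewrite subrr mul0r fill_moment_ge0.
  by rewrite subr0 mul1r /fill_moment fill_time_setT mulr0 add0r sub0r sqrrN.
(* Filled ahead of time: the moment is then [a ^+ 2], which suffices since [0 <= t.+1 <= a]. *)
have [->|AT] := eqVneq A [set: V].
  rewrite unfilled_setT subr0 mul1r /fill_moment fill_time_setT mulr0 add0r sub0r sqrrN.
  by have := ler0n R t.+1; nra.
rewrite unfilledS -idla1B -idlaZ; apply: le_trans (fill_moment_step a AT).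
have at1 : t%:R <= a - 1 by move: at_; rewrite -natr1; lra.
have E : a - t.+1%:R = a - 1 - t%:R by rewrite -natr1; ring.
by rewrite E; apply: idla_le => [|z _]; exact: IH.
Qed.

End Idla.

(** * Toppling and the abelian property *)

Section Topple.
Variables (V : finType).
Implicit Types (eta : config V) (x y z : V).

(* An instruction: [None] is "sleep", [Some None] is "be killed" and
   [Some (Some y)] is "jump to y". *)
Definition obey (x : V) (i : option (option V)) (eta : config V) : config V :=
  match i with
  | None => if eta x == Some 1%N then fall_asleep x eta else eta
  | Some None => remove_active x eta
  | Some (Some y) => jump x y eta
  end.

Definition active (x : V) (eta : config V) : bool := (0 < nactive (eta x))%N.

Definition nparts (s : option nat) : nat := if s is Some k then k else 1.

Lemma add_activeE x eta z : add_active x eta z =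
  if z == x then Some (if eta x is Some k then k.+1 else 2) else eta z.
Proof. by rewrite ffunE; case: ifP => // _; case: (eta x). Qed.

Lemma remove_activeE x eta z : active x eta -> remove_active x eta z =
  if z == x then Some (nactive (eta x)).-1 else eta z.
Proof. by rewrite /active ffunE; case: ifP => // _; case: (eta x). Qed.

Lemma add_activeC x y eta :
  add_active x (add_active y eta) = add_active y (add_active x eta).
Proof.
apply/ffunP => z; rewrite !add_activeE.
have [->|xy] := eqVneq x y; first by [].
by have [->|zx] := eqVneq z x; first by rewrite (negbTE xy).
Qed.

Lemma active_add x y eta : active y eta -> active y (add_active x eta).
Proof.
rewrite /active add_activeE; case: eqVneq => // _ _ /=.
by case: (eta x).
Qed.

Lemma active_add_same x eta : active x (add_active x eta).
Proof. by rewrite /active add_activeE eqxx; case: (eta x). Qed.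

Lemma activeP x eta : active x eta -> exists k, eta x = Some k.+1.
Proof. by rewrite /active; case: (eta x) => [[|k]|]// _; exists k. Qed.

Lemma remove_add x y eta : active y eta ->
  remove_active y (add_active x eta) = add_active x (remove_active y eta).
Proof.
move=> ya; have yax := active_add x ya; apply/ffunP => z.
rewrite remove_activeE// !add_activeE !remove_activeE//.
have [k E] := activeP ya.
have [<-|yx] := eqVneq y x; last by have [->|] := eqVneq z y; rewrite ?(negbTE yx).
by rewrite E/=; case: eqVneq.
Qed.

(** The delicate case is sleep for a lone particle: whether it sleeps and is then joined, or is
    joined and then ignores the instruction, two active particles result. This rests on the rule
    [s + 1 = 2]. *)
Lemma obey_add x y i eta : active y eta ->
  obey y i (add_active x eta) = add_active x (obey y i eta).
Proof.
move=> ya; case: i => [[z|]|] /=; last first.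
- have [k E] := activeP ya.
  rewrite add_activeE; have [<-|yx] := eqVneq y x; last first.
    case: ifP => // _; apply/ffunP => z.
    have xy : (x == y) = false by rewrite eq_sym (negbTE yx).
    rewrite !ffunE; have [->|_] := eqVneq z y; first by rewrite (negbTE yx).
    by rewrite xy.
  rewrite E /=; case: k E => [|k] E //=; apply/ffunP => z.
  by rewrite !add_activeE !ffunE eqxx E; case: eqVneq.
- exact: remove_add.
- by rewrite /jump remove_add// add_activeC.
Qed.

Lemma active_obey x y i eta : x != y -> active y eta -> active y (obey x i eta).
Proof.
move=> xy ya; have yr s : active y (set_site eta x s).
  by rewrite /active ffunE eq_sym (negbTE xy).
case: i => [[z|]|] /=; first by apply: active_add; exact: yr.
  exact: yr.
by case: ifP => // _; exact: yr.
Qed.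

Lemma obeyC x y i j eta : x != y -> active x eta -> active y eta ->
  obey x i (obey y j eta) = obey y j (obey x i eta).
Proof.
move=> xy xa ya.
have rm w z zeta : jump w z zeta = add_active z (remove_active w zeta) by [].
have yx : y != x by rewrite eq_sym.
have setC s t : set_site (set_site eta x s) y t = set_site (set_site eta y t) x s.
  apply/ffunP => z; rewrite !ffunE.
  by have [->|zy] := eqVneq z y; first by rewrite (negbTE yx).
have setE s : set_site eta x s y = eta y by rewrite ffunE (negbTE yx).
have setE' s : set_site eta y s x = eta x by rewrite ffunE (negbTE xy).
(* [r i] is [i] without its destination, so it changes only its own site. Such effects commute at
   distinct sites, and arrivals are moved past them by [obey_add]. *)
pose r i := if i is Some (Some z) then Some None else i : option (option V).
have rE w k zeta : obey w k zeta =
    if k is Some (Some z) then add_active z (obey w (r k) zeta) else obey w (r k) zeta.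
  by case: k => [[]|].
have C : obey x (r i) (obey y (r j) eta) = obey y (r j) (obey x (r i) eta).
  have [E|/negbTE E] := boolP (eta x == Some 1%N);
  have [F|/negbTE F] := boolP (eta y == Some 1%N);
  case: i => [[z|]|]; case: j => [[t|]|];
  by rewrite /= /remove_active /fall_asleep ?(E, F, setE, setE')/= ?(E, F, setE, setE')/= ?setC.
have H1 k : active x (obey y k eta) by exact: (active_obey k yx xa).
have H2 k : active y (obey x k eta) by exact: (active_obey k xy ya).
rewrite [obey y j eta]rE [obey x i eta]rE.
have -> : obey x i (if j is Some (Some z) then add_active z (obey y (r j) eta)
                   else obey y (r j) eta)
  = if j is Some (Some z) then add_active z (obey x i (obey y (r j) eta))
    else obey x i (obey y (r j) eta).
  by case: j {C} => [[t|]|] //; exact: (obey_add t i (H1 (Some None))).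
have -> : obey y j (if i is Some (Some z) then add_active z (obey x (r i) eta)
                   else obey x (r i) eta)
  = if i is Some (Some z) then add_active z (obey y j (obey x (r i) eta))
    else obey y j (obey x (r i) eta).
  by case: i {C} => [[t|]|] //; exact: (obey_add t j (H2 (Some None))).
rewrite [obey x i _]rE [obey y j _]rE C.
by case: i {C} => [[t|]|]; case: j => [[u|]|] //; exact: add_activeC.
Qed.

End Topple.

Section Weight.
Variables (R : realType) (V : finType).
Implicit Types (eta : config V) (x y z : V) (h : V -> R).

(** With [h = 1] it counts particles; with [h = g] it is the Lyapunov function for topplings. *)
Definition weight h eta : R := \sum_z (nparts (eta z))%:R * h z.

Lemma weight_set_site h eta x s :
  weight h (set_site eta x s) = weight h eta + ((nparts s)%:R - (nparts (eta x))%:R) * h x.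
Proof.
rewrite /weight (bigD1 x)//= [in RHS](bigD1 x)//= ffunE eqxx.
rewrite (eq_bigr (fun z => (nparts (eta z))%:R * h z)) => [|z /negbTE zx]; first by ring.
by rewrite ffunE zx.
Qed.

Lemma weight_add h x eta : weight h (add_active x eta) = weight h eta + h x.
Proof.
rewrite weight_set_site; congr (_ + _).
case: (eta x) => [k|] /=; last by rewrite -natrB// mul1r.
by rewrite -natrB// subSnn mul1r.
Qed.

Lemma weight_remove h x eta : active x eta ->
  weight h (remove_active x eta) = weight h eta - h x.
Proof.
move=> /activeP[k E]; rewrite weight_set_site E /=.
by rewrite -[k.+1%:R]natr1; ring.
Qed.

Lemma weight_obey h x i eta : active x eta ->
  weight h (obey x i eta) = weight h eta
    + match i with None => 0 | Some None => - h x | Some (Some y) => h y - h x end.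
Proof.
move=> xa; case: i => [[y|]|] /=.
- by rewrite /jump weight_add weight_remove//; ring.
- exact: weight_remove.
- rewrite addr0; case: ifP => // /eqP E.
  by rewrite weight_set_site E subrr mul0r addr0.
Qed.

Lemma weight_ge0 h eta : (forall x, 0 <= h x) -> 0 <= weight h eta.
Proof. by move=> h0; apply: sumr_ge0 => z _; rewrite mulr_ge0. Qed.

End Weight.

(** * Stabilization probabilities *)

Section Stabilization.
Variables (R : realType) (V : finType) (K : V -> V -> R) (g : V -> R) (lambda : R).
Hypothesis K_ge0 : forall x y, 0 <= K x y.
Hypothesis K_le1 : forall x, \sum_y K x y <= 1.
Hypothesis g_ge0 : forall x, 0 <= g x.
Hypothesis g_super : forall x, 1 + \sum_y K x y * g y <= g x.
Hypothesis lambda_gt0 : 0 < lambda.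

Implicit Types (eta zeta : config V) (x y z : V) (f h : config V -> R).
Implicit Types (xi : stable_config V).

(** Sleep keeps its probability at a crowded site, where [obey] ignores it, so that the law of an
    instruction does not depend on the configuration; topplings then commute. *)
Definition instr_prob (x : V) (i : option (option V)) : R :=
  match i with
  | None => lambda
  | Some None => 1 - \sum_y K x y
  | Some (Some y) => K x y
  end / (1 + lambda).

Definition topple (x : V) (f : config V -> R) (eta : config V) : R :=
  \sum_i instr_prob x i * f (obey x i eta).

Let lambda1_gt0 : 0 < 1 + lambda. Proof. by rewrite addr_gt0. Qed.

Lemma instr_prob_ge0 x i : 0 <= instr_prob x i.
Proof.
rewrite divr_ge0 ?(ltW lambda1_gt0)//; case: i => [[y|]|] //; last exact: ltW.
by rewrite subr_ge0.
Qed.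

Lemma sum_instr (F : option (option V) -> R) :
  \sum_i F i = F None + F (Some None) + \sum_y F (Some (Some y)).
Proof.
have H (T : finType) (G : option T -> R) : \sum_i G i = G None + \sum_y G (Some y).
  rewrite (bigD1 None)//=; congr (_ + _).
  rewrite (reindex_omap Some id) => [|[y|]]//=.
  by apply: eq_bigl => y; rewrite eqxx.
by rewrite H H addrA.
Qed.

Lemma sum_instr_prob x : \sum_i instr_prob x i = 1.
Proof.
rewrite -mulr_suml sum_instr.
have -> S : lambda + (1 - S) + S = 1 + lambda by ring.
by rewrite divff// gt_eqF.
Qed.

Lemma topple_le x f h eta : (forall i, f (obey x i eta) <= h (obey x i eta)) ->
  topple x f eta <= topple x h eta.
Proof. by move=> fh; apply: ler_sum => i _; rewrite ler_wpM2l// instr_prob_ge0. Qed.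

Lemma eq_topple x f h eta : (forall i, f (obey x i eta) = h (obey x i eta)) ->
  topple x f eta = topple x h eta.
Proof. by move=> fh; apply: eq_bigr => i _; rewrite fh. Qed.

Lemma topple_cst x (c : R) eta : topple x (fun=> c) eta = c.
Proof. by rewrite /topple -mulr_suml sum_instr_prob mul1r. Qed.

Lemma toppleB x f h eta :
  topple x (fun zeta => f zeta - h zeta) eta = topple x f eta - topple x h eta.
Proof. by rewrite -sumrB; apply: eq_bigr => i _; rewrite mulrBr. Qed.

Lemma toppleZ x c f eta :
  topple x (fun zeta => c * f zeta) eta = c * topple x f eta.
Proof. by rewrite mulr_sumr; apply: eq_bigr => i _; rewrite mulrCA. Qed.

Lemma topple_sum (I : finType) x (F : I -> config V -> R) eta :
  topple x (fun zeta => \sum_i F i zeta) eta = \sum_i topple x (F i) eta.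
Proof. by rewrite exchange_big/=; apply: eq_bigr => i _; rewrite mulr_sumr. Qed.

Lemma toppleC x y f eta : x != y -> active x eta -> active y eta ->
  topple x (topple y f) eta = topple y (topple x f) eta.
Proof.
move=> xy xa ya; rewrite /topple.
under eq_bigr do rewrite mulr_sumr.
under [RHS]eq_bigr do rewrite mulr_sumr.
rewrite exchange_big/=; apply: eq_bigr => j _; apply: eq_bigr => i _.
by rewrite mulrCA obeyC// eq_sym.
Qed.

Lemma topple_add x y f eta : active y eta ->
  topple y (fun zeta => f (add_active x zeta)) eta = topple y f (add_active x eta).
Proof. by move=> ya; apply: eq_bigr => i _; rewrite obey_add. Qed.

Lemma toppleE x f eta : topple x f eta = (1 + lambda)^-1 *
  (lambda * f (if eta x == Some 1%N then fall_asleep x eta else eta)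
   + (1 - \sum_y K x y) * f (remove_active x eta)
   + \sum_y K x y * f (jump x y eta)).
Proof.
rewrite /topple sum_instr /instr_prob/= !mulrDr mulr_sumr.
rewrite [X in _ + X](_ : _ = \sum_y (1 + lambda)^-1 * (K x y * f (jump x y eta))).
  by congr (_ + _ + _); rewrite mulrA (mulrC _^-1).
by apply: eq_bigr => y _; rewrite mulrA (mulrC _^-1).
Qed.

(** A sleep instruction leaves the weight unchanged; a walk step, of probability [1 / (1 + lambda)],
    lowers it by at least 1 on average by [g_super]. *)
Lemma topple_weight x eta : active x eta ->
  topple x (weight g) eta <= weight g eta - (1 + lambda)^-1.
Proof.
move=> xa; rewrite -subr_ge0 /topple.
under eq_bigr do rewrite weight_obey// mulrDr.
rewrite big_split/= -mulr_suml sum_instr_prob mul1r sum_instr /instr_prob mulr0 add0r.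
have -> : \sum_y K x y / (1 + lambda) * (g y - g x) =
    (1 + lambda)^-1 * \sum_y K x y * (g y - g x).
  by rewrite mulr_sumr; apply: eq_bigr => y _; rewrite mulrAC mulrC.
have -> : \sum_y K x y * (g y - g x) = \sum_y K x y * g y - (\sum_y K x y) * g x.
  by rewrite mulr_suml -sumrB; apply: eq_bigr => y _; rewrite mulrBr.
have -> (w s t : R) : w - (1 + lambda)^-1 - (w + ((1 - s) / (1 + lambda) * - g x +
   (1 + lambda)^-1 * (t - s * g x))) = (1 + lambda)^-1 * (g x - (1 + t)) by ring.
by rewrite mulr_ge0 ?invr_ge0 ?(ltW lambda1_gt0)// subr_ge0.
Qed.

(* A function that does not decrease in expectation under some legal toppling
   of each configuration where it is positive is nonpositive, because
   [weight g] forces any sequence of legal topplings to end. *)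
Lemma topple_max f (b c : R) :
  (forall eta, weight (fun=> 1) eta <= c -> f eta <= b) ->
  (forall eta, weight (fun=> 1) eta <= c ->
     f eta <= 0 \/ exists2 x, active x eta & f eta <= topple x f eta) ->
  forall eta, weight (fun=> 1) eta <= c -> f eta <= 0.
Proof.
move=> fb fT.
(* With the penalty [e * weight g], each toppling gains [e / (1 + lambda)], so the bound [b] drops
   linearly in [k] until it reaches 0. The [e] chosen below keeps the penalty under half of [f eta],
   which makes this absurd if [f eta > 0]. *)
have key (e : R) : 0 < e -> forall k eta, weight (fun=> 1) eta <= c ->
  f eta - e * weight g eta <= Num.max 0 (b - k%:R * (e / (1 + lambda))).
  move=> e0; elim=> [|k IH] eta ec.
    rewrite mul0r subr0 le_max orbC (le_trans _ (fb _ ec))// gerBl.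
    by rewrite mulr_ge0 ?weight_ge0// ltW.
  have [f0|[x xa fx]] := fT _ ec.
    by rewrite le_max subr_le0 (le_trans f0)// mulr_ge0 ?weight_ge0// ltW.
  have le1 : f eta - e * weight g eta <=
      topple x (fun zeta => f zeta - e * weight g zeta) eta - e / (1 + lambda).
    rewrite toppleB toppleZ -addrA lerD// -opprD lerN2 -mulrDr ler_wpM2l ?(ltW e0)//.
    by rewrite -lerBrDr topple_weight.
  apply: le_trans le1 _; rewrite lerBlDr.
  apply: (@le_trans _ _ (topple x (fun=> Num.max 0 (b - k%:R * (e / (1 + lambda)))) eta)).
    apply: topple_le => i; apply: IH; rewrite weight_obey// (le_trans _ ec)// gerDl.
    by case: i => [[y|]|]//; rewrite ?subrr ?lerN10.
  rewrite topple_cst -natr1 mulrDl mul1r.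
  have d0 : 0 < e / (1 + lambda) by rewrite divr_gt0.
  move: (e / _) d0 => d d0; move: (_ * d) => u.
  have m0 : 0 <= Num.max 0 (b - (u + d)) by rewrite le_max lexx.
  have mb : b - (u + d) <= Num.max 0 (b - (u + d)) by rewrite le_max lexx orbT.
  by rewrite ge_max; apply/andP; split; lra.
move=> eta ec; rewrite leNgt; apply/negP => f0.
have G0 : 0 <= weight g eta by exact: weight_ge0.
pose e := f eta / (2 * (weight g eta + 1)).
have e0 : 0 < e by rewrite divr_gt0// mulr_gt0// ltr_wpDl.
have d0 : 0 < e / (1 + lambda) by rewrite divr_gt0.
have [k kb] : exists k : nat, b < k%:R * (e / (1 + lambda)).
  exists (Num.truncn (`|b| / (e / (1 + lambda)))).+1.
  rewrite -ltr_pdivrMr// (le_lt_trans _ (truncnS_gt _))//.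
  by rewrite ler_pM2r ?invr_gt0// ler_norm.
have := key e e0 k eta ec.
rewrite (_ : Num.max _ _ = 0); last by apply/max_idPl; rewrite subr_le0 ltW.
have eE : e * (2 * (weight g eta + 1)) = f eta.
  by rewrite divfK// gt_eqF// mulr_gt0// ltr_wpDl.
have := mulr_ge0 (ltW e0) G0; clearbody e => eG fe; nra.
Qed.

Definition stable eta : Prop := forall x, ~~ active x eta.

Lemma of_stableP eta : stable eta -> exists xi, eta = of_stable xi.
Proof.
move=> st; exists [ffun x => eta x == None]; apply/ffunP => x; rewrite !ffunE.
by have := st x; rewrite /active; case: (eta x) => [[|k]|].
Qed.

Lemma stable_of_stable xi : stable (of_stable xi).
Proof. by move=> x; rewrite /active ffunE; case: ifP. Qed.

Lemma of_stable_inj : injective (@of_stable V).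
Proof.
move=> xi xi' /ffunP E; apply/ffunP => x; have := E x; rewrite !ffunE.
by case: (xi x); case: (xi' x).
Qed.

Lemma harmonic_unique f h :
  (forall x eta, active x eta -> topple x f eta = f eta) ->
  (forall x eta, active x eta -> topple x h eta = h eta) ->
  (exists b, forall eta, `|f eta| <= b) -> (exists b, forall eta, `|h eta| <= b) ->
  (forall xi, f (of_stable xi) = h (of_stable xi)) -> f =1 h.
Proof.
move=> fT hT [bf fb] [bh hb] fh.
have H (u v : config V -> R) (bu bv : R) :
  (forall x eta, active x eta -> topple x u eta = u eta) ->
  (forall x eta, active x eta -> topple x v eta = v eta) ->
  (forall eta, `|u eta| <= bu) -> (forall eta, `|v eta| <= bv) ->
  (forall xi, u (of_stable xi) = v (of_stable xi)) -> forall eta, u eta <= v eta.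
  move=> uT vT ub vb uv eta; rewrite -subr_le0.
  apply: (@topple_max (fun eta => u eta - v eta) (bu + bv) (weight (fun=> 1) eta)) => // zeta _.
    by have := ub zeta; have := vb zeta; rewrite !ler_norml => /andP[? ?] /andP[? ?]; lra.
  have [st|] := pselect (stable zeta).
    by left; have [xi ->] := of_stableP st; rewrite uv subrr.
  move/existsNP => [x /negP]; rewrite negbK => xa; right; exists x => //.
  by rewrite toppleB uT// vT.
by move=> eta; apply/eqP; rewrite eq_le (H _ _ bf bh)//= (H _ _ bh bf).
Qed.


(** * Monotone iteration, shared by sequential toppling and uniformization *)

Section MonotoneIteration.
Local Open Scope classical_set_scope.
Variables (op : (config V -> R) -> config V -> R) (S : config V -> Prop).
Variable (ind : config V -> R).
Hypothesis op_le : forall f h, (forall zeta, S zeta -> f zeta <= h zeta) ->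
  forall zeta, S zeta -> op f zeta <= op h zeta.
Hypothesis op_cst : forall zeta (c : R), S zeta -> op (fun=> c) zeta = c.
Hypothesis op_cvg : forall (u : nat -> config V -> R) f,
  (forall zeta, S zeta -> u k zeta @[k --> \oo] --> f zeta) ->
  forall zeta, S zeta -> op (u k) zeta @[k --> \oo] --> op f zeta.
Hypothesis ind01 : forall zeta, 0 <= ind zeta <= 1.
Hypothesis ind_op : forall zeta, S zeta -> ind zeta <= op ind zeta.

Let itr k := iter k op ind.

Lemma iter_op01 k zeta : S zeta -> 0 <= itr k zeta <= 1.
Proof.
elim: k zeta => [|k IH] zeta zS; first exact: ind01.
rewrite /itr iterS; apply/andP; split.
  by rewrite -[leLHS](op_cst 0 zS); apply: op_le => // w /IH/andP[].
by rewrite -[leRHS](op_cst 1 zS); apply: op_le => // w /IH/andP[].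
Qed.

Lemma iter_op_le k zeta : S zeta -> itr k zeta <= itr k.+1 zeta.
Proof.
elim: k zeta => [|k IH] zeta zS; first exact: ind_op.
exact: (op_le IH zS).
Qed.

Lemma iter_op_cvg zeta : S zeta ->
  itr k zeta @[k --> \oo] --> limn (fun k => itr k zeta).
Proof.
move=> zS; apply: nondecreasing_is_cvgn.
  by apply/nondecreasing_seqP => k; exact: iter_op_le.
by exists 1 => _ [k _ <-]; have /andP[] := iter_op01 k zS.
Qed.

Lemma iter_op_fixed zeta : S zeta ->
  op (fun w => limn (fun k => itr k w)) zeta = limn (fun k => itr k zeta).
Proof.
move=> zS; rewrite -(cvg_lim _ (op_cvg iter_op_cvg zS))//.
apply: cvg_lim => //; have := iter_op_cvg zS.
by rewrite -(cvg_shiftS (fun k => itr k zeta)).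
Qed.

Lemma iter_op_lim01 zeta : S zeta -> 0 <= limn (fun k => itr k zeta) <= 1.
Proof.
move=> zS; have cv : cvgn (fun k => itr k zeta) by exact: iter_op_cvg.
by apply/andP; split; [apply: limr_ge => //|apply: limr_le => //];
  apply: nearW => k; have /andP[] := iter_op01 k zS.
Qed.

Lemma iter_op_lim_fixed zeta : (forall f, op f zeta = f zeta) ->
  limn (fun k => itr k zeta) = ind zeta.
Proof.
move=> opf; have -> : (fun k => itr k zeta) = fun=> ind zeta.
  by apply/funext; elim=> [//|k IH]; rewrite /itr iterS opf.
exact: lim_cst.
Qed.

End MonotoneIteration.

Section Existence.
Local Open Scope classical_set_scope.

Lemma topple_cvg x (u : nat -> config V -> R) f eta :
  (forall i, u k (obey x i eta) @[k --> \oo] --> f (obey x i eta)) ->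
  topple x (u k) eta @[k --> \oo] --> topple x f eta.
Proof.
move=> uf; apply: cvg_big => [|i _]; first exact: add_continuous.
by apply: cvgMl_tmp; exact: uf.
Qed.

Definition first_active eta : option V :=
  [pick x | active x eta && [forall y, active y eta ==> (enum_rank x <= enum_rank y)%N]].

Variant first_active_spec eta : option V -> Prop :=
  | FirstActive x of active x eta
      & (forall y, active y eta -> (enum_rank x <= enum_rank y)%N) :
      first_active_spec eta (Some x)
  | NoActive of stable eta : first_active_spec eta None.

Lemma first_activeP eta : first_active_spec eta (first_active eta).
Proof.
rewrite /first_active; case: pickP => [x /andP[xa /forallP xm]|none].
  by constructor=> // y ya; apply: (implyP (xm y)).
constructor=> x; apply/negP => xa.
have [y ya ym] := @arg_minnP V x (fun y => active y eta) (fun y => enum_rank y : nat) xa.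
have /negP := none y; apply; rewrite ya; apply/forallP => z; apply/implyP; exact: ym.
Qed.

Definition topple_first (f : config V -> R) (eta : config V) : R :=
  if first_active eta is Some x then topple x f eta else f eta.

(* Always toppling the first active site is an arbitrary choice, which does not
   matter by [stab_topple]. *)
Definition stab (xi : stable_config V) (eta : config V) : R :=
  limn (fun k => iter k topple_first (fun zeta => (zeta == of_stable xi)%:R) eta).

Lemma topple_first_le f h : (forall zeta, True -> f zeta <= h zeta) ->
  forall zeta, True -> topple_first f zeta <= topple_first h zeta.
Proof.
move=> fh zeta _; rewrite /topple_first; case: first_activeP => [x _ _|_]; last exact: fh.
by apply: topple_le => i; exact: fh.
Qed.

Lemma topple_first_cst zeta (c : R) : True -> topple_first (fun=> c) zeta = c.
Proof. by rewrite /topple_first; case: first_activeP => *; rewrite ?topple_cst. Qed.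

Lemma topple_first_cvg (u : nat -> config V -> R) f :
  (forall zeta, True -> u k zeta @[k --> \oo] --> f zeta) ->
  (forall zeta, True -> topple_first (u k) zeta @[k --> \oo] --> topple_first f zeta).
Proof.
move=> uf zeta _; rewrite /topple_first; case: first_activeP => [x _ _|_]; last exact: uf.
by apply: topple_cvg => i; exact: uf.
Qed.

Lemma ind01 xi zeta : 0 <= ((zeta == of_stable xi)%:R : R) <= 1.
Proof. by case: (_ == _); rewrite ?lexx ?ler01. Qed.

Lemma topple_first_ind xi zeta : True ->
  ((zeta == of_stable xi)%:R : R) <= topple_first (fun zeta => (zeta == of_stable xi)%:R) zeta.
Proof.
rewrite /topple_first; case: first_activeP => [x xa _ _|//].
have -> : (zeta == of_stable xi) = false.
  by apply/negP => /eqP E; move: xa; rewrite E (negbTE (stable_of_stable _ _)).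
by rewrite -[leLHS](topple_cst x 0 zeta); apply: topple_le.
Qed.

Lemma stab01 xi eta : 0 <= stab xi eta <= 1.
Proof.
exact: (@iter_op_lim01 topple_first (fun=> True) _ topple_first_le topple_first_cst
  (ind01 xi) (@topple_first_ind xi)).
Qed.

Lemma stab_ge0 xi eta : 0 <= stab xi eta. Proof. by case/andP: (stab01 xi eta). Qed.

Lemma stab_stable xi xi' : stab xi (of_stable xi') = (xi' == xi)%:R.
Proof.
rewrite -(inj_eq of_stable_inj); apply: (@iter_op_lim_fixed topple_first) => f.
rewrite /topple_first; case: first_activeP => // x.
by rewrite (negbTE (stable_of_stable _ _)).
Qed.

Lemma stab_first xi eta x : first_active eta = Some x ->
  topple x (stab xi) eta = stab xi eta.
Proof.
move=> E; rewrite -[RHS](@iter_op_fixed topple_first (fun=> True) _ topple_first_le topple_first_cst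
  topple_first_cvg (ind01 xi) (@topple_first_ind xi))//.
by rewrite [RHS]/topple_first E.
Qed.

End Existence.

(* The abelian property. By induction on the rank of [x]: the defect
   [topple x (stab xi) - stab xi] vanishes when [x] is the first active site,
   and otherwise is harmonic for toppling the first active site [y], because
   [topple x] and [topple y] commute. *)
Lemma stab_topple xi x eta : active x eta -> topple x (stab xi) eta = stab xi eta.
Proof.
have [n] := ubnP (enum_rank x : nat); elim: n x eta => // n IH x eta xn xa.
pose E (s : R) zeta := if active x zeta then s * (topple x (stab xi) zeta - stab xi zeta) else 0.
suff H s : `|s| = 1 -> E s eta <= 0.
  have := H 1 (normr1 _); have := H (-1) (normrN1 _).
  rewrite /E xa mul1r mulN1r; lra.
move=> s1; apply: (@topple_max (E s) 1 (weight (fun=> 1) eta)) => // zeta _.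
  rewrite /E; case: ifP => // _; apply: le_trans (ler_norm _) _.
  rewrite normrM s1 mul1r ler_norml.
  have : 0 <= topple x (stab xi) zeta <= 1.
    rewrite -{1}(topple_cst x 0 zeta) -[X in _ && (_ <= X)](topple_cst x 1 zeta).
    by rewrite !topple_le// => i; case/andP: (stab01 xi (obey x i zeta)).
  have := stab01 xi zeta; lra.
rewrite /E; case: ifP => za; last by left.
have := @stab_first xi zeta; case: first_activeP => [y ya ymin|/(_ x)]; last by rewrite za.
move=> /(_ y erefl) yst.
have [<-|yx] := eqVneq y x; first by left; rewrite yst subrr mulr0.
have yn : (enum_rank y < n)%N.
  rewrite -ltnS (leq_trans _ xn)// ltnS ltn_neqAle ymin// andbT.
  by apply: contra yx => /eqP/val_inj/enum_rank_inj ->.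
right; exists y => //.
rewrite [leRHS](@eq_topple _ _ (fun w => s * (topple x (stab xi) w - stab xi w))) => [|i].
  (* After toppling [x], site [y] is still active but may no longer be the first active site; the
     induction hypothesis covers this, as [y] has smaller rank than [x]. *)
  have cm : topple y (topple x (stab xi)) zeta = topple x (stab xi) zeta.
    rewrite toppleC//; apply: eq_topple => i.
    by apply: IH => //; apply: active_obey; rewrite // eq_sym.
  by rewrite toppleZ toppleB [X in _ <= _ * (X - _)]cm [X in _ <= _ * (_ - X)]yst.
by rewrite active_obey.
Qed.

End Stabilization.

(** * Exponential series *)

Section ExpSeries.
Local Open Scope classical_set_scope.
Variable R : realType.
Implicit Types (x y c : R).

Definition exp_term x (k : nat) : R := x ^+ k / k`!%:R.
Arguments exp_term : simpl never.

Lemma exp_termS x k : k.+1%:R * exp_term x k.+1 = x * exp_term x k.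
Proof.
rewrite /exp_term/= exprS factS natrM invfM mulrCA (mulrA k.+1%:R).
by rewrite divff ?pnatr_eq0// mul1r mulrA.
Qed.

(** Coefficient form of [exp (c (U - 1)) = exp (c U) exp (- c)]; in the application [b k i] is, up
    to a power of time, the [k]-th power of the generator applied to the [i]-th iterate of a
    one-step operator [U]. The induction multiplies by [k.+1], split as [j + (k.+1 - j)]. *)
Lemma exp_term_binomial c (b : nat -> nat -> R) :
  (forall k i, b k.+1 i = c * (b k i.+1 - b k i)) ->
  forall k i, b k i / k`!%:R =
    \sum_(j < k.+1) exp_term c j * exp_term (- c) (k - j)%N * b 0%N (i + j)%N.
Proof.
move=> bS; elim=> [|k IH] i.
  by rewrite big_ord1 addn0 /exp_term/= !expr0 !fact0 !divr1 !mul1r.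
apply: (mulfI (_ : k.+1%:R != 0)); first by rewrite pnatr_eq0.
have -> : k.+1%:R * (b k.+1 i / k.+1`!%:R) = c * (b k i.+1 / k`!%:R - b k i / k`!%:R).
  by rewrite bS factS natrM invfM mulrCA (mulrA k.+1%:R) divff ?pnatr_eq0// mul1r -mulrBl mulrA.
rewrite !IH; apply/esym; rewrite [LHS]mulr_sumr.
rewrite (eq_bigr (fun j : 'I_k.+2 =>
    j%:R * (exp_term c j * exp_term (- c) (k.+1 - j)%N * b 0%N (i + j)%N)
    + (k.+1 - j)%:R * (exp_term c j * exp_term (- c) (k.+1 - j)%N * b 0%N (i + j)%N))); last first.
  by move=> j _; rewrite -mulrDl -natrD subnKC// -ltnS.
rewrite big_split/= mulrBr; congr (_ + _).
  rewrite [LHS]big_ord_recl/= mul0r add0r mulr_sumr; apply: eq_bigr => j _.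
  rewrite /bump/= add1n subSS addSnnS.
  move: (exp_termS c j) (b _ _); move: (exp_term c j.+1) (exp_term c j) (exp_term _ _).
  by move=> p q r E w; rewrite !mulrA E; ring.
rewrite [LHS]big_ord_recr/= subnn mul0r addr0 -mulNr mulr_sumr; apply: eq_bigr => j _.
rewrite subSn; last by rewrite -ltnS.
move: (exp_termS (- c) (k - j)) (b _ _).
move: (exp_term (- c) (k - j).+1) (exp_term (- c) (k - j)) (exp_term c j) => p q r E w.
by rewrite -mulrA mulrCA (mulrA _%:R) E; ring.
Qed.

Lemma triangle_sum (F : nat -> nat -> R) N :
  \sum_(k < N) \sum_(i < k.+1) F i (k - i)%N =
  \sum_(i < N) \sum_(j < N | (i + j < N)%N) F i j.
Proof.
rewrite (eq_bigr (fun k : 'I_N => \sum_(i < N | (i < k.+1)%N) F i (k - i)%N)); last first.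
  move=> k _; exact: (big_ord_widen N (fun i => F i (k - i)%N) (ltn_ord k)).
rewrite (exchange_big_dep xpredT)//=; apply: eq_bigr => i _.
transitivity (\sum_(i <= k < N) F i (k - i)%N); first by rewrite big_geq_mkord.
rewrite -{1}(add0n i) big_addn (big_nat_widen _ _ N) ?leq_subr// big_mkord.
by apply: eq_big => [j|j _]; rewrite ?ltn_subRL ?addnK.
Qed.

Lemma exp_term_sum x y k :
  exp_term (x + y) k = \sum_(i < k.+1) exp_term x i * exp_term y (k - i)%N.
Proof.
rewrite /exp_term addrC exprDn mulr_suml; apply: eq_bigr => i _.
have ik : (i <= k)%N by rewrite -ltnS.
have C0 : 'C(k, i)%:R != 0 :> R by rewrite pnatr_eq0 -lt0n bin_gt0.
have a0 : i`!%:R != 0 :> R by rewrite pnatr_eq0 -lt0n fact_gt0.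
have b0 : (k - i)`!%:R != 0 :> R by rewrite pnatr_eq0 -lt0n fact_gt0.
rewrite -(bin_fact ik) !natrM -mulr_natr.
move: 'C(k, i)%:R i`!%:R (k - i)`!%:R C0 a0 b0 => C c d C0 c0 d0.
by field; rewrite d0 c0.
Qed.

Lemma exp_term_ge0 x k : 0 <= x -> 0 <= exp_term x k.
Proof. by move=> x0; rewrite divr_ge0 ?exprn_ge0. Qed.

Lemma exp_term_cvg x : series (exp_term x) n @[n --> \oo] --> expR x.
Proof. exact: is_cvg_series_exp_coeff. Qed.

Lemma exp_dominated_cvg x (a : nat -> R) : (forall k, `|a k| <= exp_term x k) ->
  cvgn (series a).
Proof.
move=> ax; apply: normed_cvg; apply: (@series_le_cvg _ _ (exp_term x)) => //.
- by move=> n; exact: normr_ge0.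
- by move=> n; exact: (le_trans (normr_ge0 (a n)) (ax n)).
exact: is_cvg_series_exp_coeff.
Qed.

(* The error in the Cauchy product is dominated, term by term, by the error in
   [expR (x + y) = expR x * expR y]. *)
Lemma exp_cauchy_product x y (a b : nat -> R) :
  (forall k, `|a k| <= exp_term x k) -> (forall k, `|b k| <= exp_term y k) ->
  series (fun k => \sum_(i < k.+1) a i * b (k - i)%N) n @[n --> \oo] -->
    limn (series a) * limn (series b).
Proof.
move=> ax bY.
pose err (u v : nat -> R) N := \sum_(i < N) \sum_(j < N | ~~ (i + j < N)%N) u i * v j.
have errE (u v : nat -> R) N : series (fun k => \sum_(i < k.+1) u i * v (k - i)%N) N =
    series u N * series v N - err u v N.
  rewrite /series/= !big_mkord (triangle_sum (fun i j => u i * v j)).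
  rewrite mulr_suml /err -sumrB; apply: eq_bigr => i _.
  by rewrite mulr_sumr [in RHS](bigID (fun j : 'I_N => (i + j < N)%N))/= addrK.
have err0 : err (exp_term x) (exp_term y) N @[N --> \oo] --> 0.
  have -> : err (exp_term x) (exp_term y) =
     fun N => series (exp_term x) N * series (exp_term y) N - series (exp_term (x + y)) N.
    apply/funext => N; rewrite (_ : exp_term (x + y) =
        fun k => \sum_(i < k.+1) exp_term x i * exp_term y (k - i)%N); last first.
      by apply/funext => k; exact: exp_term_sum.
    by rewrite errE opprB addrC addrNK.
  rewrite -(subrr (expR (x + y))) [X in X - _]expRD.
  by apply: cvgB; [apply: cvgM|]; exact: exp_term_cvg.
have errab : err a b N @[N --> \oo] --> 0.
  apply/norm_cvg0P; apply: (squeeze_cvgr _ (cvg_cst 0) err0).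
  apply: nearW => N; rewrite normr_ge0/=.
  apply: le_trans (ler_norm_sum _ _ _) _; apply: ler_sum => i _.
  apply: le_trans (ler_norm_sum _ _ _) _; apply: ler_sum => j _.
  by rewrite normrM ler_pM.
rewrite (_ : (fun n => _) = fun N => series a N * series b N - err a b N).
  rewrite -[X in _ --> X]subr0; apply: cvgB => //.
  by apply: cvgM; [exact: (exp_dominated_cvg ax)|exact: (exp_dominated_cvg bY)].
by apply/funext => N; exact: errE.
Qed.

Lemma exp_term_le t k : 0 <= t -> exp_term t k <= expR t.
Proof.
move=> t0; apply: le_trans (nondecreasing_cvgn_le _ (@is_cvg_series_exp_coeff _ t) k.+1).
  by rewrite /series/= big_nat_recr//= lerDr sumr_ge0// => i _; exact: exp_term_ge0.
apply/nondecreasing_seqP => n; rewrite /series/= big_nat_recr//= lerDl.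
exact: exp_term_ge0.
Qed.

(** The next term controls this one: [t * exp_term t k = k.+1 * exp_term t k.+1 <= k.+1 * expR
    t]. *)
Lemma exp_term_vanish k : expR (- t) * exp_term t k @[t --> +oo] --> (0 : R).
Proof.
apply: (squeeze_cvgr (f := fun=> 0) (h := fun t => k.+1%:R * t^-1)) => //.
- near=> t; have t0 : 0 < t by near: t; exact: nbhs_pinfty_gt.
  rewrite mulr_ge0 ?expR_ge0 ?exp_term_ge0 ?(ltW t0)//=.
  rewrite expRN ler_pdivrMl ?expR_gt0// mulrA ler_pdivlMr//.
  by rewrite mulrC -exp_termS mulrC ler_wpM2r// exp_term_le// ltW.
- exact: cvg_cst.
- rewrite -[X in _ --> X](mulr0 k.+1%:R).
  apply: cvgMl_tmp; apply/(gtr0_cvgV0 (f := id)); last exact: cvg_id.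
  exact: nbhs_pinfty_gt.
Unshelve. all: by end_near. Qed.

(* As [t] grows, the Poisson law of mean [t] gives vanishing weight to any
   fixed finite set. *)
Lemma exp_average (a : nat -> R) (l : R) :
  (forall k, `|a k| <= 1) -> a k @[k --> \oo] --> l ->
  expR (- t) * limn (series (fun k => exp_term t k * a k)) @[t --> +oo] --> l.
Proof.
move=> a1 al; have l1 : `|l| <= 1.
  rewrite -(cvg_lim _ (cvg_norm al))//; apply: limr_le; last exact: nearW.
  by apply/cvg_ex; eexists; exact: (cvg_norm al).
apply/cvgrPdist_le => e e0.
have [m _ am] : \forall k \near \oo, `|l - a k| <= e / 2.
  by move/cvgrPdist_le : al; apply; rewrite divr_gt0.
have small : \sum_(k < m) 2 * (expR (- t) * exp_term t k) @[t --> +oo] --> (0 : R).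
  elim: (m) => [|j IH]; first by under eq_fun do rewrite big_ord0; exact: cvg_cst.
  have -> : (fun t => \sum_(k < j.+1) 2 * (expR (- t) * exp_term t k)) =
      (fun t => \sum_(k < j) 2 * (expR (- t) * exp_term t k) + 2 * (expR (- t) * exp_term t j)).
    by apply/funext => t; rewrite big_ord_recr.
  rewrite -[X in _ --> X](addr0 0); apply: cvgD => //.
  by rewrite -[X in _ --> X](mulr0 2); apply: cvgMl_tmp; exact: exp_term_vanish.
near=> t.
have t0 : 0 <= t by near: t; exact: nbhs_pinfty_ge.
have smallt : \sum_(k < m) 2 * (expR (- t) * exp_term t k) <= e / 2.
  near: t; move/cvgrPdist_le : small => /(_ (e / 2)).
  rewrite divr_gt0// => /(_ isT); apply: filterS => t.
  by rewrite sub0r normrN; apply: le_trans; exact: ler_norm.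
have b1 k : `|exp_term t k * (l - a k)| <= 2 * exp_term t k.
  rewrite normrM ger0_norm ?exp_term_ge0// mulrC ler_wpM2r ?exp_term_ge0//.
  by have := ler_normB l (a k); have := a1 k; lra.
have cva : cvgn (series (fun k => exp_term t k * a k)).
  apply: (@exp_dominated_cvg t) => k.
  by rewrite normrM (ger0_norm (exp_term_ge0 _ t0)) ler_piMr ?exp_term_ge0.
pose v n := expR (- t) * series (fun k => exp_term t k * (l - a k)) n.
have vcv : v n @[n --> \oo] -->
    l - expR (- t) * limn (series (fun k => exp_term t k * a k)).
  rewrite /v.
  have -> : (fun n => expR (- t) * series (fun k => exp_term t k * (l - a k)) n) =
     (fun n => expR (- t) * (l * series (exp_term t) n - series (fun k => exp_term t k * a k) n)).
    apply/funext => n; congr (_ * _); rewrite /series/= mulr_sumr -sumrB.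
    by apply: eq_bigr => k _; rewrite mulrBr (mulrC l).
  rewrite [X in _ --> X](_ : _ = expR (- t) *
      (l * expR t - limn (series (fun k => exp_term t k * a k)))); last first.
    by rewrite mulrBr mulrCA -expRD addNr expR0 mulr1.
  apply: cvgMl_tmp; apply: cvgB => //.
  by apply: cvgMl_tmp; exact: exp_term_cvg.
have vb n : (m <= n)%N -> `|v n| <= e.
  move=> mn; rewrite /v normrM ger0_norm ?expR_ge0// (_ : e = e / 2 + e / 2); last lra.
  apply: (@le_trans _ _ (\sum_(k < m) 2 * (expR (- t) * exp_term t k) +
     expR (- t) * \sum_(k < n) exp_term t k * (e / 2))).
    rewrite /series/= big_mkord (big_ord_widen _ (fun k => 2 * (expR (- t) * exp_term t k)) mn).
    rewrite [X in _ <= X + _]big_mkcond/= [X in _ <= _ + X]mulr_sumr -big_split/=.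
    rewrite -[X in X * _](ger0_norm (expR_ge0 (- t))) -normrM mulr_sumr.
    apply: le_trans (ler_norm_sum _ _ _) _; apply: ler_sum => k _.
    rewrite normrM (ger0_norm (expR_ge0 _)) normrM (ger0_norm (exp_term_ge0 _ t0)).
    have E0 := expR_ge0 (- t); have X0 := exp_term_ge0 k t0.
    case: ltnP => km.
      have := b1 k; rewrite normrM (ger0_norm X0) => bk.
      have e2 : 0 <= e / 2 by rewrite divr_ge0// ltW.
      apply: ler_wpDr; first exact: mulr_ge0 E0 (mulr_ge0 X0 e2).
      by rewrite [leRHS]mulrCA ler_wpM2l.
    by rewrite add0r !ler_wpM2l//; exact: am.
  rewrite lerD// -mulr_suml mulrA ler_piMl ?divr_ge0 ?(ltW e0)//.
  rewrite expRN ler_pdivrMl ?expR_gt0// mulr1.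
  rewrite -(big_mkord xpredT (exp_term t)).
  apply: (nondecreasing_cvgn_le _ (@is_cvg_series_exp_coeff _ t) n).
  apply/nondecreasing_seqP => j; rewrite /series/= big_nat_recr//= lerDl.
  exact: exp_term_ge0.
rewrite -(cvg_lim _ (cvg_norm vcv))//; apply: limr_le.
  by apply/cvg_ex; eexists; exact: (cvg_norm vcv).
by exists m.
Unshelve. all: by end_near. Qed.

End ExpSeries.

(** * Absorption probabilities *)

Section Absorption.
Variables (R : realType) (V : finType) (K : V -> V -> R) (g : V -> R) (lambda : R).
Hypothesis K_ge0 : forall x y, 0 <= K x y.
Hypothesis K_le1 : forall x, \sum_y K x y <= 1.
Hypothesis g_ge0 : forall x, 0 <= g x.
Hypothesis g_super : forall x, 1 + \sum_y K x y * g y <= g x.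
Hypothesis lambda_gt0 : 0 < lambda.

Implicit Types (eta zeta : config V) (x y z : V) (f h : config V -> R).

Notation L := (arw_generator K lambda).
Notation topple := (topple K lambda).
Notation stab := (stab K lambda).

Let lambda1_gt0 : 0 < 1 + lambda. Proof. by rewrite addr_gt0. Qed.

(** A site with [k] active particles receives instructions at rate [k * (1 + lambda)]; sleep acts
    only for [k = 1], where its rate is [lambda] as required. *)
Lemma generator_topple f eta : L f eta =
  \sum_x (nactive (eta x))%:R * (1 + lambda) * (topple x f eta - f eta).
Proof.
apply: eq_bigr => x _; rewrite toppleE.
have -> : \sum_y K x y * (f (jump x y eta) - f eta) =
   \sum_y K x y * f (jump x y eta) - (\sum_y K x y) * f eta.
  by rewrite mulr_suml -sumrB; apply: eq_bigr => y _; rewrite mulrBr.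
have -> : (if eta x == Some 1%N then lambda * (f (fall_asleep x eta) - f eta) else 0) =
    (nactive (eta x))%:R * lambda *
      (f (if eta x == Some 1%N then fall_asleep x eta else eta) - f eta).
  by case: ifP => [/eqP ->|_]; rewrite ?mul1r// subrr mulr0.
move: (f (if _ then _ else _)) (f eta) (f (remove_active x eta))
  (\sum_y K x y * f (jump x y eta)) (\sum_y K x y) => a b c d e.
rewrite [in RHS]mulrBr -[in RHS]mulrA [in RHS](mulrA (1 + lambda)).
by rewrite divff ?gt_eqF// mul1r; ring.
Qed.

Lemma generator_lin c f h :
  L (fun zeta => c * (f zeta - h zeta)) = (fun zeta => c * (L f zeta - L h zeta)).
Proof.
apply/funext => eta; rewrite !generator_topple -sumrB mulr_sumr.
apply: eq_bigr => x _; rewrite toppleZ toppleB; ring.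
Qed.

Lemma iter_generator_lin k c f h :
  iter k L (fun zeta => c * (f zeta - h zeta)) =
  (fun zeta => c * (iter k L f zeta - iter k L h zeta)).
Proof. by elim: k => //= k ->; rewrite generator_lin. Qed.

Lemma sum_nactive_le eta : \sum_x (nactive (eta x))%:R <= weight (fun=> 1 : R) eta.
Proof.
by apply: ler_sum => x _; rewrite mulr1 ler_nat; case: (eta x).
Qed.

Section Uniformization.
Variables (c : R).
Hypothesis c_ge0 : 0 <= c.
Let bounded_weight zeta := weight (fun=> 1 : R) zeta <= c.
Let Rate : R := (1 + lambda) * (c + 1).

(** The dynamics at the rings of a Poisson clock of intensity [Rate]. At most [c] particles give a
    total rate of at most [(1 + lambda) * c]; using [c + 1] keeps [Rate] positive for [c = 0]. *)
Definition uniformized f eta : R := f eta + Rate^-1 * L f eta.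

Lemma uniformizedE f eta : uniformized f eta =
  (1 - \sum_(x | active x eta) (nactive (eta x))%:R / (c + 1)) * f eta
  + \sum_(x | active x eta) (nactive (eta x))%:R / (c + 1) * topple x f eta.
Proof.
have c1 : c + 1 != 0 by rewrite gt_eqF// ltr_wpDl.
have l1 : 1 + lambda != 0 by rewrite gt_eqF.
rewrite /uniformized generator_topple mulrBl mul1r mulr_suml -addrA; congr (_ + _).
rewrite addrC -sumrB mulr_sumr (bigID (fun x => active x eta))/= [X in _ + X]big1 => [|x]; last first.
  by rewrite /active -leqNgt leqn0 => /eqP ->; rewrite !mul0r mulr0.
rewrite addr0; apply: eq_bigr => x _; rewrite /Rate invfM.
move: (nactive _)%:R (topple _ _ _) (f _) => n a b.
by field; rewrite c1.
Qed.

Lemma uniform_rate_le1 eta : bounded_weight eta ->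
  \sum_(x | active x eta) (nactive (eta x))%:R / (c + 1) <= 1.
Proof.
move=> ec; rewrite -mulr_suml ler_pdivrMr ?ltr_wpDl// mul1r.
apply: (@le_trans _ _ c); last by rewrite lerDl.
apply: le_trans ec; apply: le_trans (sum_nactive_le eta).
by rewrite [leRHS](bigID (fun x => active x eta))/= lerDl sumr_ge0.
Qed.

Lemma bounded_weight_obey x i eta : active x eta -> bounded_weight eta ->
  bounded_weight (obey x i eta).
Proof.
move=> xa ec; rewrite /bounded_weight weight_obey// (le_trans _ ec)// gerDl.
by case: i => [[y|]|]//; rewrite ?subrr ?lerN10.
Qed.

Lemma uniformized_le f h : (forall zeta, bounded_weight zeta -> f zeta <= h zeta) ->
  forall zeta, bounded_weight zeta -> uniformized f zeta <= uniformized h zeta.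
Proof.
move=> fh zeta zc; rewrite !uniformizedE lerD//.
  by rewrite ler_wpM2l ?fh// subr_ge0 uniform_rate_le1.
apply: ler_sum => x xa; rewrite ler_wpM2l ?divr_ge0 ?addr_ge0//.
by apply: topple_le => // i; apply: fh; exact: bounded_weight_obey.
Qed.

Lemma uniformized_cst zeta (b : R) : bounded_weight zeta -> uniformized (fun=> b) zeta = b.
Proof.
move=> _; rewrite uniformizedE.
rewrite [X in _ + X](eq_bigr (fun x => (nactive (zeta x))%:R / (c + 1) * b)) => [|x _].
  by rewrite -[X in _ + X]mulr_suml -mulrDl subrK mul1r.
by rewrite topple_cst.
Qed.

Local Open Scope classical_set_scope.

Lemma uniformized_cvg (u : nat -> config V -> R) f :
  (forall zeta, bounded_weight zeta -> u k zeta @[k --> \oo] --> f zeta) ->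
  forall zeta, bounded_weight zeta ->
    uniformized (u k) zeta @[k --> \oo] --> uniformized f zeta.
Proof.
move=> uf zeta zc; under eq_fun do rewrite uniformizedE; rewrite uniformizedE.
apply: cvgD; first by apply: cvgMl_tmp; exact: uf.
apply: cvg_big => [|x xa]; first exact: add_continuous.
by apply: cvgMl_tmp; apply: topple_cvg => i; apply: uf; exact: bounded_weight_obey.
Qed.

Variable xi : stable_config V.
Let ind : config V -> R := fun zeta => (zeta == of_stable xi)%:R.

Lemma uniformized_stable f zeta : stable zeta -> uniformized f zeta = f zeta.
Proof.
move=> st; rewrite uniformizedE !big_pred0 ?subr0 ?mul1r ?addr0// => x;
  by rewrite (negbTE (st x)).
Qed.

Lemma uniformized_ind zeta : bounded_weight zeta -> ind zeta <= uniformized ind zeta.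
Proof.
move=> zc; have [->|ne] := eqVneq zeta (of_stable xi).
  by rewrite uniformized_stable//; exact: stable_of_stable.
rewrite {1}/ind (negbTE ne) -[leLHS](uniformized_cst 0 zc).
by apply: uniformized_le => // w _; rewrite /ind.
Qed.

Let ind01' zeta : 0 <= ind zeta <= 1. Proof. exact: ind01. Qed.

Lemma uniformized_iter01 k zeta : bounded_weight zeta ->
  0 <= iter k uniformized ind zeta <= 1.
Proof. exact: (iter_op01 uniformized_le uniformized_cst ind01'). Qed.

(** The limit [h] is only known to be invariant under an average over the topplings of active sites.
    This suffices: as the weighted sum of [topple y h - h] vanishes, some active [y] does not
    decrease [s * h], and [topple_max] asks for just one such toppling. *)
Lemma uniformized_iter_cvg zeta : bounded_weight zeta ->
  iter k uniformized ind zeta @[k --> \oo] --> stab xi zeta.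
Proof.
pose h zeta := limn (fun k => iter k uniformized ind zeta).
have hfix w : bounded_weight w -> uniformized h w = h w.
  exact: (iter_op_fixed uniformized_le uniformized_cst uniformized_cvg ind01' uniformized_ind).
have h01 w : bounded_weight w -> 0 <= h w <= 1.
  exact: (iter_op_lim01 uniformized_le uniformized_cst ind01' uniformized_ind).
have hst w : stable w -> h w = ind w.
  by move=> st; apply: iter_op_lim_fixed => f; exact: uniformized_stable.
suff hE : forall w, bounded_weight w -> h w = stab xi w.
  move=> zc; rewrite -hE//.
  exact: (iter_op_cvg uniformized_le uniformized_cst ind01' uniformized_ind).
have cmp (s : R) : `|s| = 1 -> forall w, bounded_weight w -> s * (h w - stab xi w) <= 0.
  move=> s1 w wc.
  apply: (@topple_max _ _ _ _ _ K_ge0 K_le1 g_ge0 g_super lambda_gt0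
    (fun w => s * (h w - stab xi w)) 1 c _ _ w wc) => z zc.
    apply: le_trans (ler_norm _) _; rewrite normrM s1 mul1r ler_norml.
    have := h01 z zc; have := stab01 K_ge0 K_le1 lambda_gt0 xi z; lra.
  have [st|/existsNP[x /negP]] := pselect (stable z).
    left; rewrite hst//; have [xi' ->] := of_stableP st.
    rewrite stab_stable /ind (inj_eq (@of_stable_inj _)) subrr mulr0//.
  rewrite negbK => xa; right.
  have H : \sum_(y | active y z) (nactive (z y))%:R / (c + 1) * (s * (topple y h z - h z)) = 0.
    have := hfix z zc; rewrite uniformizedE mulrBl mul1r mulr_suml => H0.
    rewrite -[RHS](mulr0 s) -[in RHS](subrr (h z)) -[X in s * (X - _)]H0.
    rewrite [X in s * X](_ : _ = \sum_(y | active y z) (nactive (z y))%:R / (c + 1) * topple y h z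
      - \sum_(y | active y z) (nactive (z y))%:R / (c + 1) * h z); last by ring.
    by rewrite -sumrB mulr_sumr; apply: eq_bigr => y _; ring.
  have [y ya yh] : exists2 y, active y z & 0 <= s * (topple y h z - h z).
    apply: contrapT => none; suff : \sum_(y | active y z)
      (nactive (z y))%:R / (c + 1) * (s * (topple y h z - h z)) < 0 by rewrite H ltxx.
    have neg y : active y z -> (nactive (z y))%:R / (c + 1) * (s * (topple y h z - h z)) < 0.
      move=> ya; rewrite pmulr_rlt0 ?divr_gt0 ?ltr0n ?ltr_wpDl//.
      by rewrite ltNge; apply/negP => ?; apply: none; exists y.
    rewrite (bigD1 x)//= ltr_wnDr ?neg// sumr_le0// => y /andP[ya _].
    exact/ltW/neg.
  exists y => //; rewrite toppleZ toppleB.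
  rewrite [X in _ <= _ * (_ - X)](stab_topple K_ge0 K_le1 g_ge0 g_super lambda_gt0 xi ya).
  rewrite -subr_ge0; apply: le_trans yh _; rewrite le_eqVlt; apply/orP; left; apply/eqP; ring.
move=> w wc; have := cmp 1 (normr1 _) w wc; have := cmp (-1) (normrN1 _) w wc.
by lra.
Qed.

End Uniformization.

Local Open Scope classical_set_scope.

Lemma arw_absorptionE xi eta :
  arw_absorption K lambda eta (of_stable xi) = stab xi eta.
Proof.
pose c : R := weight (fun=> 1) eta.
have c0 : 0 <= c by apply: weight_ge0.
pose Rate : R := (1 + lambda) * (c + 1).
have Rate0 : 0 < Rate by rewrite mulr_gt0// ltr_wpDl.
pose ind : config V -> R := fun zeta => (zeta == of_stable xi)%:R.
pose a j := iter j (uniformized c) ind eta.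
have a01 j : 0 <= a j <= 1 by apply: uniformized_iter01.
have a1 j : `|a j| <= 1 by have /andP[a0 ?] := a01 j; rewrite ger0_norm.
have al : a k @[k --> \oo] --> stab xi eta by apply: uniformized_iter_cvg.
have sgE t : 0 <= t -> arw_semigroup K lambda t ind eta =
   expR (- (t * Rate)) * limn (series (fun k => exp_term (t * Rate) k * a k)).
  move=> t0.
  have tR0 : 0 <= t * Rate by rewrite mulr_ge0// ltW.
  rewrite mulrC; apply: cvg_lim => //.
  rewrite (_ : (fun k => _) = (fun k => \sum_(i < k.+1)
     (exp_term (t * Rate) i * a i) * exp_term (- (t * Rate)) (k - i)%N)).
    apply: (@exp_cauchy_product _ (t * Rate) (t * Rate)) => k.
      by rewrite normrM ger0_norm ?exp_term_ge0// ler_piMr ?exp_term_ge0.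
    by rewrite /exp_term normrM normfV normrX normrN normr_nat ger0_norm.
  apply/funext => k.
  (* As [L = Rate * (U - 1)] for the uniformized step [U], the array satisfies the recursion of
     [exp_term_binomial], which exhibits the semigroup as a Poisson average of [a]. *)
  pose b k i := t ^+ k * iter k L (iter i (uniformized c) ind) eta.
  transitivity (b k 0%N / k`!%:R); first exact: mulrAC.
  rewrite (@exp_term_binomial _ (t * Rate) b) => [|{}k i].
    apply: eq_bigr => j _; rewrite /b expr0 mul1r add0n /=; exact: mulrAC.
  rewrite /b exprS iterSr.
  have -> : L (iter i (uniformized c) ind) = fun zeta =>
     Rate * (iter i.+1 (uniformized c) ind zeta - iter i (uniformized c) ind zeta).
    have LE f zeta : L f zeta = Rate * (uniformized c f zeta - f zeta).
      by rewrite /uniformized [_ + _ - _]addrC addKr mulrA divff ?gt_eqF// mul1r.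
    by apply/funext => zeta; exact: LE.
  rewrite iter_generator_lin; ring.
apply: cvg_lim => //.
have Rcvg : t * Rate @[t --> +oo] --> +oo.
  by apply: gt0_cvgMly => //; exact: cvg_id.
have := cvg_comp _ _ Rcvg (exp_average a1 al).
apply: cvg_trans; apply: near_eq_cvg; near=> t.
by rewrite /= sgE.
Unshelve. all: by end_near. Qed.

End Absorption.

(** * Separation from equilibrium *)

Lemma geometric_le (R : realType) (a C r : R) : 0 <= r < 1 ->
  (forall t, a <= C * r ^+ t) -> a <= 0.
Proof.
move=> /andP[r0 r1] aC; have nr : `|r| < 1 by rewrite ger0_norm.
rewrite -(cvg_lim _ (@cvg_geometric _ C r nr))//; apply: limr_ge.
  by apply/cvg_ex; exists 0; exact: cvg_geometric.
by apply: nearW => t; rewrite /geometric/=.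
Qed.

Section MarkovOperator.
Variables (R : realType) (X : finType) (P : X -> X -> R).
Hypothesis P_sum : forall x, \sum_y P x y = 1.

Definition markov_op (F : X -> R) (x : X) : R := \sum_y P x y * F y.

Lemma iter_markov_op t F x :
  iter t markov_op F x = \sum_y chain_pow P t x y * F y.
Proof.
elim: t x => [|t IH] x.
  rewrite /chain_pow expr0 (bigD1 x)//= mxE eqxx mul1r big1 ?addr0// => y yx.
  by rewrite mxE (inj_eq enum_rank_inj) eq_sym (negbTE yx) mul0r.
rewrite iterS /markov_op.
under eq_bigr do rewrite IH mulr_sumr.
rewrite exchange_big/=; apply: eq_bigr => y _.
rewrite /chain_pow exprS mxE mulr_suml (reindex _ (onW_bij _ (@enum_rank_bij X)))/=.
by apply: eq_bigr => z _; rewrite mxE !enum_rankK mulrA.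
Qed.

Lemma chain_powE t x y : chain_pow P t x y = iter t markov_op (fun z => (z == y)%:R) x.
Proof.
rewrite iter_markov_op (bigD1 y)//= eqxx mulr1 big1 ?addr0// => z /negbTE ->.
by rewrite mulr0.
Qed.

Lemma iter_markov_op1 t x : iter t markov_op (fun=> 1) x = 1.
Proof.
elim: t x => [|t IH] x //=; rewrite /markov_op -[RHS](P_sum x).
by apply: eq_bigr => y _; rewrite IH mulr1.
Qed.

End MarkovOperator.

(** * Stationary law and separation distance of the ARW chain *)

Section Chain.
Variables (R : realType) (V : finType) (K : V -> V -> R) (g : V -> R) (lambda : R).
Variables (nu : V -> R) (M : R).
Hypothesis K_ge0 : forall x y, 0 <= K x y.
Hypothesis K_le1 : forall x, \sum_y K x y <= 1.
Hypothesis g_ge0 : forall x, 0 <= g x.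
Hypothesis g_super : forall x, 1 + \sum_y K x y * g y <= g x.
Hypothesis lambda_gt0 : 0 < lambda.
Hypothesis nu_sum : \sum_x nu x = 1.
Hypothesis M_gt0 : 0 < M.
Hypothesis nu_ge : forall x, M^-1 <= nu x.

Implicit Types (eta zeta : config V) (x y z : V) (f h : config V -> R).
Implicit Types (F : stable_config V -> R) (xi : stable_config V) (A B : {set V}).

Notation stab := (stab K lambda).
Notation unfilled := (unfilled K nu).
Notation P := (ARW K lambda nu).
Notation markov := (markov_op P).

Let nu_ge0 x : 0 <= nu x.
Proof. by apply: le_trans (nu_ge x); rewrite invr_ge0 ltW. Qed.

Let lambda1_gt0 : 0 < 1 + lambda. Proof. by rewrite addr_gt0. Qed.

Definition harmonic f :=
  (forall x eta, active x eta -> topple K lambda x f eta = f eta) /\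
  exists b, forall eta, `|f eta| <= b.

Definition stab_mean F eta : R := \sum_xi stab xi eta * F xi.

Lemma stab_mean_harmonic F : harmonic (stab_mean F).
Proof.
split=> [x eta xa|].
  rewrite (_ : stab_mean F = fun zeta => \sum_xi F xi * stab xi zeta); last first.
    by apply/funext => zeta; apply: eq_bigr => xi _; rewrite mulrC.
  rewrite topple_sum; apply: eq_bigr => xi _.
  by rewrite toppleZ (stab_topple K_ge0 K_le1 g_ge0 g_super lambda_gt0).
exists (\sum_xi `|F xi|) => eta; apply: le_trans (ler_norm_sum _ _ _) _.
apply: ler_sum => xi _; have /andP[s0 s1] := stab01 K_ge0 K_le1 lambda_gt0 xi eta.
by rewrite normrM ger0_norm// ler_piMl.
Qed.

Lemma stab_mean_stable F xi : stab_mean F (of_stable xi) = F xi.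
Proof.
rewrite /stab_mean (bigD1 xi)//= stab_stable eqxx mul1r big1 ?addr0// => z.
by rewrite stab_stable eq_sym => /negbTE ->; rewrite mul0r.
Qed.

Lemma harmonic_stab_mean f : harmonic f ->
  f =1 stab_mean (fun xi => f (of_stable xi)).
Proof.
move=> [fT fb]; have [sT sb] := stab_mean_harmonic (fun xi => f (of_stable xi)).
apply: (harmonic_unique K_ge0 K_le1 g_ge0 g_super lambda_gt0) => // xi.
by rewrite stab_mean_stable.
Qed.

(** Almost sure absorption, obtained from uniqueness since the constant 1 is invariant under
    topplings. *)
Lemma stab_sum eta : \sum_xi stab xi eta = 1.
Proof.
have h1 : harmonic (fun=> 1).
  by split=> [x zeta _|]; [rewrite topple_cst|exists 1 => zeta; rewrite normr1].
rewrite [RHS](harmonic_stab_mean h1 eta).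
by apply: eq_bigr => xi _; rewrite mulr1.
Qed.

Lemma stab_mean_delta xi eta : stab_mean (fun xi' => (xi' == xi)%:R) eta = stab xi eta.
Proof.
rewrite /stab_mean (bigD1 xi)//= eqxx mulr1 big1 ?addr0// => z /negbTE ->.
by rewrite mulr0.
Qed.

Lemma stab_mean_ge0 F eta : (forall xi, 0 <= F xi) -> 0 <= stab_mean F eta.
Proof.
move=> F0; apply: sumr_ge0 => xi _.
by rewrite mulr_ge0// (stab_ge0 K_ge0 K_le1 lambda_gt0).
Qed.

Definition add_mean f eta : R := \sum_x nu x * f (add_active x eta).

Lemma add_mean_harmonic f : harmonic f -> harmonic (add_mean f).
Proof.
move=> [fT [b fb]]; split=> [y eta ya|].
  rewrite topple_sum; apply: eq_bigr => x _; rewrite toppleZ; congr (_ * _).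
  by rewrite topple_add// fT// active_add.
exists b => eta; apply: le_trans (ler_norm_sum _ _ _) _.
rewrite -[leRHS]mul1r -nu_sum mulr_suml; apply: ler_sum => x _.
by rewrite normrM ger0_norm// ler_wpM2l.
Qed.

Lemma markovE F xi : markov F xi = add_mean (stab_mean F) (of_stable xi).
Proof.
rewrite /markov_op /add_mean /stab_mean.
under [RHS]eq_bigr do rewrite mulr_sumr.
rewrite exchange_big/=; apply: eq_bigr => xi' _.
rewrite /ARW mulr_suml; apply: eq_bigr => x _.
by rewrite (arw_absorptionE K_ge0 K_le1 g_ge0 g_super lambda_gt0) mulrA.
Qed.

(* Inserting a particle before or after stabilizing makes no difference. *)
Lemma stab_mean_markov F : stab_mean (markov F) =1 add_mean (stab_mean F).
Proof.
move=> eta.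
rewrite (harmonic_stab_mean (add_mean_harmonic (stab_mean_harmonic F))).
by apply: eq_bigr => xi _; rewrite markovE.
Qed.

Lemma ARW_sum xi : \sum_xi' P xi xi' = 1.
Proof.
have := markovE (fun=> 1) xi; rewrite /markov_op.
under eq_bigr do rewrite mulr1.
move=> ->; rewrite -[RHS]nu_sum; apply: eq_bigr => x _.
by rewrite /stab_mean; under eq_bigr do rewrite mulr1; rewrite stab_sum mulr1.
Qed.

Lemma remove_add_same x eta : eta x != None -> remove_active x (add_active x eta) = eta.
Proof.
case E: (eta x) => [k|//] _; apply/ffunP => z; rewrite remove_activeE ?active_add_same//.
by rewrite /nactive !add_activeE eqxx E; case: eqVneq => [->|].
Qed.

(* The extra particle performs a [K]-walk while it shares its site. *)
Lemma harmonic_walk f x eta : harmonic f -> active x eta ->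
  f (add_active x eta) =
  \sum_y K x y * f (add_active y eta) + (1 - \sum_y K x y) * f eta.
Proof.
move=> [fT _] xa; have := fT x _ (active_add_same x eta).
have xN : eta x != None by case/activeP: xa => k ->.
(* Site [x] now holds at least two particles, so sleep is ignored and its share cancels against the
   factor [1 + lambda]: no [lambda] is left. *)
rewrite toppleE remove_add_same// (_ : (_ == Some 1%N) = false); last first.
  by have [k E] := activeP xa; rewrite add_activeE eqxx E.
rewrite [\sum_y K x y * f (jump x y _)]
  (eq_bigr (fun y => K x y * f (add_active y eta))) => [|y _]; last first.
  by rewrite /jump remove_add_same.
move: (f (add_active x eta)) (\sum_y K x y * f (add_active y eta)) => a b.
move/(congr1 (fun u => (1 + lambda) * u)); rewrite mulrA divff ?gt_eqF// mul1r.
by move=> E; move: E; lra.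
Qed.

Lemma harmonic_exit f A eta : harmonic f -> {in A, forall x, active x eta} ->
  forall x, f (add_active x eta) =
    \sum_(z | z \notin A) exit_prob K A x z * f (add_active z eta)
    + (1 - \sum_(z | z \notin A) exit_prob K A x z) * f eta.
Proof.
move=> fh Aa; apply: (exit_harmonic K_ge0 g_ge0 g_super) => x xA.
exact: harmonic_walk fh (Aa x xA).
Qed.

Definition ones A : config V := [ffun x => Some (x \in A : nat)].

Lemma active_ones A x : active x (ones A) = (x \in A).
Proof. by rewrite /active ffunE/=; case: (x \in A). Qed.

Lemma add_ones A x : x \notin A -> add_active x (ones A) = ones (x |: A).
Proof.
move=> xA; apply/ffunP => z; rewrite add_activeE !ffunE in_setU1 (negbTE xA).
by case: eqVneq.
Qed.

(** On a fully active configuration an additional particle can be walked until it is killed, as it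
    never reaches a site where it has to stop. Surplus particles are removed in this way one by
    one. *)
Lemma harmonic_full f eta : harmonic f -> (forall x, active x eta) ->
  f eta = f (ones [set: V]).
Proof.
move=> fh; have [n] := ubnP (\sum_x nactive (eta x)); elim: n eta => // n IH eta.
move=> etan etaa.
have [all1|/existsNP[x xn]] := pselect (forall x, eta x = Some 1%N).
  by congr f; apply/ffunP => x; rewrite all1 ffunE inE.
have [k E] := activeP (etaa x).
have k0 : (0 < k)%N by rewrite lt0n; apply/eqP => k0; apply: xn; rewrite E k0.
pose eta' := remove_active x eta.
have eta'E z : eta' z = if z == x then Some k else eta z.
  by rewrite /eta' remove_activeE// E.
have eta'a z : active z eta'.
  by rewrite /active eta'E; case: eqVneq => //= _; exact: etaa.
have <- : add_active x eta' = eta.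
  apply/ffunP => z; rewrite add_activeE !eta'E eqxx.
  by case: eqVneq => [->|]; rewrite ?E.
have noT z : (z \notin [set: V]) = false by rewrite inE.
rewrite (@harmonic_exit f [set: V])// !(big_pred0 _ _ _ _ noT) add0r subr0 mul1r.
apply: IH => //; rewrite -ltnS; apply: leq_trans etan.
rewrite ltnS (bigD1 x)//= [in leqRHS](bigD1 x)//= eta'E eqxx E/= addSn ltnS leq_add//.
by apply: eq_leq; apply: eq_bigr => z /negbTE zx; rewrite eta'E zx.
Qed.

(** The inserted particle is moved while it stands on [A], whose own particles are held back, and
    stays active where it leaves [A]. Stabilization is thus postponed past all insertions. *)
Lemma stab_mean_ones_markov F A :
  stab_mean (markov F) (ones A) = idla K nu (fun B => stab_mean F (ones B)) A.
Proof.
rewrite stab_mean_markov idlaE /add_mean.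
have Aa : {in A, forall x, active x (ones A)} by move=> x; rewrite active_ones.
under eq_bigr do rewrite (harmonic_exit (stab_mean_harmonic F) Aa) mulrDr.
rewrite big_split/= addrC; congr (_ + _).
  rewrite -[1 in RHS]nu_sum [X in _ = (_ - X) * _]exchange_big/= -sumrB mulr_suml.
  by apply: eq_bigr => x _; rewrite -mulr_sumr; ring.
under eq_bigr do rewrite mulr_sumr.
rewrite exchange_big/=; apply: eq_bigr => z zA; rewrite mulr_suml.
by apply: eq_bigr => x _; rewrite mulrA add_ones.
Qed.

Lemma stab_mean_ones_iter t F A :
  stab_mean (iter t markov F) (ones A) = iter t (idla K nu) (fun B => stab_mean F (ones B)) A.
Proof.
elim: t A => [//|t IH] A; rewrite iterS stab_mean_ones_markov iterS.
by congr (idla _ _ _ A); apply/funext => B.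
Qed.

(** Same strategy with arbitrary content outside [A]: a particle arriving at [z] makes [z] active
    whatever it held, so the growing set stays active until it is full, when [harmonic_full] forgets
    the rest. Unfilled outcomes contribute at least 0. *)
Lemma unfilled_lower t F A eta : (forall xi, 0 <= F xi) ->
  {in A, forall x, active x eta} ->
  (1 - unfilled t A) * stab_mean F (ones [set: V]) <= stab_mean (iter t markov F) eta.
Proof.
move=> F0; elim: t A eta => [|t IH] A eta Aa.
  rewrite /unfilled/=; have [AT|_] := eqVneq A [set: V]; last first.
    by rewrite subrr mul0r stab_mean_ge0.
  rewrite subr0 mul1r (@harmonic_full _ eta)//; first exact: stab_mean_harmonic.
  by move=> x; apply: Aa; rewrite AT inE.
rewrite iterS stab_mean_markov unfilledS -idla1B -idlaZ idlaE /add_mean.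
have fh := stab_mean_harmonic (iter t markov F).
set f := stab_mean _ in fh *.
under [leRHS]eq_bigr do rewrite (harmonic_exit fh Aa) mulrDr.
rewrite big_split/= [leRHS]addrC; apply: lerD.
  rewrite [leRHS](_ : _ = (1 - \sum_(z | z \notin A) settle K nu A z) * f eta).
    rewrite ler_wpM2l ?IH// subr_ge0.
    exact: (settle_sum_le1 K_ge0 K_le1 g_ge0 g_super nu_sum M_gt0 nu_ge).
  rewrite -[1 in RHS]nu_sum [X in _ = (_ - X) * _]exchange_big/= -sumrB mulr_suml.
  by apply: eq_bigr => x _; rewrite -mulr_sumr; ring.
under [leRHS]eq_bigr do rewrite mulr_sumr.
rewrite [leRHS]exchange_big/=; apply: ler_sum => z zA; rewrite mulr_suml.
apply: ler_sum => x _; rewrite -mulrA ler_wpM2l// ler_wpM2l//.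
  exact: (exit_prob_ge0 K_ge0 g_ge0 g_super).
apply: IH => y; rewrite in_setU1 => /predU1P[->|/Aa]; first exact: active_add_same.
exact: active_add.
Qed.

Definition all_asleep : stable_config V := [ffun=> true].

Definition none_asleep : stable_config V := [ffun=> false].

Lemma of_none_asleep : of_stable none_asleep = ones (finset.set0 : {set V}).
Proof. by apply/ffunP => x; rewrite !ffunE inE. Qed.

(** Particles are never created, and [A] supplies too few of them for [all_asleep]. The count enters
    through the bound [c] of [topple_max]. *)
Lemma stab_all_asleep A : A != [set: V] -> stab all_asleep (ones A) = 0.
Proof.
move=> AT; apply/eqP; rewrite eq_le (stab_ge0 K_ge0 K_le1 lambda_gt0) andbT.
apply: (topple_max K_ge0 K_le1 g_ge0 g_super lambda_gt0 (b := 1)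
  (c := weight (fun=> 1) (ones A))) => // [eta _|eta etaw].
  by case/andP: (stab01 K_ge0 K_le1 lambda_gt0 all_asleep eta).
have [st|/existsNP[x /negP]] := pselect (stable eta); last first.
  rewrite negbK => xa; right; exists x => //.
  by rewrite (stab_topple K_ge0 K_le1 g_ge0 g_super lambda_gt0).
left; have [xi E] := of_stableP st; rewrite E stab_stable.
have [xiE|//] := eqVneq xi all_asleep.
move: etaw; rewrite E xiE leNgt => /negP[].
move: AT; rewrite -finset.subTset => /subsetPn[x _ xA].
rewrite /weight (bigD1 x)//= [ltRHS](bigD1 x)//= !ffunE (negbTE xA)/= mul0r mul1r ltr_leD//.
by apply: ler_sum => y _; rewrite !ffunE ler_wpM2r// ler_nat; case: (y \in A).
Qed.

Lemma stab_all_asleep_idla t :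
  chain_pow P t none_asleep all_asleep =
  (1 - unfilled t finset.set0) * stab all_asleep (ones [set: V]).
Proof.
rewrite chain_powE -(stab_mean_stable (iter t _ _)) of_none_asleep stab_mean_ones_iter.
have -> : (fun B => stab_mean (fun xi => (xi == all_asleep)%:R) (ones B)) =
   (fun B => (1 - (B != [set: V])%:R) * stab all_asleep (ones [set: V])).
  apply/funext => B; rewrite stab_mean_delta.
  have [->|BT] := eqVneq B [set: V]; first by rewrite subr0 mul1r.
  by rewrite subrr mul0r stab_all_asleep.
rewrite /unfilled; elim: t (finset.set0 : {set V}) => [//|t IH] A.
rewrite !iterS -idla1B -idlaZ; congr (idla _ _ _ A).
by apply/funext.
Qed.


Lemma stab_gt0_step xi x eta i : active x eta ->
  instr_prob K lambda x i * stab xi (obey x i eta) <= stab xi eta.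
Proof.
move=> xa; rewrite -(stab_topple K_ge0 K_le1 g_ge0 g_super lambda_gt0 xi xa).
rewrite /topple (bigD1 i)//= lerDl sumr_ge0// => j _.
by rewrite mulr_ge0 ?instr_prob_ge0// (stab_ge0 K_ge0 K_le1).
Qed.

Definition partly_asleep (A : {set V}) xi : config V :=
  [ffun x => if x \in A then Some 1%N else if xi x then None else Some 0%N].

Lemma stab_partly_asleep_gt0 xi A : {in A, forall x, xi x} ->
  0 < stab xi (partly_asleep A xi).
Proof.
have [n] := ubnP #|A|; elim: n A => // n IH A An Axi.
have [->|[x xA]] := set_0Vmem A.
  have -> : partly_asleep finset.set0 xi = of_stable xi.
    by apply/ffunP => x; rewrite !ffunE inE.
  by rewrite stab_stable eqxx ltr01.
have xa : active x (partly_asleep A xi) by rewrite /active ffunE xA.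
apply: lt_le_trans (stab_gt0_step xi None xa); rewrite mulr_gt0 ?divr_gt0//.
have -> : obey x None (partly_asleep A xi) = partly_asleep (A :\ x) xi.
  apply/ffunP => y; rewrite /= ffunE xA eqxx !ffunE !inE.
  by have [->|//] := eqVneq y x; rewrite Axi.
apply: IH => [|y]; last by rewrite in_setD1 => /andP[_]; exact: Axi.
by move: An; rewrite (cardsD1 x) xA.
Qed.

(* Otherwise [K] would be stochastic on the set of zeros of [u]. *)
Lemma kernel_pos (c v : R) (u : V -> R) : 0 < c -> 0 < v -> (forall x, 0 <= u x) ->
  (forall x, c * (\sum_y K x y * u y + (1 - \sum_y K x y) * v) <= u x) ->
  forall x, 0 < u x.
Proof.
move=> c0 v0 u0 uK x; rewrite lt0r u0 andbT; apply/negP => /eqP ux0.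
(* Take a zero of [u] where [g] is least: all the mass of [K y] then lies on zeros, so [K g >= g] at
   [y], against [g_super]. *)
have [y /eqP uy0 ymin] := @arg_minP _ _ _ x (fun y => u y == 0) g (introT eqP ux0).
have s0 : 0 <= \sum_z K y z * u z by apply: sumr_ge0 => z _; rewrite mulr_ge0.
have k0 : 0 <= 1 - \sum_z K y z by rewrite subr_ge0.
have := uK y; rewrite uy0 pmulr_rle0// => le0.
have v1 : 0 <= (1 - \sum_z K y z) * v by rewrite mulr_ge0// ltW.
have K1 : \sum_z K y z = 1.
  apply/eqP; rewrite eq_sym -subr_eq0 -(mulIr_eq0 _ (mulIf (lt0r_neq0 v0))).
  by rewrite eq_le v1 andbT; apply: le_trans le0; rewrite lerDr.
have K0 z : K y z * u z = 0.
  apply/eqP; move: (le0); rewrite K1 subrr mul0r addr0 => sle.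
  have /eqP : \sum_z K y z * u z = 0 by apply/eqP; rewrite eq_le sle.
  rewrite psumr_eq0 => [/allP/(_ z)|w _]; last by rewrite mulr_ge0.
  by rewrite mem_index_enum => /(_ isT).
have := g_super y; apply/negP; rewrite -ltNge ltr_pwDl//.
rewrite -[leLHS]mul1r -[X in X * _]K1 mulr_suml; apply: ler_sum => z _.
move/eqP: (K0 z); rewrite mulf_eq0 => /orP[/eqP->|uz]; first by rewrite !mul0r.
by rewrite ler_wpM2l// ymin.
Qed.

(** With positive probability, the particles on sites left empty by [xi] are walked to their death
    in turn ([kernel_pos], with [v] the value without the particle), and then the others fall asleep
    one at a time. *)
Lemma stab_ones_gt0 xi A : (forall x, xi x -> x \in A) -> 0 < stab xi (ones A).
Proof.
have [n] := ubnP #|A|; elim: n A => // n IH A An Axi.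
have [/existsP[x /andP[xA xN]]|none] := boolP [exists x, (x \in A) && ~~ xi x]; last first.
  have -> : ones A = partly_asleep A xi.
    apply/ffunP => x; rewrite !ffunE; case: (boolP (x \in A)) => // xA.
    by case: ifP => // /Axi; rewrite (negbTE xA).
  apply: stab_partly_asleep_gt0 => x xA; apply: contraNT none => xN.
  by apply/existsP; exists x; rewrite xA.
have -> : ones A = add_active x (ones (A :\ x)).
  by rewrite add_ones; [rewrite finset.setD1K|rewrite !inE eqxx].
have v0 : 0 < stab xi (ones (A :\ x)).
  apply: IH => [|y xiy]; first by move: An; rewrite (cardsD1 x) xA.
  by rewrite !inE Axi// andbT; apply: contraNneq xN => <-.
apply: (@kernel_pos (1 + lambda)^-1 _ (fun y => stab xi (add_active y (ones (A :\ x)))) _ v0).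
- by rewrite invr_gt0.
- by move=> y; exact: (stab_ge0 K_ge0 K_le1).
move=> y.
have ya := active_add_same y (ones (A :\ x)).
rewrite -[leRHS](stab_topple K_ge0 K_le1 g_ge0 g_super lambda_gt0 xi ya).
have yN : ones (A :\ x) y != None by rewrite ffunE.
rewrite toppleE ler_wpM2l ?invr_ge0 ?(ltW lambda1_gt0)//.
rewrite remove_add_same// -addrA [leLHS]addrC.
rewrite [\sum_z K y z * stab xi (jump y z _)](eq_bigr
   (fun z => K y z * stab xi (add_active z (ones (A :\ x))))) => [|z _]; last first.
  by rewrite /jump remove_add_same.
by rewrite lerDr mulr_ge0 ?(ltW lambda_gt0)// (stab_ge0 K_ge0 K_le1).
Qed.

Definition stationary : {ffun stable_config V -> R} := [ffun xi => stab xi (ones [set: V])].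

Lemma stationary_gt0 xi : 0 < stationary xi.
Proof. by rewrite ffunE stab_ones_gt0// => x _; rewrite inE. Qed.

Lemma stationary_sum : \sum_xi stationary xi = 1.
Proof. by under eq_bigr do rewrite ffunE; exact: stab_sum. Qed.

(** Nothing can settle in the full set, where [idla] is the identity, so the intertwining there is
    the invariance equation. *)
Lemma stationary_invariant : is_invariant P stationary.
Proof.
split=> [xi||xi]; first exact/ltW/stationary_gt0.
  exact: stationary_sum.
have := stab_mean_ones_markov (fun xi' => (xi' == xi)%:R) [set: V].
rewrite /idla big_pred0 => [|z]; last by rewrite inE.
rewrite addr0 stab_mean_delta ffunE => <-; rewrite /stab_mean.
apply: eq_bigr => xi' _; rewrite ffunE; congr (_ * _).
by rewrite /markov_op (bigD1 xi)//= eqxx mulr1 big1 ?addr0// => z /negbTE ->; rewrite mulr0.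
Qed.

Lemma chain_pow_ge t xi xi' :
  (1 - unfilled t finset.set0) * stationary xi' <= chain_pow P t xi xi'.
Proof.
rewrite chain_powE ffunE -[X in _ * X]stab_mean_delta -(stab_mean_stable (iter t _ _)).
apply: unfilled_lower => [z|x]; first by case: (_ == _).
by rewrite inE.
Qed.

Lemma unfilled0_le t : unfilled t finset.set0 <= #|V|%:R * (1 - M^-1) ^+ t.
Proof.
have := unfilled_le K_ge0 K_le1 g_ge0 g_super nu_sum M_gt0 nu_ge t finset.set0.
by rewrite finset.setC0 cardsT.
Qed.

(** Any invariant [p] dominates [1 - unfilled t] times [stationary] for all [t], hence dominates
    [stationary]; equal masses give equality. *)
Lemma invariant_lawE : invariant_law P = stationary.
Proof.
apply: xget_unique; first exact: stationary_invariant.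
move=> p [p0 psum pinv].
have pt t xi : \sum_xi' p xi' * chain_pow P t xi' xi = p xi.
  elim: t xi => [|t IH] xi.
    rewrite (bigD1 xi)//= chain_powE/= eqxx mulr1 big1 ?addr0// => xi' /negbTE xi'N.
    by rewrite chain_powE /= xi'N mulr0.
  transitivity (\sum_xi' p xi' * chain_pow P t xi' xi); last exact: IH.
  under eq_bigr do rewrite chain_powE iterS /markov_op mulr_sumr.
  rewrite exchange_big/=; apply: eq_bigr => z _.
  rewrite chain_powE -(pinv z) mulr_suml; apply: eq_bigr => w _; exact: mulrA.
have ge xi : stationary xi <= p xi.
  rewrite -subr_le0; apply: (geometric_le (C := #|V|%:R * stationary xi)
    (decay01 nu_sum M_gt0 nu_ge)) => t.
  rewrite -(pt t xi) mulrAC.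
  apply: (@le_trans _ _ (unfilled t finset.set0 * stationary xi)); last first.
    by rewrite ler_wpM2r ?unfilled0_le// ltW// stationary_gt0.
  rewrite lerBlDr -lerBlDl -{1}[stationary xi]mul1r -mulrBl.
  rewrite -[leLHS]mul1r -[X in X * _ <= _]psum mulr_suml; apply: ler_sum => z _.
  by rewrite ler_wpM2l// chain_pow_ge.
apply/ffunP => xi; apply/eqP; rewrite -subr_eq0.
have /eqP : \sum_xi (p xi - stationary xi) = 0.
  by rewrite sumrB psum stationary_sum subrr.
rewrite psumr_eq0 => [/allP/(_ xi)|z _]; last by rewrite subr_ge0.
by rewrite mem_index_enum => /(_ isT).
Qed.

Lemma d_sepE t : d_sep P t = unfilled t finset.set0.
Proof.
have ub : ubound [set r : R | exists x y : stable_config V,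
      r = 1 - chain_pow P t x y / invariant_law P y]%classic (unfilled t finset.set0).
  move=> _ [xi [xi' ->]]; rewrite invariant_lawE lerBlDr -lerBlDl.
  by rewrite ler_pdivlMr ?stationary_gt0// chain_pow_ge.
have mem : [set r : R | exists x y : stable_config V,
      r = 1 - chain_pow P t x y / invariant_law P y]%classic (unfilled t finset.set0).
  exists none_asleep, all_asleep.
  rewrite invariant_lawE stab_all_asleep_idla ffunE mulfK; first by ring.
  by have := stationary_gt0 all_asleep; rewrite ffunE => /lt0r_neq0.
apply/eqP; rewrite /d_sep eq_le ge_sup//=; last by exists (unfilled t finset.set0).
by apply: ub_le_sup => //; exists (unfilled t finset.set0).
Qed.

Lemma t_sepP (eps : R) : 0 < eps ->
  unfilled (t_sep P eps) finset.set0 <= eps /\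
  forall s, unfilled s finset.set0 <= eps -> (t_sep P eps <= s)%N.
Proof.
move=> e0.
have ex : exists t, unfilled t finset.set0 <= eps.
  apply: contrapT => /forallNP none.
  suff : eps <= 0 by rewrite leNgt e0.
  apply: (geometric_le (C := #|V|%:R) (decay01 nu_sum M_gt0 nu_ge)) => t.
  by apply: le_trans (unfilled0_le t); rewrite ltW// ltNge; apply/negP/none.
rewrite /t_sep; set S := [set t : nat | _]%classic.
have : S (xget 0%N S).
  apply: xgetPex; case: (ex_minnP ex) => t tP tmin; exists t; split.
    by rewrite d_sepE.
  by move=> s; rewrite d_sepE; exact: tmin.
by move=> [h1 h2]; split=> [|s]; rewrite -d_sepE//; exact: h2.
Qed.

End Chain.

(** * Spectrum *)

Section Spectrum.
Variables (R : realType) (V : finType) (K : V -> V -> R) (g : V -> R) (lambda : R).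
Variables (nu : V -> R) (M : R).
Hypothesis K_ge0 : forall x y, 0 <= K x y.
Hypothesis K_le1 : forall x, \sum_y K x y <= 1.
Hypothesis g_ge0 : forall x, 0 <= g x.
Hypothesis g_super : forall x, 1 + \sum_y K x y * g y <= g x.
Hypothesis lambda_gt0 : 0 < lambda.
Hypothesis nu_sum : \sum_x nu x = 1.
Hypothesis M_gt0 : 0 < M.
Hypothesis nu_ge : forall x, M^-1 <= nu x.

Notation P := (ARW K lambda nu).
Notation toC := (real_complex R).
Notation hit x := (settle K nu [set~ x] x).

Let toC_ge0 (a : R) : 0 <= a -> 0 <= toC a.
Proof. by move=> a0; rewrite (lecR 0 a). Qed.

(** A left eigenvector for [z != 1] has total mass 0, so subtracting [1 - u] times [stationary] from
    each row of the [t]-th power does not alter its action. The remainder is nonnegative with row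
    sums [u], so [|z| ^ t <= u], and [u] decays geometrically. *)
Lemma eigenvalue_le (z : R[i]) : z != 1 ->
  eigenvalue (map_mx toC (chain_mx P)) z -> complex.Re `|z| <= 1 - M^-1.
Proof.
move=> z1 /eigenvalueP[v vz v0].
pose w x := v 0 (enum_rank x).
have wP y : \sum_x w x * toC (P x y) = z * w y.
  move/matrixP: vz => /(_ 0 (enum_rank y)); rewrite !mxE => <-.
  rewrite [RHS](reindex _ (onW_bij _ (@enum_rank_bij _)))/=.
  by apply: eq_bigr => x _; rewrite !mxE !enum_rankK.
have wPt t y : \sum_x w x * toC (chain_pow P t x y) = z ^+ t * w y.
  elim: t y => [|t IH] y.
    rewrite (bigD1 y)//= chain_powE/= eqxx mulr1 expr0 mul1r big1 ?addr0// => x /negbTE xy.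
    by rewrite chain_powE/= xy mulr0.
  rewrite exprSr -mulrA mulrA (mulrC _ z) -mulrA -IH mulr_sumr.
  under [RHS]eq_bigr do rewrite mulrA -wP mulr_suml.
  rewrite exchange_big/=; apply: eq_bigr => x _.
  rewrite chain_powE iterS /markov_op rmorph_sum mulr_sumr; apply: eq_bigr => y' _.
  by rewrite -chain_powE rmorphM/= mulrA.
have w0 : \sum_x w x = 0.
  have : (1 - z) * \sum_x w x = 0.
    rewrite mulrBl mul1r mulr_sumr; under [X in _ - X]eq_bigr do rewrite -wP.
    rewrite exchange_big/= -sumrB big1// => x _.
    rewrite -mulr_sumr -rmorph_sum/=.
    rewrite (ARW_sum K_ge0 K_le1 g_ge0 g_super lambda_gt0 nu_sum).
    by rewrite rmorph1 mulr1 subrr.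
  by move/eqP; rewrite mulf_eq0 subr_eq0 [1 == z]eq_sym (negbTE z1)/= => /eqP.
have S0 : 0 < \sum_x `|w x|.
  rewrite lt0r sumr_ge0 ?andbT// psumr_neq0//.
  have [j vj] : exists j, v 0 j != 0.
    apply: contrapT => /forallNP none; move/negP: v0; apply; apply/eqP/rowP => j.
    by rewrite mxE; apply/eqP; have := none j; move/negP; rewrite negbK.
  apply/hasP; exists (enum_val j); first exact: mem_index_enum.
  by rewrite /= /w enum_valK normr_gt0.
pose rho := complex.Re `|z|.
have zE : `|z| = toC rho by rewrite /rho normc_def.
have rho0 : 0 <= rho by have := normr_ge0 z; rewrite zE (lecR 0 rho).
have bound t : rho ^+ t <= #|V|%:R * (1 - M^-1) ^+ t.
  pose u := unfilled K nu t finset.set0.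
  pose a x y := chain_pow P t x y - (1 - u) * stationary K lambda y.
  have a0 x y : 0 <= a x y.
    by rewrite subr_ge0 (chain_pow_ge K_ge0 K_le1 g_ge0 g_super lambda_gt0 nu_sum M_gt0 nu_ge).
  have asum x : \sum_y a x y = u.
    rewrite sumrB -mulr_sumr (stationary_sum K_ge0 K_le1 g_ge0 g_super lambda_gt0).
    rewrite mulr1 (_ : \sum_y _ = 1); first by ring.
    have := iter_markov_op1 (ARW_sum K_ge0 K_le1 g_ge0 g_super lambda_gt0 nu_sum) t x.
    by rewrite iter_markov_op => <-; apply: eq_bigr => y _; rewrite mulr1.
  have le y : `|z| ^+ t * `|w y| <= \sum_x `|w x| * toC (a x y).
    rewrite -normrX -normrM -wPt (_ : \sum_x _ = \sum_x w x * toC (a x y)).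
      apply: le_trans (ler_norm_sum _ _ _) _; apply: ler_sum => x _.
      by rewrite normrM (ger0_norm (toC_ge0 (a0 x y))).
    rewrite /a; under [RHS]eq_bigr do rewrite rmorphB mulrBr.
    by rewrite sumrB -[X in _ = _ - X]mulr_suml w0 mul0r subr0.
  have : `|z| ^+ t * \sum_x `|w x| <= toC u * \sum_x `|w x|.
    rewrite mulr_sumr; apply: (@le_trans _ _ (\sum_y \sum_x `|w x| * toC (a x y))).
      by apply: ler_sum => y _; exact: le.
    rewrite exchange_big/= mulr_sumr; apply: ler_sum => x _.
    by rewrite -mulr_sumr -rmorph_sum/= asum mulrC.
  rewrite ler_pM2r// zE -rmorphXn lecR => /le_trans; apply.
  exact: (unfilled0_le K_ge0 K_le1 g_ge0 g_super nu_sum M_gt0 nu_ge).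
rewrite -/rho leNgt; apply/negP => rlt.
have /andP[d0 d1] := decay01 nu_sum M_gt0 nu_ge.
have rho_gt0 : 0 < rho by exact: le_lt_trans rlt.
suff : (1 : R) <= 0 by rewrite ler10.
apply: (@geometric_le _ 1 #|V|%:R ((1 - M^-1) / rho)) => [|t].
  by rewrite divr_ge0//= ltr_pdivrMr// mul1r.
by rewrite expr_div_n mulrA ler_pdivlMr ?exprn_gt0// mul1r.
Qed.

(** [d] is the image of the eigenvector of internal DLA under the intertwining. It does not vanish:
    [all_asleep] has mass 0 in its first term and positive mass in its second. *)
Lemma hit_eigenvalue x : eigenvalue (map_mx toC (chain_mx P)) (toC (1 - hit x)).
Proof.
pose d xi := stab K lambda xi (ones [set~ x]) - stab K lambda xi (ones [set: V]).
have xT : [set~ x] != [set: V].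
  by apply/eqP => /setP/(_ x); rewrite !inE eqxx.
have dP xi : \sum_xi' d xi' * P xi' xi = (1 - hit x) * d xi.
  have E A : \sum_xi' stab K lambda xi' (ones A) * P xi' xi =
      idla K nu (fun B => stab K lambda xi (ones B)) A.
    have := stab_mean_ones_markov K_ge0 K_le1 g_ge0 g_super lambda_gt0 nu_sum M_gt0 nu_ge
      (fun xi' => (xi' == xi)%:R) A.
    rewrite (_ : (fun B => _) = (fun B => stab K lambda xi (ones B))); last first.
      by apply/funext => B; rewrite stab_mean_delta.
    move=> <-; apply: eq_bigr => xi' _; congr (_ * _).
    by rewrite /markov_op (bigD1 xi)//= eqxx mulr1 big1 ?addr0// => y /negbTE ->; rewrite mulr0.
  under eq_bigr do rewrite mulrBl.
  rewrite sumrB !E /idla [X in _ - (_ + X)]big_pred0 => [|y]; last by rewrite inE.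
  rewrite (big_pred1 x) => [|y]; last by rewrite !inE negbK.
  by rewrite finset.setUCr /d; ring.
apply/eigenvalueP; exists (map_mx toC (\row_j d (enum_val j))).
  rewrite -map_mxM; apply/rowP => j; rewrite !mxE -rmorphM; congr toC.
  rewrite -dP (reindex _ (onW_bij _ (@enum_rank_bij _)))/=.
  by apply: eq_bigr => xi _; rewrite !mxE !enum_rankK.
apply/eqP => /rowP/(_ (enum_rank (all_asleep V))); rewrite !mxE enum_rankK /d.
rewrite (stab_all_asleep K_ge0 K_le1 g_ge0 g_super lambda_gt0 xT) sub0r => /complexI/eqP.
rewrite oppr_eq0 gt_eqF//.
have := stationary_gt0 K_ge0 K_le1 g_ge0 g_super lambda_gt0 (all_asleep V).
by rewrite ffunE.
Qed.

Lemma spectral_rho_bounds x : 1 - hit x <= spectral_rho P <= 1 - M^-1.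
Proof.
have xx : x \notin [set~ x] by rewrite !inE negbK.
have hM := settle_ge K_ge0 g_ge0 g_super M_gt0 nu_ge xx.
have h1 : hit x <= 1.
  have := settle_sum_le1 K_ge0 K_le1 g_ge0 g_super nu_sum M_gt0 nu_ge [set~ x].
  by rewrite (big_pred1 x) => [//|y]; rewrite !inE negbK.
have mem : [set r : R | exists z : R[i],
         [/\ z != 1, eigenvalue (map_mx toC (chain_mx P)) z
           & r = complex.Re `|z|]]%classic (1 - hit x).
  exists (toC (1 - hit x)); split.
  - rewrite -(rmorph1 toC) (inj_eq (@complexI R)) -subr_eq0 addrAC subrr sub0r oppr_eq0.
    by rewrite gt_eqF// (lt_le_trans _ hM)// invr_gt0.
  - exact: hit_eigenvalue.
  - by rewrite ger0_norm// toC_ge0// subr_ge0.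
have ub : ubound [set r : R | exists z : R[i],
         [/\ z != 1, eigenvalue (map_mx toC (chain_mx P)) z
           & r = complex.Re `|z|]]%classic (1 - M^-1).
  by move=> _ [z [z1 ez ->]]; exact: eigenvalue_le.
apply/andP; split; first by apply: ub_le_sup => //; exists (1 - M^-1).
by apply: ge_sup => //; exists (1 - hit x).
Qed.

Lemma t_rel_bounds x : (hit x)^-1 <= t_rel P <= M.
Proof.
have /andP[l u] := spectral_rho_bounds x.
have Mi : 0 < M^-1 by rewrite invr_gt0.
have s0 : 0 < 1 - spectral_rho P by apply: lt_le_trans Mi _; lra.
have sh : 1 - spectral_rho P <= hit x by lra.
have h0 : 0 < hit x by exact: lt_le_trans sh.
apply/andP; split; first by rewrite lef_pV2// posrE.
by rewrite -[leRHS]invrK lef_pV2// ?posrE//; lra.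
Qed.

End Spectrum.

(** * Non-amenability *)

Section Cheeger.
Variables (R : realType) (V : finType) (a : V -> V -> R) (b deg : V -> R) (c D : R).
Hypothesis a_sym : forall x y, a x y = a y x.
Hypothesis a_ge0 : forall x y, 0 <= a x y.
Hypothesis b_ge0 : forall x, 0 <= b x.
Hypothesis deg_ge : forall x, \sum_y a x y + b x <= deg x.
Hypothesis deg_le : forall x, deg x <= D.
Hypothesis c_gt0 : 0 < c.
Hypothesis D_gt0 : 0 < D.
Hypothesis iso : forall A : {set V},
  c * #|A|%:R <= \sum_(x in A) (\sum_(y | y \notin A) a x y + b x).

Implicit Types (F f : V -> R).

(* Induction on the support: remove the lowest layer of [F]. *)
Lemma coarea F : (forall x, 0 <= F x) -> c * \sum_x F x <=
  \sum_x (\sum_y a x y * Num.max 0 (F x - F y) + b x * F x).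
Proof.
have [n] := ubnP #|[set x | F x != 0]|; elim: n F => // n IH F Fn F0.
pose A := [set x | F x != 0].
have [A0|[x0 x0A]] := set_0Vmem A.
  have Fz x : F x = 0.
    apply/eqP/negPn/negP => Fx; have : x \in A by rewrite inE.
    by rewrite A0 inE.
  rewrite big1 ?mulr0; last by move=> x _; exact: Fz.
  apply: sumr_ge0 => x _; rewrite addr_ge0 ?mulr_ge0 ?sumr_ge0// => y _.
  by rewrite mulr_ge0// le_max lexx.
have [x1 x1A x1min] := @arg_minP _ _ _ x0 (fun x => x \in A) F x0A.
pose m := F x1.
have m0 : 0 < m by rewrite lt0r F0 andbT; move: x1A; rewrite inE.
(* Lowering [F] by its least positive value [m] on its support [A] takes [c * m * #|A|] from the
   left-hand side and [m] times the boundary of [A] from the right-hand side; [iso] compares the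
   two. *)
pose F' x := F x - (x \in A)%:R * m.
have FA x : x \notin A -> F x = 0 by rewrite inE negbK => /eqP.
have F'0 x : 0 <= F' x.
  rewrite /F'; have [xA|xA] := boolP (x \in A); last by rewrite FA// mul0r subr0.
  by rewrite mul1r subr_ge0 x1min.
have F'n : (#|[set x | F' x != 0%R]| < n)%N.
  rewrite -ltnS; apply: leq_trans Fn; rewrite ltnS; apply: proper_card.
  apply/properP; split.
    apply/fintype.subsetP => x; rewrite !inE; apply: contra => /eqP Fx.
    have xA : (x \in A) = false by rewrite inE Fx eqxx.
    by rewrite /F' xA Fx mul0r subr0.
  by exists x1 => //; rewrite inE negbK /F' x1A mul1r subrr.
have := IH F' F'n F'0.
have -> : \sum_x F' x = \sum_x F x - #|A|%:R * m.
  have -> : #|A|%:R = \sum_x (x \in A)%:R :> R.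
    by rewrite -sum1_card natr_sum big_mkcond/=; apply: eq_bigr => x _; case: (x \in A).
  by rewrite mulr_suml -sumrB.
have -> : \sum_x (\sum_y a x y * Num.max 0 (F' x - F' y) + b x * F' x) =
   \sum_x (\sum_y a x y * Num.max 0 (F x - F y) + b x * F x)
   - m * \sum_(x in A) (\sum_(y | y \notin A) a x y + b x).
  rewrite mulr_sumr [X in _ - X]big_mkcond/= -sumrB; apply: eq_bigr => x _.
  have [xA|xA] := boolP (x \in A); last first.
    rewrite subr0 /F' (negbTE xA) mul0r subr0; congr (_ + _).
    apply: eq_bigr => y _; congr (_ * _); rewrite (FA x xA).
    have := F0 y; have := F'0 y; rewrite /F' => h1 h2.
    by rewrite !max_l// sub0r oppr_le0.
  have F'x : F' x = F x - m by rewrite /F' xA mul1r.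
  have E : \sum_y a x y * Num.max 0 (F x - m - F' y) =
      \sum_y a x y * Num.max 0 (F x - F y) - m * \sum_(y | y \notin A) a x y.
    rewrite mulr_sumr [X in _ = _ - X]big_mkcond/= -sumrB; apply: eq_bigr => y _.
    rewrite /F'; have [yA|yA] := boolP (y \in A).
      by rewrite mul1r /= subr0; congr (_ * Num.max 0 _); ring.
    have xm : 0 <= F x - m by rewrite subr_ge0 x1min.
    by rewrite /= mul0r (FA y yA) !subr0 !max_r//; ring.
  by rewrite F'x E; ring.
have := iso A; have := m0; set I := \sum_(x in A) _; set S := \sum_x _; set T := \sum_x _.
move: (#|A|%:R) => k m_gt0 kI H.
have : m * (c * k) <= m * I by rewrite ler_wpM2l// ltW.
by lra.
Qed.

(** Dirichlet form of the killed walk, paired so that an equation for [f - K f] can be inserted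
    directly. *)
Definition energy f : R := \sum_x f x * (deg x * f x - \sum_y a x y * f y).

Lemma energy_ge f :
  2^-1 * \sum_x \sum_y a x y * (f x - f y) ^+ 2 + \sum_x b x * f x ^+ 2 <= energy f.
Proof.
have -> : \sum_x \sum_y a x y * (f x - f y) ^+ 2 =
   2 * \sum_x (f x ^+ 2 * \sum_y a x y - f x * \sum_y a x y * f y).
  have E : \sum_x \sum_y a x y * f y ^+ 2 = \sum_x f x ^+ 2 * \sum_y a x y.
    rewrite exchange_big/=; apply: eq_bigr => y _; rewrite mulr_sumr.
    by apply: eq_bigr => x _; rewrite a_sym mulrC.
  rewrite mulr_sumr.
  rewrite [RHS](eq_bigr (fun x => (f x ^+ 2 * \sum_y a x y - 2 * (f x * \sum_y a x y * f y))
     + f x ^+ 2 * \sum_y a x y)) => [|x _]; last by ring.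
  rewrite [RHS]big_split/= -E -big_split/=; apply: eq_bigr => x _.
  rewrite !mulr_sumr -sumrB -big_split/=; apply: eq_bigr => y _; ring.
rewrite mulrA mulVf ?pnatr_eq0// mul1r -big_split/=; apply: ler_sum => x _.
have := deg_ge x; move: (\sum_y a x y) (\sum_y a x y * f y) => s t h.
have := ler_wpM2r (sqr_ge0 (f x)) h; rewrite expr2.
by lra.
Qed.

(** [coarea] for [f ^+ 2]. Differences of squares are split by the arithmetic-geometric mean
    inequality with weight [2 * D / c], chosen so that the resulting sum of squares is half of the
    left-hand side of [coarea] and is absorbed there. *)
Lemma cheeger f : c / 2 * \sum_x f x ^+ 2 <= (4 * D / c + 1) * energy f.
Proof.
have := @coarea (fun x => f x ^+ 2) (fun x => sqr_ge0 _).
have le x y : a x y * Num.max 0 (f x ^+ 2 - f y ^+ 2) <=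
   2 * D / c * (a x y * (f x - f y) ^+ 2) + c / (4 * D) * (a x y * (f x ^+ 2 + f y ^+ 2)).
  rewrite [leRHS](_ : _ = a x y * (2 * D / c * (f x - f y) ^+ 2
    + c / (4 * D) * (f x ^+ 2 + f y ^+ 2))); last by ring.
  rewrite ler_wpM2l// ge_max; apply/andP; split.
    by rewrite addr_ge0// mulr_ge0 ?addr_ge0 ?sqr_ge0// divr_ge0 ?mulr_ge0// ltW.
  have -> : c / (4 * D) = (2 * (2 * D / c))^-1.
    by field; rewrite !gt_eqF.
  have k0 : 0 < 2 * D / c by rewrite divr_gt0// mulr_gt0.
  move: (2 * D / c) k0 => k k0.
  rewrite -subr_ge0 (_ : _ - _ =
     (4 * k)^-1 * ((2 * k * (f x - f y) - (f x + f y)) ^+ 2 + (f x - f y) ^+ 2)).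
    by rewrite mulr_ge0 ?addr_ge0 ?sqr_ge0// invr_ge0 mulr_ge0// ltW.
  by field; rewrite gt_eqF.
have ab x : \sum_y a x y <= D.
  by apply: le_trans (deg_le x); apply: le_trans (deg_ge x); rewrite lerDl.
have tot : \sum_x \sum_y a x y * (f x ^+ 2 + f y ^+ 2) <= 2 * D * \sum_x f x ^+ 2.
  under eq_bigr do (under eq_bigr do rewrite mulrDr; rewrite big_split/=).
  rewrite big_split/= [X in _ + X]exchange_big/= -big_split/= mulr_sumr.
  apply: ler_sum => x _; rewrite -!mulr_suml.
  under [X in _ + X * _]eq_bigr do rewrite a_sym.
  have := ler_wpM2r (sqr_ge0 (f x)) (ab x); lra.
have := energy_ge f; set E2 := \sum_x \sum_y _; set B := \sum_x b x * _.
have B0 : 0 <= B by apply: sumr_ge0 => x _; rewrite mulr_ge0// sqr_ge0.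
have E20 : 0 <= E2.
  by apply: sumr_ge0 => x _; apply: sumr_ge0 => y _; rewrite mulr_ge0// sqr_ge0.
move=> Ege; rewrite big_split/= -/B.
have : \sum_x \sum_y a x y * Num.max 0 (f x ^+ 2 - f y ^+ 2) <=
   2 * D / c * E2 + c / 2 * \sum_x f x ^+ 2.
  apply: (@le_trans _ _ (2 * D / c * E2 +
     c / (4 * D) * \sum_x \sum_y a x y * (f x ^+ 2 + f y ^+ 2))).
    rewrite /E2 !mulr_sumr -big_split/=; apply: ler_sum => x _.
    by rewrite !mulr_sumr -big_split/=; apply: ler_sum.
  rewrite lerD2l (_ : c / 2 * _ = c / (4 * D) * (2 * D * \sum_x f x ^+ 2)).
    by rewrite ler_wpM2l// divr_ge0 ?ltW// mulr_gt0.
  by field; rewrite gt_eqF.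
have k0 : 0 < D / c by rewrite divr_gt0.
rewrite -[2 * D / c]mulrA -[4 * D / c]mulrA; move: (D / c) k0 => k k0.
set S := \sum_x f x ^+ 2; set T := \sum_x \sum_y _; move: (energy f) Ege => e Ege h1 h2.
have : 4 * k * (2^-1 * E2 + B) <= 4 * k * e by rewrite ler_wpM2l// mulr_ge0// ltW.
have : 0 <= k * B by rewrite mulr_ge0// ltW.
by lra.
Qed.

Definition walk_kernel (x y : V) : R := a x y / deg x.

Lemma deg_gt0 x : 0 < deg x.
Proof.
have := iso [set x]; rewrite cards1 big_set1 mulr1 => cx.
apply: lt_le_trans c_gt0 _; apply: le_trans cx _; apply: le_trans (deg_ge x).
by rewrite lerD2r [leRHS](bigID (fun y => y \notin [set x]))/= lerDl sumr_ge0.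
Qed.

Lemma walk_kernel_ge0 x y : 0 <= walk_kernel x y.
Proof. by rewrite divr_ge0// ltW// deg_gt0. Qed.

Lemma walk_kernel_le1 x : \sum_y walk_kernel x y <= 1.
Proof.
rewrite -mulr_suml ler_pdivrMr ?deg_gt0// mul1r.
by apply: le_trans (deg_ge x); rewrite lerDl.
Qed.

Lemma energy_walk f x :
  deg x * f x - \sum_y a x y * f y = deg x * (f x - \sum_y walk_kernel x y * f y).
Proof.
rewrite mulrBr mulr_sumr; congr (_ - _); apply: eq_bigr => y _.
by rewrite /walk_kernel mulrA mulrCA divff ?mulr1// gt_eqF// deg_gt0.
Qed.

Definition mean_exit_time : V -> R := ksolve walk_kernel [set: V] (fun=> 1).

(** No [g] is available yet, so solvability comes from [cheeger]: a solution of [u = K u] has zero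
    energy, hence vanishes. The mean exit time then serves as [g]. *)
Lemma mean_exit_timeE x :
  mean_exit_time x = 1 + \sum_y walk_kernel x y * mean_exit_time y.
Proof.
rewrite /mean_exit_time ksolve_eq ?inE ?mul1r//.
apply: killed_mx_unit => u uE.
have e0 : energy u = 0.
  rewrite /energy big1// => y _; rewrite energy_walk.
  by have := uE y; rewrite inE mul1r => <-; rewrite subrr !mulr0.
have := cheeger u; rewrite e0 mulr0 pmulr_rle0 ?divr_gt0// => S0.
have /eqP : \sum_x u x ^+ 2 = 0.
  by apply/eqP; rewrite eq_le S0 sumr_ge0// => y _; exact: sqr_ge0.
rewrite psumr_eq0 => [/allP h y|y _]; last exact: sqr_ge0.
by have := h y (mem_index_enum y); rewrite sqrf_eq0 => /eqP.
Qed.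

Lemma mean_exit_time_ge0 x : 0 <= mean_exit_time x.
Proof.
have [x0 _ x0min] := @arg_minP _ _ _ x xpredT mean_exit_time isT.
apply: le_trans (x0min x isT); rewrite leNgt; apply/negP => neg.
have : mean_exit_time x0 >= 1 + mean_exit_time x0.
  rewrite [leRHS]mean_exit_timeE lerD2l.
  apply: (@le_trans _ _ (\sum_y walk_kernel x0 y * mean_exit_time x0)).
    rewrite -mulr_suml -[leLHS]mul1r ler_nM2r//; exact: walk_kernel_le1.
  by apply: ler_sum => y _; rewrite ler_wpM2l ?walk_kernel_ge0// x0min.
by rewrite gerDr ler10.
Qed.

(** As [T - K T = 1] for the mean exit time [T], its energy is the sum of [deg * T]. So [cheeger]
    bounds the sum of the squares by [k] times the sum, and [2 k T - k^2 <= T^2] closes the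
    estimate. *)
Lemma mean_exit_time_sum :
  \sum_x mean_exit_time x <= 2 * (4 * D / c + 1) * D / c * #|V|%:R.
Proof.
have := cheeger mean_exit_time.
have -> : energy mean_exit_time = \sum_x mean_exit_time x * deg x.
  apply: eq_bigr => x _; rewrite energy_walk {2}mean_exit_timeE addrK.
  by rewrite mulr1.
set C := 4 * D / c + 1 => h.
have C0 : 0 < C by rewrite addr_gt0// divr_gt0// mulr_gt0.
set k := 2 * C * D / c.
have k0 : 0 < k by rewrite divr_gt0// !mulr_gt0.
have sq : \sum_x mean_exit_time x ^+ 2 <= k * \sum_x mean_exit_time x.
  have c2 : 0 < c / 2 by rewrite divr_gt0.
  rewrite -(ler_pM2l c2); apply: le_trans h _.
  have -> : c / 2 * (k * \sum_x mean_exit_time x) = C * \sum_x mean_exit_time x * D.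
    by rewrite -mulr_suml /k; field; rewrite gt_eqF.
  rewrite ler_wpM2l ?(ltW C0)//; apply: ler_sum => x _.
  by rewrite ler_wpM2l// mean_exit_time_ge0.
have : \sum_x (2 * k * mean_exit_time x - k ^+ 2) <= \sum_x mean_exit_time x ^+ 2.
  by apply: ler_sum => x _; have := sqr_ge0 (mean_exit_time x - k); nra.
rewrite sumrB -mulr_sumr (_ : \sum_(x : V) k ^+ 2 = k ^+ 2 * #|V|%:R); last first.
  by rewrite sumr_const mulr_natr.
move: sq.
move: (\sum_x mean_exit_time x) (\sum_x _) (#|V|%:R) => S Q n sq h2.
rewrite -(ler_pM2l k0); clearbody k; move: sq h2; rewrite expr2; lra.
Qed.

End Cheeger.

Lemma card_bigfcup_le (T : choiceType) (I : Type) (r : seq I) (F : I -> {fset T}) (p : pred I) :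
  (#|` \bigcup_(i <- r | p i) F i| <= \sum_(i <- r | p i) #|` F i|)%N%fset.
Proof.
elim/big_ind2: _ => [|A m B n Am Bn|//]; first by rewrite cardfs0.
by rewrite cardfsU (leq_trans (leq_subr _ _))// leq_add.
Qed.

(** * Isoperimetry inside a finite vertex set *)

Section GraphRestriction.
Variables (R : realType) (VV : choiceType) (adj : rel VV) (W : {fset VV}).
Hypothesis adj_sym : symmetric adj.
Hypothesis nbrs_finite : forall x, finite_set (nbrs adj x).

Let N (x : VV) : {fset VV} := fset_set (nbrs adj x).

Lemma mem_N x y : (y \in N x) = adj x y.
Proof. by rewrite in_fset_set//; apply/idP/idP => [/set_mem|]// ?; apply/mem_set. Qed.

Definition img (A : {set W}) : {fset VV} := [fset x in [seq val y | y <- enum A]]%fset.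

Lemma mem_img (A : {set W}) (x : W) : (val x \in img A) = (x \in A).
Proof. by rewrite inE/= (mem_map val_inj) mem_enum. Qed.

Lemma imgP (A : {set W}) v : v \in img A -> exists2 x, x \in A & v = val x.
Proof. by rewrite inE/= => /mapP[x]; rewrite mem_enum => xA ->; exists x. Qed.

Lemma card_img (A : {set W}) : #|` img A|%fset = #|A|.
Proof.
by rewrite card_fseq undup_id ?size_map -?cardE// (map_inj_uniq val_inj) enum_uniq.
Qed.

Definition outer_degree (x : W) : nat := #|` N (val x) `\` W|%fset.

Lemma sum_adj (A : {set W}) (x : W) :
  \sum_(y in A) (adj (val x) (val y))%:R = #|` N (val x) `&` img A|%fset%:R :> R.
Proof.
rewrite -natr_sum (_ : (N (val x) `&` img A)%fset = img [set y in A | adj (val x) (val y)]).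
  by rewrite card_img -sum1_card natr_sum (natr_sum _ _ _ (fun=> 1%N))
    big_mkcond [RHS]big_mkcond/=; apply: eq_bigr => y _; rewrite inE; case: (y \in A) => //=;
    case: (adj _ _).
apply/fsetP => v; rewrite in_fsetI mem_N; apply/idP/idP => [/andP[xv /imgP[y yA E]]|/imgP[y]].
  by rewrite E mem_img inE yA -E.
by rewrite inE => /andP[yA xy] ->; rewrite xy mem_img.
Qed.

Lemma degree_split (x : W) :
  \sum_(y : W) (adj (val x) (val y))%:R + (outer_degree x)%:R <= (degree adj (val x))%:R :> R.
Proof.
rewrite (eq_bigl [in [set: W]]) => [|y]; last by rewrite inE.
rewrite sum_adj -natrD ler_nat /outer_degree /degree -/(N _).
rewrite -[leqRHS](cardfsID W) leq_add2r fsubset_leq_card//.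
apply/fsubsetP => v; rewrite !in_fsetI => /andP[-> /imgP[y _ ->]]; exact: valP.
Qed.

(** Each boundary vertex ends an edge leaving [A], which either stays in [W] or counts in
    [outer_degree]. Non-amenability thus becomes the hypothesis [iso] for the killed walk, with a
    constant common to all [W]. *)
Lemma boundary_card (A : {set W}) :
  #|` fset_set (boundary adj (img A))|%fset%:R <=
  \sum_(x in A) (\sum_(y | y \notin A) (adj (val x) (val y))%:R + (outer_degree x)%:R) :> R.
Proof.
have sub : (boundary adj (img A) `<=` [set` (\bigcup_(x in A) (N (val x) `\` img A))%fset])%classic.
  move=> v [vA [u /imgP[x xA ->] xv]].
  apply/bigfcupP; exists x; first by rewrite mem_index_enum.
  by rewrite in_fsetD vA mem_N.
have fin : finite_set (boundary adj (img A)) by apply: sub_finite_set sub _.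
apply: (@le_trans _ _ (\sum_(x in A) #|` N (val x) `\` img A|%fset%:R)).
  rewrite -natr_sum ler_nat; apply: leq_trans (card_bigfcup_le _ _ _).
  apply: fsubset_leq_card; apply/fsubsetP => v; rewrite in_fset_set// => /set_mem; exact: sub.
apply: ler_sum => x xA.
rewrite (eq_bigl [in ~: A]) => [|y]; last by rewrite inE.
rewrite sum_adj -natrD ler_nat /outer_degree -(cardfsID W (_ `\` _)%fset) leq_add//.
  apply: fsubset_leq_card; apply/fsubsetP => v; rewrite !(in_fsetI, in_fsetD) -!andbA.
  move=> /and3P[vA -> vW].
  by rewrite -[v]/(val (Sub v vW : W)) mem_img inE -mem_img.
by apply: fsubset_leq_card; apply/fsubsetP => v; rewrite !in_fsetD => /and3P[-> _ ->].
Qed.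

End GraphRestriction.

(** * Asymptotics *)

Section Asymptotics.
Variable R : realType.

Lemma harmonic_sum_le_ln k : (0 < k)%N -> harmonic_sum R k <= 1 + ln k%:R.
Proof.
elim: k => // -[_ _|k IH _]; first by rewrite /harmonic_sum big_ord1 invr1 ln1 addr0.
rewrite harmonic_sumS; have := IH isT.
have k1 : 0 < k.+1%:R :> R by rewrite ltr0n.
have k2 : 0 < k.+2%:R :> R by rewrite ltr0n.
have : ln k.+1%:R <= ln k.+2%:R - k.+2%:R^-1 :> R.
  rewrite -lerBlDl -ln_div ?posrE// (_ : k.+1%:R / k.+2%:R = 1 + - k.+2%:R^-1 :> R).
    by rewrite le_ln1Dx// ltrN2 invf_lt1// ltr1n.
  rewrite -[k.+2%:R]natr1; move: k.+1%:R k1 => x x0.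
  by field; rewrite gt_eqF// addr_gt0.
move: (ln _) (ln _) (_^-1) (harmonic_sum _ _) => ? ? ? ?; lra.
Qed.

Lemma ln_le_harmonic_sum k : ln k.+1%:R <= harmonic_sum R k.
Proof.
elim: k => [|k IH]; first by rewrite /harmonic_sum big_ord0 ln1.
rewrite harmonic_sumS.
have k1 : 0 < k.+1%:R :> R by rewrite ltr0n.
have k2 : 0 < k.+2%:R :> R by rewrite ltr0n.
have : ln k.+2%:R <= ln k.+1%:R + k.+1%:R^-1 :> R.
  rewrite -lerBlDl -ln_div ?posrE// (_ : k.+2%:R / k.+1%:R = 1 + k.+1%:R^-1 :> R).
    by rewrite le_ln1Dx// (lt_trans (ltrN10 _))// invr_gt0.
  rewrite -[k.+2%:R]natr1; move: k.+1%:R k1 => x x0.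
  by field; rewrite gt_eqF.
move: (ln _) (ln _) (_^-1) (harmonic_sum _ _) IH => ? ? ? ? ?; lra.
Qed.

Lemma ln_nat_large (B : R) : exists N, forall n, (N <= n)%N -> B <= ln n%:R.
Proof.
exists (Num.truncn (expR B)).+1 => n Nn.
have le : expR B <= n%:R.
  by apply: le_trans (ltW (truncnS_gt _)) _; rewrite ler_nat.
by rewrite -[leLHS]expRK ler_ln ?posrE ?expR_gt0// (lt_le_trans (expR_gt0 _) le).
Qed.

(** * Cutoff from the Chebyshev bounds *)

Section Cutoff.
Variables (tau : nat -> R) (u : nat -> nat -> R) (ts : R -> nat -> nat) (c : R) (n0 : nat).
Hypothesis c_gt0 : 0 < c.
Hypothesis tau_bounds : forall n, (n0 <= n)%N ->
  c * (n%:R * ln n%:R) <= tau n <= 2 * (n%:R * ln n%:R).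
Hypothesis u01 : forall n t, (n0 <= n)%N -> 0 <= u n t <= 1.
Hypothesis above : forall n t, (n0 <= n)%N -> tau n <= t%:R ->
  u n t * (t%:R - tau n) ^+ 2 <= n%:R * tau n.
Hypothesis below : forall n t, (n0 <= n)%N -> t%:R <= tau n ->
  (1 - u n t) * (tau n - t%:R) ^+ 2 <= n%:R * tau n.
Hypothesis tsP : forall eps n, 0 < eps -> (n0 <= n)%N ->
  u n (ts eps n) <= eps /\ forall s, u n s <= eps -> (ts eps n <= s)%N.

Let w n : R := n%:R * Num.sqrt (ln n%:R).

Lemma window_sqr n : 0 <= ln n%:R :> R -> w n ^+ 2 = n%:R * (n%:R * ln n%:R).
Proof. by move=> l0; rewrite /w exprMn sqr_sqrtr//; ring. Qed.

(** The ratio of [n ln n] to the window is [sqrt (ln n)], which diverges; [1 <= w n] lets the window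
    absorb the rounding of times to integers. *)
Lemma window_small (d : R) : 0 < d -> exists N, forall n, (N <= n)%N ->
  [/\ (n0 <= n)%N, 1 <= ln n%:R :> R, 1 <= n%:R :> R, 1 <= w n
    & w n <= d * (n%:R * ln n%:R)].
Proof.
move=> d0; have [N1 h1] := ln_nat_large 1; have [N2 h2] := ln_nat_large (d^-1 ^+ 2).
exists (maxn n0 (maxn 1 (maxn N1 N2))) => n.
rewrite !geq_max => /and4P[nn0 n1 /h1 l1 /h2 l2].
have l0 : 0 <= ln n%:R :> R by apply: le_trans l1.
have n1' : 1 <= n%:R :> R by rewrite ler1n.
have s1 : 1 <= Num.sqrt (ln n%:R) :> R by rewrite -[leLHS]sqrtr1 ler_wsqrtr.
have sd : d^-1 <= Num.sqrt (ln n%:R).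
  by rewrite -[leLHS](@ger0_norm _ d^-1) ?invr_ge0 ?(ltW d0)// -sqrtr_sqr ler_wsqrtr.
split=> //; first by rewrite -[leLHS](mulr1 1) ler_pM// ler01.
rewrite /w mulrCA ler_wpM2l//.
rewrite -{2}(sqr_sqrtr l0); move: sd; move: (Num.sqrt _) s1 => s s1 sd.
have : 1 <= d * s by rewrite -ler_pdivrMl// mulr1.
have s0 : 0 <= s by apply: le_trans s1.
by move=> ds; rewrite expr2 mulrA ler_peMl.
Qed.

Lemma sqr_le_window (x y k : R) : 0 <= y -> 0 <= k -> x ^+ 2 <= k * y ^+ 2 -> x <= (k + 1) * y.
Proof.
move=> y0 k0 h; rewrite leNgt; apply/negP => yx.
have ky : 0 <= (k + 1) * y by rewrite mulr_ge0// addr_ge0.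
have : ((k + 1) * y) ^+ 2 < x ^+ 2.
  by rewrite ltr_pXn2r ?nnegrE//; exact: le_trans ky (ltW yx).
rewrite exprMn; move: h; have := sqr_ge0 y; move: (y ^+ 2) (x ^+ 2) => Y X Y0 h1 h2.
have kk : k * Y <= (k + 1) ^+ 2 * Y by rewrite ler_wpM2r//; nra.
by lra.
Qed.

Lemma t_sep_window (eps : R) : 0 < eps < 1 -> exists2 k : R, 0 < k &
  exists N, forall n, (N <= n)%N -> `|(ts eps n)%:R - tau n| <= k * w n.
Proof.
(* The fractions come from the two Chebyshev bounds with [n * tau <= 2 w^2]. Of the remaining 2, one
   unit is lost in [sqr_le_window], and one pays for applying minimality of [ts] at its predecessor
   [s]. *)
move=> /andP[e0 e1]; pose k := 2 / eps + 2 / (1 - eps) + 2.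
have e1' : 0 < 1 - eps by rewrite subr_gt0.
have p1 : 0 < 2 / eps by rewrite divr_gt0.
have p2 : 0 < 2 / (1 - eps) by rewrite divr_gt0.
exists k; first by rewrite !addr_gt0.
have [N hN] := window_small ltr01; exists N => n /hN[nn0 l1 n1 w1 _].
have l0 : 0 <= ln n%:R :> R by apply: le_trans l1.
have [uts tsmin] := tsP e0 nn0.
have /andP[_ tau2] := tau_bounds nn0.
have nt : n%:R * tau n <= 2 * w n ^+ 2.
  by rewrite window_sqr// mulrCA ler_wpM2l.
have w0 : 0 <= w n by apply: le_trans w1.
rewrite ler_norml; apply/andP; split.
  have [tt|tt] := leP (tau n) (ts eps n)%:R.
    have : 0 <= k * w n by rewrite mulr_ge0// ltW// !addr_gt0.
    lra.
  have b := below nn0 (ltW tt).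
  suff : tau n - (ts eps n)%:R <= (2 / (1 - eps) + 1) * w n.
    have := mulr_ge0 (ltW p1) w0; rewrite /k; lra.
  apply: sqr_le_window => //; first exact: ltW.
  rewrite mulrAC ler_pdivlMr// mulrC; apply: le_trans nt; apply: le_trans b.
  by rewrite ler_wpM2r ?sqr_ge0// lerD2l lerN2.
case E : (ts eps n) => [|s].
  have : 0 <= tau n.
    have /andP[+ _] := tau_bounds nn0; apply: le_trans.
    by rewrite mulr_ge0 ?mulr_ge0 ?(ltW c_gt0)// (le_trans ler01).
  have : 0 <= k * w n by rewrite mulr_ge0// ltW// !addr_gt0.
  lra.
have us : eps < u n s.
  by rewrite ltNge; apply/negP => /tsmin; rewrite E ltnn.
suff : s%:R - tau n <= (2 / eps + 1) * w n.
  have := mulr_ge0 (ltW p2) w0; rewrite /k -natr1; lra.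
have [ts'|ts'] := leP s%:R (tau n).
  have : 0 <= (2 / eps + 1) * w n by rewrite mulr_ge0// ltW// addr_gt0.
  lra.
have a := above nn0 (ltW ts').
apply: sqr_le_window => //; first exact: ltW.
rewrite mulrAC ler_pdivlMr// mulrC; apply: le_trans nt; apply: le_trans a.
by rewrite ler_wpM2r ?sqr_ge0// ltW.
Qed.

Local Open Scope classical_set_scope.

Lemma t_sep_Theta :
  (fun n => (ts 2^-1 n)%:R : R) \is 'Theta_\oo (fun n => n%:R * ln n%:R : R).
Proof.
have [|k k0 [N1 h1]] := @t_sep_window 2^-1.
  by rewrite invr_gt0 ltr0n/= invf_lt1// ltr1n.
have d0 : 0 < c / (2 * k) by rewrite divr_gt0// mulr_gt0.
have [N2 h2] := window_small d0.
rewrite qualifE; apply/asboolP; exists (c / 2, 2 + c / 2) => /=.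
  by rewrite !divr_gt0// addr_gt0// divr_gt0.
exists (maxn N1 N2) => // n /=; rewrite geq_max => /andP[/h1 close /h2[nn0 l1 n1 _ wd]].
have X0 : 0 <= n%:R * ln n%:R :> R by rewrite mulr_ge0// (le_trans ler01).
have /andP[t1 t2] := tau_bounds nn0.
rewrite !ger0_norm//; move: (n%:R * ln n%:R) X0 t1 t2 wd => X X0 t1 t2 wd.
have kw : k * w n <= c / 2 * X.
  rewrite (_ : c / 2 * X = k * (c / (2 * k) * X)); first by rewrite ler_wpM2l// ltW.
  by field; rewrite gt_eqF.
move: close; rewrite ler_norml => /andP[cl1 cl2].
split; lra.
Qed.

Lemma t_sep_window_bigO (eps : R) : 0 < eps < 2^-1 ->
  (fun n => (ts eps n)%:R - (ts (1 - eps) n)%:R : R) =O_\oo w.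
Proof.
move=> /andP[e0 e2].
have e1 : eps < 1 by apply: lt_trans e2 _; rewrite invf_lt1// ltr1n.
have [|k k0 [N1 h1]] := @t_sep_window eps; first by rewrite e0 e1.
have [|k' k'0 [N2 h2]] := @t_sep_window (1 - eps).
  by rewrite subr_gt0 e1 ltrBlDr ltrDl.
have [N3 h3] := window_small ltr01.
apply/eqO_exP; exists (k + k'); first by rewrite addr_gt0.
exists (maxn N1 (maxn N2 N3)) => // n /=; rewrite !geq_max.
move=> /and3P[/h1 c1 /h2 c2 /h3[_ _ _ w1 _]].
have w0 : 0 <= w n by apply: le_trans w1.
rewrite (ger0_norm w0) mulrDl.
rewrite (_ : _ - _ = ((ts eps n)%:R - tau n) - ((ts (1 - eps) n)%:R - tau n)); last by ring.
by apply: le_trans (ler_normB _ _) _; rewrite lerD.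
Qed.

Lemma cutoff (alpha : R) : 0 <= alpha ->
  let d n := u n (Num.truncn (alpha * (ts 2^-1 n)%:R)) in
  (alpha < 1 -> d n @[n --> \oo] --> (1 : R)) /\
  (1 < alpha -> d n @[n --> \oo] --> (0 : R)).
Proof.
move=> a0 d.
have [|k k0 [N1 h1]] := @t_sep_window 2^-1.
  by rewrite invr_gt0 ltr0n/= invf_lt1// ltr1n.
(* [alpha * ts], rounded down, is within [alpha * k * w n + w n] of [alpha * tau], eventually below
   [b / 2 * tau n]: half of the gap [b * tau n] survives. *)
have far (b : R) : 0 < b -> (alpha = 1 - b \/ alpha = 1 + b) ->
    exists N, forall n, (N <= n)%N ->
      [/\ (n0 <= n)%N, 1 <= ln n%:R :> R, 1 <= n%:R :> R
        & if alpha < 1 then b / 2 * tau n <= tau n - (Num.truncn (alpha * (ts 2^-1 n)%:R))%:R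
          else b / 2 * tau n <= (Num.truncn (alpha * (ts 2^-1 n)%:R))%:R - tau n].
  move=> b0 ab.
  have d0 : 0 < b * c / (2 * (alpha * k + 1)).
    by rewrite divr_gt0 ?mulr_gt0// ltr_wpDl// mulr_ge0// ltW.
  have [N2 h2] := window_small d0; exists (maxn N1 N2) => n.
  rewrite geq_max => /andP[/h1 close /h2[nn0 l1 n1 w1 wd]]; split=> //.
  have X0 : 0 <= n%:R * ln n%:R :> R by rewrite mulr_ge0// (le_trans ler01).
  have /andP[t1 _] := tau_bounds nn0.
  have kw : (alpha * k + 1) * w n <= b / 2 * tau n.
    have ak : 0 < alpha * k + 1 by rewrite ltr_wpDl// mulr_ge0// ltW.
    apply: (@le_trans _ _ (b / 2 * (c * (n%:R * ln n%:R)))); last first.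
      by rewrite ler_wpM2l// divr_ge0// ltW.
    rewrite (_ : _ * (c * _) = (alpha * k + 1) * (b * c / (2 * (alpha * k + 1)) * (n%:R * ln n%:R))).
      by rewrite ler_wpM2l// ltW.
    by field; rewrite gt_eqF.
  have ts0 : 0 <= alpha * (ts 2^-1 n)%:R by rewrite mulr_ge0.
  have /andP[tr1 tr2] := truncn_itv ts0.
  move: close; rewrite ler_norml => /andP[cl1 cl2].
  have c1 := ler_wpM2l a0 cl1; have c2 := ler_wpM2l a0 cl2.
  move: tr2; rewrite -[X in _ < X]natr1 => tr2.
  move: kw; rewrite mulrDl mul1r -mulrA => kw.
  case: ltP => ha; case: ab => ab; rewrite ?ab in ha; try lra.
    have : alpha * tau n = tau n - b * tau n by rewrite ab; ring.
    lra.
  have : alpha * tau n = tau n + b * tau n by rewrite ab; ring.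
  lra.
(* Chebyshev gives [v <= 4 n / (b^2 tau)], at most [4 / (b^2 c ln n)]; hence the threshold on
   [ln n]. *)
have small (b : R) : 0 < b -> forall e : R, 0 < e ->
   exists N, forall n, (N <= n)%N -> (n0 <= n)%N ->
   1 <= ln n%:R :> R -> 1 <= n%:R :> R ->
   forall v x, 0 <= v -> b / 2 * tau n <= x -> v * x ^+ 2 <= n%:R * tau n -> v <= e.
  move=> b0 e e0; have [N hN] := ln_nat_large (4 / (b ^+ 2 * c * e)).
  exists N => n /hN lnN nn0 l1 n1 v x v0 xb vx.
  have /andP[t1 _] := tau_bounds nn0.
  have n_gt0 : 0 < n%:R :> R by apply: lt_le_trans n1.
  have l_gt0 : 0 < ln n%:R :> R by apply: lt_le_trans l1.
  have t0 : 0 < tau n by apply: lt_le_trans t1; rewrite !mulr_gt0.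
  have x2 : (b / 2 * tau n) ^+ 2 <= x ^+ 2.
    have bt : 0 <= b / 2 * tau n by rewrite mulr_ge0 ?(ltW t0)// divr_ge0// ltW.
    by rewrite ler_pXn2r ?nnegrE//; exact: le_trans bt xb.
  have : v * (b ^+ 2 * tau n) <= 4 * n%:R.
    rewrite -(ler_pM2r t0) -mulrA.
    apply: (@le_trans _ _ (4 * (v * x ^+ 2))); last first.
      by rewrite -mulrA ler_pM2l ?ltr0n.
    rewrite [leRHS]mulrCA ler_wpM2l//.
    apply: (@le_trans _ _ (4 * (b / 2 * tau n) ^+ 2)); last by rewrite ler_pM2l ?ltr0n.
    rewrite le_eqVlt; apply/orP; left; apply/eqP; by field.
  have b2 : 0 < b ^+ 2 by rewrite exprn_gt0.
  have : 4 * n%:R <= e * (b ^+ 2 * tau n).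
    apply: (@le_trans _ _ (e * (b ^+ 2 * (c * (n%:R * ln n%:R))))); last first.
      by rewrite ler_pM2l// ler_pM2l.
    move: lnN; rewrite ler_pdivrMr ?mulr_gt0// => lnN.
    have := ler_wpM2l (ltW n_gt0) lnN; lra.
  move=> h1' h2'.
  have bt : 0 < b ^+ 2 * tau n by exact: mulr_gt0.
  by rewrite -(ler_pM2r bt); exact: le_trans h2' h1'.
split=> ha.
  have b0 : 0 < 1 - alpha by rewrite subr_gt0.
  have [|N2 h2] := far _ b0; first by left; ring.
  apply/cvgrPdist_le => e e0; have [N3 h3] := small _ b0 e e0.
  exists (maxn N2 N3) => // n /=; rewrite geq_max => /andP[/h2[nn0 l1 n1 hf] n3].
  rewrite ha in hf; have /andP[d0 d1] := u01 (Num.truncn (alpha * (ts 2^-1 n)%:R)) nn0.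
  rewrite ger0_norm ?subr_ge0//.
  apply: (h3 n n3 nn0 l1 n1 _ _ _ hf); first by rewrite subr_ge0.
  apply: below => //; rewrite -subr_ge0; apply: le_trans hf.
  rewrite mulr_ge0 ?divr_ge0 ?(ltW b0)//.
  have /andP[t1 _] := tau_bounds nn0; apply: le_trans t1.
  by rewrite !mulr_ge0 ?(ltW c_gt0)// (le_trans ler01).
have b0 : 0 < alpha - 1 by rewrite subr_gt0.
have [|N2 h2] := far _ b0; first by right; ring.
apply/cvgrPdist_le => e e0; have [N3 h3] := small _ b0 e e0.
exists (maxn N2 N3) => // n /=; rewrite geq_max => /andP[/h2[nn0 l1 n1 hf] n3].
rewrite ltNge (ltW ha)/= in hf; have /andP[d0 d1] := u01 (Num.truncn (alpha * (ts 2^-1 n)%:R)) nn0.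
rewrite sub0r normrN ger0_norm//.
apply: (h3 n n3 nn0 l1 n1 _ _ _ hf) => //.
apply: above => //; rewrite -subr_ge0; apply: le_trans hf.
rewrite mulr_ge0 ?divr_ge0 ?(ltW b0)//.
have /andP[t1 _] := tau_bounds nn0; apply: le_trans t1.
by rewrite !mulr_ge0 ?(ltW c_gt0)// (le_trans ler01).
Qed.

End Cutoff.
End Asymptotics.

(** [C] depends only on the isoperimetric constant [c] and on a degree bound [D], raised by 1 to be
    positive, so it is uniform in [W]. *)
Lemma nonamenable_exit_time (R : realType) (VV : choiceType) (adj : rel VV) :
  symmetric adj -> nonamenable R adj -> bounded_degree adj ->
  exists2 C : R, 0 < C & forall W : {fset VV},
    let K (x y : W) := rw_kernel R adj (val x) (val y) in
    [/\ forall x y, 0 <= K x y, forall x, \sum_y K x y <= 1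
      & exists g : W -> R, [/\ forall x, 0 <= g x,
          forall x, 1 + \sum_y K x y * g y <= g x
        & \sum_x ksolve K [set: W] (fun=> 1) x <= C * #|` W|%fset%:R]].
Proof.
move=> adj_sym c_gt0 [D0 degD]; rewrite /nonamenable in c_gt0.
set S := (X in inf X) in c_gt0; set c := inf S in c_gt0.
pose D : R := D0.+1%:R.
have nfin x : finite_set (nbrs adj x) by case: (degD x).
have D_gt0 : 0 < D by rewrite ltr0n.
have C_gt0 : 0 < 2 * (4 * D / c + 1) * D / c.
  by rewrite divr_gt0// mulr_gt0// mulr_gt0// addr_gt0// divr_gt0// mulr_gt0.
exists (2 * (4 * D / c + 1) * D / c) => // W K.
pose a (x y : W) : R := (adj (val x) (val y))%:R.
pose b (x : W) : R := (outer_degree adj x)%:R.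
pose deg (x : W) : R := (degree adj (val x))%:R.
have a_sym x y : a x y = a y x by rewrite /a adj_sym.
have a_ge0 x y : 0 <= a x y by [].
have b_ge0 x : 0 <= b x by [].
have deg_ge x : \sum_y a x y + b x <= deg x by exact: degree_split.
have deg_le x : deg x <= D.
  by rewrite ler_nat (leq_trans _ (leqnSn _))//; case: (degD (val x)).
have iso (A : {set W}) :
    c * #|A|%:R <= \sum_(x in A) (\sum_(y | y \notin A) a x y + b x).
  apply: le_trans (boundary_card R nfin A).
  have [A0|A0] := posnP #|A|; first by rewrite A0 mulr0.
  rewrite -ler_pdivlMr ?ltr0n//; apply: ge_inf.
    by exists 0 => _ [B [_ ->]]; rewrite divr_ge0.
  exists (img A); rewrite card_img; split=> //.
  by rewrite -cardfs_gt0 card_img.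
have KE : K = walk_kernel a deg.
  apply/funext => x; apply/funext => y; rewrite /K /rw_kernel /walk_kernel /a /deg.
  by case: (adj _ _); rewrite ?mul1r ?mul0r.
rewrite KE; split.
- exact: (walk_kernel_ge0 a_ge0 deg_ge c_gt0 iso).
- exact: (walk_kernel_le1 a_ge0 b_ge0 deg_ge c_gt0 iso).
exists (mean_exit_time a deg); split.
- exact: (mean_exit_time_ge0 a_sym a_ge0 b_ge0 deg_ge deg_le c_gt0 D_gt0 iso).
- move=> x.
  by rewrite -(mean_exit_timeE a_sym a_ge0 b_ge0 deg_ge deg_le c_gt0 D_gt0 iso).
- rewrite cardfE.
  exact: (mean_exit_time_sum a_sym a_ge0 b_ge0 deg_ge deg_le c_gt0 D_gt0 iso).
Qed.

(** * Uniform insertion: hitting probabilities and filling time *)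

Section UniformInsertion.
Variables (R : realType) (V : finType) (K : V -> V -> R) (g : V -> R) (C : R) (n : nat).
Hypothesis K_ge0 : forall x y, 0 <= K x y.
Hypothesis K_le1 : forall x, \sum_y K x y <= 1.
Hypothesis g_ge0 : forall x, 0 <= g x.
Hypothesis g_super : forall x, 1 + \sum_y K x y * g y <= g x.
Hypothesis C_gt0 : 0 < C.
Hypothesis exit_le : \sum_x ksolve K [set: V] (fun=> 1) x <= C * n%:R.
Hypothesis card_V : #|V| = n.
Hypothesis n_gt0 : (0 < n)%N.

Let nu (_ : V) : R := n%:R^-1.
Notation hit z := (settle K nu [set~ z] z).

Let nR : 0 < n%:R :> R. Proof. by rewrite ltr0n. Qed.

Lemma uniform_sum : \sum_x nu x = 1.
Proof. by rewrite sumr_const card_V -[LHS]mulr_natr mulVf// gt_eqF. Qed.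

Lemma uniform_ge (x : V) : n%:R^-1 <= nu x.
Proof. by []. Qed.

Lemma uniform_hit_sum : \sum_z hit z <= C.
Proof.
rewrite exchange_big/=.
apply: (@le_trans _ _ (\sum_x nu x * ksolve K [set: V] (fun=> 1) x)).
  apply: ler_sum => x _; rewrite -mulr_sumr ler_wpM2l ?invr_ge0//.
  exact: (sum_hit_le K_ge0 g_ge0 g_super).
by rewrite -mulr_sumr ler_pdivrMl// mulrC.
Qed.

Lemma uniform_hit_small : exists x, hit x <= C / n%:R.
Proof.
apply: contrapT => /forallNP none; have := uniform_hit_sum; apply/negP; rewrite -ltNge.
have [x _] : exists x, x \in V by apply/card_gt0P; rewrite card_V.
have hx z : C / n%:R < hit z by rewrite ltNge; apply/negP/none.
have -> : C = \sum_(z : V) C / n%:R.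
  by rewrite sumr_const card_V -[RHS]mulr_natr divfK// gt_eqF.
rewrite (bigD1 x)//= [ltRHS](bigD1 x)//= ltr_leD// ler_sum// => z _.
exact: ltW.
Qed.

Lemma fill_time_ge_nlnn : (4 <= n)%N ->
  (4 * C)^-1 * (n%:R * ln n%:R) <= fill_time K nu finset.set0.
Proof.
(* By Markov's inequality and [uniform_hit_sum], [S] contains at least half of the sites. *)
move=> n4; pose S := [set z | hit z <= 2 * C / n%:R].
have c0 : 0 < 2 * C / n%:R by rewrite divr_gt0// mulr_gt0.
have hit0 z : 0 <= hit z by rewrite (settle_ge0 K_ge0 g_ge0 g_super (M := n%:R)).
have SC : (#|~: S| * 2 <= n)%N.
  have le : 2 * C / n%:R * #|~: S|%:R <= C.
    apply: le_trans uniform_hit_sum; rewrite mulr_natr -sumr_const.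
    rewrite [leRHS](bigID [in ~: S])/= ler_wpDr ?sumr_ge0//.
    by apply: ler_sum => z; rewrite !inE -ltNge => /ltW.
  rewrite -(ler_nat R) natrM -(ler_pM2l C_gt0) [leRHS]mulrC.
  rewrite [leLHS](_ : _ = n%:R * (2 * C / n%:R * #|~: S|%:R)).
    by rewrite ler_wpM2l.
  by field; rewrite gt_eqF.
have Sn : (n <= #|S| * 2)%N by have := cardsC S; rewrite card_V; lia.
have le := fill_time_ge K_ge0 g_ge0 g_super nR uniform_ge (S := S) finset.set0 c0.
apply: le_trans (le _) => [|z]; last by rewrite inE.
rewrite finset.setD0 !invfM invrK.
(* From [n <= 2 #|S|] and [2 #|S| <= #|S|.+1 ^ 2]. This factor 2 and the one in the threshold of [S]
   make up the 4 of the statement. *)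
have lnS : ln n%:R <= 2 * harmonic_sum R #|S|.
  have S2 : 2 * ln #|S|.+1%:R = ln (#|S|.+1 ^ 2)%:R :> R.
    by rewrite natrX lnXn ?ltr0n// mulr_natl.
  apply: (@le_trans _ _ (2 * ln #|S|.+1%:R)); last by rewrite ler_pM2l// ln_le_harmonic_sum.
  rewrite S2 ler_ln ?posrE ?ltr0n ?expn_gt0// ler_nat.
  by rewrite expnS expn1; nia.
have C1 : 0 < C^-1 by rewrite invr_gt0.
have := ler_wpM2l (mulr_ge0 (ltW C1) (ltW nR)) lnS; lra.
Qed.

Lemma fill_time_le_nlnn : 1 <= ln n%:R :> R ->
  fill_time K nu finset.set0 <= 2 * (n%:R * ln n%:R).
Proof.
move=> l1; have := fill_time_le K_ge0 g_ge0 g_super nR uniform_ge finset.set0.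
rewrite finset.setC0 cardsT card_V => /le_trans; apply.
rewrite mulrCA ler_wpM2l//; have := harmonic_sum_le_ln R n_gt0; lra.
Qed.

End UniformInsertion.

Local Open Scope classical_set_scope.

Theorem corollary1 (R : realType) (VV : choiceType) (adj : rel VV)
  (adj_sym : symmetric adj) (adj_irr : irreflexive adj)
  (VV_infinite : infinite_set [set: VV])
  (adj_connected : connected_graph adj)
  (adj_nonamenable : nonamenable R adj)
  (adj_bounded : bounded_degree adj)
  (Vn : nat -> {fset VV}) (card_Vn : forall n, (0 < n)%N -> #|` Vn n|%fset = n)
  (lambda : nat -> R) (lambda_gt0 : forall n, (0 < n)%N -> 0 < lambda n) :
  let K n (x y : Vn n) : R := rw_kernel R adj (val x) (val y) in
  let nu n (x : Vn n) : R := n%:R^-1 in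
  let P n := ARW (K n) (lambda n) (nu n) in
  [/\ (fun n => t_rel (P n)) \is 'Theta_\oo (fun n => n%:R : R),
      (fun n => (t_sep (P n) 2^-1)%:R : R)
        \is 'Theta_\oo (fun n => n%:R * ln n%:R : R)
    & separation_cutoff_with_window P
        (fun n => n%:R * Num.sqrt (ln n%:R))].
Proof.
move=> K nu P.
have [C C0 exitC] := nonamenable_exit_time adj_sym adj_nonamenable adj_bounded.
have [N1 lnN1] := ln_nat_large (1 : R).
pose n0 := maxn 4 N1.
have n0P n : (n0 <= n)%N -> [/\ (4 <= n)%N, (0 < n)%N & 1 <= ln n%:R :> R].
  by rewrite geq_max => /andP[n4 /lnN1 l1]; split=> //; exact: leq_trans n4.
pose tau n := fill_time (K n) (nu n) finset.set0.
pose u n t := d_sep (P n) t.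
pose ts eps n := t_sep (P n) eps.
have cardV n : (0 < n)%N -> #|fset_sub_type (Vn n)| = n by move=> n0'; rewrite -cardfE card_Vn.
have nR n : (0 < n)%N -> 0 < n%:R :> R by rewrite ltr0n.
have uE n t : (0 < n)%N -> u n t = unfilled (K n) (nu n) t finset.set0.
  move=> n_gt0; have [K0 K1 [g [g0 gs _]]] := exitC (Vn n).
  exact: (d_sepE K0 K1 g0 gs (lambda_gt0 n n_gt0) (uniform_sum R (cardV n n_gt0) n_gt0)
    (nR n n_gt0) (uniform_ge _ _)).
have tau_bounds n : (n0 <= n)%N ->
    (4 * C)^-1 * (n%:R * ln n%:R) <= tau n <= 2 * (n%:R * ln n%:R).
  move=> /n0P[n4 n_gt0 l1]; have [K0 K1 [g [g0 gs gC]]] := exitC (Vn n).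
  rewrite card_Vn// in gC; apply/andP; split.
    exact: (fill_time_ge_nlnn K0 g0 gs C0 gC (cardV n n_gt0) n_gt0 n4).
  exact: (fill_time_le_nlnn K0 g0 gs (cardV n n_gt0) n_gt0 l1).
(* Centred at the mean filling time, the moment keeps only its variance part, where [M = n] for the
   uniform law. *)
have moment n : fill_moment (K n) (nu n) n%:R finset.set0 (tau n) = n%:R * tau n.
  by rewrite /fill_moment subrr expr0n addr0.
have above n t : (n0 <= n)%N -> tau n <= t%:R ->
    u n t * (t%:R - tau n) ^+ 2 <= n%:R * tau n.
  move=> /n0P[_ n_gt0 _] tt; have [K0 K1 [g [g0 gs _]]] := exitC (Vn n).
  rewrite uE// -moment.
  exact: (unfilled_chebyshev_above K0 K1 g0 gs (uniform_sum R (cardV n n_gt0) n_gt0)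
    (nR n n_gt0) (uniform_ge _ _)).
have below n t : (n0 <= n)%N -> t%:R <= tau n ->
    (1 - u n t) * (tau n - t%:R) ^+ 2 <= n%:R * tau n.
  move=> /n0P[_ n_gt0 _] tt; have [K0 K1 [g [g0 gs _]]] := exitC (Vn n).
  rewrite uE// -moment.
  exact: (unfilled_chebyshev_below K0 K1 g0 gs (uniform_sum R (cardV n n_gt0) n_gt0)
    (nR n n_gt0) (uniform_ge _ _)).
have u01 n t : (n0 <= n)%N -> 0 <= u n t <= 1.
  move=> /n0P[_ n_gt0 _]; have [K0 K1 [g [g0 gs _]]] := exitC (Vn n).
  rewrite uE//; apply/andP; split.
    exact: (unfilled_ge0 K0 K1 g0 gs (uniform_sum R (cardV n n_gt0) n_gt0)
      (nR n n_gt0) (uniform_ge _ _)).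
  exact: (unfilled_le1 K0 K1 g0 gs (uniform_sum R (cardV n n_gt0) n_gt0)
      (nR n n_gt0) (uniform_ge _ _)).
have tsP eps n : 0 < eps -> (n0 <= n)%N ->
    u n (ts eps n) <= eps /\ forall s, u n s <= eps -> (ts eps n <= s)%N.
  move=> e0 /n0P[_ n_gt0 _]; have [K0 K1 [g [g0 gs _]]] := exitC (Vn n).
  have [h1 h2] := t_sepP K0 K1 g0 gs (lambda_gt0 n n_gt0) (uniform_sum R (cardV n n_gt0) n_gt0)
    (nR n n_gt0) (uniform_ge _ _) e0.
  by rewrite uE//; split=> // s; rewrite uE//; exact: h2.
have c0 : 0 < (4 * C)^-1 by rewrite invr_gt0 mulr_gt0.
split; [|exact: (t_sep_Theta c0 tau_bounds above below tsP)|split].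
(* A site with [hit x <= C / n] gives the lower constant [C^-1]; the upper constant 1 comes from
   [M = n]. *)
- rewrite qualifE; apply/asboolP; exists (C^-1, 1) => /=; first by rewrite invr_gt0 C0 ltr01.
  exists n0 => // n /= /n0P[_ n_gt0 _]; have [K0 K1 [g [g0 gs gC]]] := exitC (Vn n).
  rewrite card_Vn// in gC.
  have [x hx] := uniform_hit_small K0 g0 gs gC (cardV n n_gt0) n_gt0.
  have /andP[lo hi] := t_rel_bounds K0 K1 g0 gs (lambda_gt0 n n_gt0)
    (uniform_sum R (cardV n n_gt0) n_gt0) (nR n n_gt0) (uniform_ge _ _) x.
  have h0 : 0 < settle (K n) (nu n) [set~ x]%SET x.
    by apply: (settle_gt0 K0 g0 gs (nR n n_gt0) (uniform_ge _ _)); rewrite !inE negbK.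
  have t0 : 0 <= t_rel (P n) by apply: le_trans lo; rewrite invr_ge0 ltW.
  rewrite !ger0_norm// mul1r; split=> //; apply: le_trans lo.
  rewrite -[leLHS]invrK lef_pV2 ?posrE ?invr_gt0 ?mulr_gt0 ?invr_gt0 ?nR//.
  by rewrite invfM invrK.
- exact: (cutoff c0 tau_bounds u01 above below tsP).
- exact: (t_sep_window_bigO c0 tau_bounds above below tsP).
Qed.
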